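(* Let $(M,\omega)$ be a connected symplectic manifold (open or closed). Let $X_0,X_1,Y_0,Y_1\subset M$ be compact sets with $X_0\cap X_1=Y_0\cap Y_1=\emptyset$ and $$pb_4(\mathrm{stab}_RX_0,\mathrm{stab}_RX_1,\mathrm{stab}_RY_0,\mathrm{stab}_RY_1)=p>0$$ for some $R\in(1,+\infty]$. Let $G\in C_c^\infty(M\times S^1)$ be a (non-autonomous) $1$-periodic Hamiltonian, $G_t=G(\cdot,t)$, with $G_t|_{Y_0}\le 0$ and $G_t|_{Y_1}\ge 1$ for all $t\in S^1$ and $\max G-\min G<R$, generating the Hamiltonian flow $g_t$. Then there exist a point $x\in M$ and times $t_0,t_1\in\mathbb R$ with $|t_0-t_1|\le 1/p$ such that $g_{t_0}x\in X_0$ and $g_{t_1}x\in X_1$.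
   Context: $S^1=\mathbb R/\mathbb Z$. $T^*S^1=\mathbb R\times S^1$ has coordinates $r$ and $\theta\ (\mathrm{mod}\ 1)$ and symplectic form $dr\wedge d\theta$. For $0<R\le\infty$, $\mathbb A_R=\{|r|<R\}\subset T^*S^1$. For a compact subset $X\subset M$, its $R$-stabilization is $\mathrm{stab}_RX=X\times S^1\subset(M\times\mathbb A_R,\ \omega+dr\wedge d\theta)$, where $S^1$ is identified with the zero section $\{r=0\}$. On a symplectic manifold $(N,\Omega)$, the Hamiltonian vector field of $F$ is given by $i_{\mathrm{sgrad}F}\,\Omega=-dF$ and $\{F,G\}=\Omega(\mathrm{sgrad}\,G,\mathrm{sgrad}\,F)$; $\|F\|=\max|F|$. For compact subsets $A_0,A_1,B_0,B_1\subset N$ with $A_0\cap A_1=B_0\cap B_1=\emptyset$, $pb_4(A_0,A_1,B_0,B_1)=\inf\|\{F,G\}\|$ over all $F,G\in C_c^\infty(N)$ with $F|_{A_0}\le 0$, $F|_{A_1}\ge 1$, $G|_{B_0}\le 0$, $G|_{B_1}\ge 1$. In the theorem $pb_4$ is taken in $N=M\times\mathbb A_R$. The flow $g_t$ is the flow of the time-dependent vector field $\mathrm{sgrad}\,G_t$ on $M$ with $g_0=\mathrm{id}$. *)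

(* Defs.v *)
From mathcomp Require Import all_boot all_order all_algebra generic_quotient.
From mathcomp Require Import all_classical all_reals all_analysis.

Set Implicit Arguments.
Unset Strict Implicit.
Unset Printing Implicit Defensive.

Import Order.TTheory GRing.Theory Num.Theory numFieldNormedType.Exports.

Local Open Scope classical_set_scope.
Local Open Scope ring_scope.

(** * Smooth maps between Euclidean spaces *)

Fixpoint iter_derive {R : realType} {d : nat} {W : normedModType R}
    (s : seq 'rV[R]_d) (f : 'rV[R]_d -> W) : 'rV[R]_d -> W :=
  if s is v :: s' then 'D_v (iter_derive s' f) else f.

(* Meaningful for open [U]: [f] is C^oo on [U] iff all its iterated directional
   derivatives exist and are (Frechet) differentiable there. *)
Definition smooth_on {R : realType} {d : nat} {W : normedModType R}
    (U : set 'rV[R]_d) (f : 'rV[R]_d -> W) : Prop :=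
  forall (s : seq 'rV[R]_d) (x : 'rV[R]_d), U x ->
    differentiable (iter_derive s f) x.

(** * Manifolds *)

(* [cmap] and [cinv] are total functions; only the values of [cmap] on [cdom]
   and of [cinv] on [cim] matter. *)
Record chart (R : realType) (T : Type) (d : nat) := Chart {
  cdom : set T;
  cmap : T -> 'rV[R]_d;
  cinv : 'rV[R]_d -> T }.

Definition cim {R : realType} {T : Type} {d : nat} (c : chart R T d) :
  set 'rV[R]_d := cmap c @` cdom c.

(* The atlas is the family [atlas]; [at_pt x] is a chosen chart around [x]. *)
Record mfd_data (R : realType) := MfdData {
  carrier :> topologicalType;
  mdim : nat;
  cidx : Type;
  atlas : cidx -> chart R carrier mdim;
  at_pt : carrier -> cidx }.
Arguments atlas {R} m _.
Arguments at_pt {R} m _.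

Record is_manifold (R : realType) (N : mfd_data R) : Prop := IsManifold {
  mfd_hausdorff : hausdorff_space N;
  mfd_second_countable : @second_countable N;
  mfd_dom_open : forall i, open (cdom (atlas N i));
  mfd_im_open : forall i, open (cim (atlas N i));
  mfd_mapK : forall i x, cdom (atlas N i) x ->
    cinv (atlas N i) (cmap (atlas N i) x) = x;
  mfd_map_cont : forall i x, cdom (atlas N i) x ->
    {for x, continuous (cmap (atlas N i))};
  mfd_inv_cont : forall i y, cim (atlas N i) y ->
    {for y, continuous (cinv (atlas N i))};
  mfd_at_pt : forall x, cdom (atlas N (at_pt N x)) x;
  mfd_transition : forall i j,
    smooth_on (cmap (atlas N i) @` (cdom (atlas N i) `&` cdom (atlas N j)))
              (cmap (atlas N j) \o cinv (atlas N i)) }.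

Definition smooth_fun {R : realType} (N : mfd_data R) (F : N -> R) : Prop :=
  forall i, smooth_on (cim (atlas N i)) (F \o cinv (atlas N i)).

Definition Cc_infty {R : realType} (N : mfd_data R) (F : N -> R) : Prop :=
  smooth_fun F /\ compact (closure [set x | F x != 0]).

Definition prod_chart {R : realType} {T1 T2 : Type} {d1 d2 : nat}
    (c1 : chart R T1 d1) (c2 : chart R T2 d2) : chart R (T1 * T2) (d1 + d2) :=
  {| cdom := cdom c1 `*` cdom c2;
     cmap := fun x => row_mx (cmap c1 x.1) (cmap c2 x.2);
     cinv := fun v => (cinv c1 (lsubmx v), cinv c2 (rsubmx v)) |}.

Definition prod_mfd {R : realType} (N1 N2 : mfd_data R) : mfd_data R :=
  {| carrier := (N1 * N2)%type;
     mdim := mdim N1 + mdim N2;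
     cidx := (cidx N1 * cidx N2)%type;
     atlas := fun i => prod_chart (atlas N1 i.1) (atlas N2 i.2);
     at_pt := fun x => (at_pt N1 x.1, at_pt N2 x.2) |}.

(* The open subset [U] of [N] as a manifold. Its charts are those of [N],
   indexed moreover by a point [z] of [U], which is only used as the junk value
   of the inverse chart outside its image. *)
Definition open_mfd {R : realType} (N : mfd_data R) (U : set N) : mfd_data R :=
  {| carrier := set_type U;
     mdim := mdim N;
     cidx := (set_type U * cidx N)%type;
     atlas := fun zi =>
       {| cdom := [set x | cdom (atlas N zi.2) (val x)];
          cmap := fun x => cmap (atlas N zi.2) (val x);
          cinv := fun v => insubd zi.1 (cinv (atlas N zi.2) v) |};
     at_pt := fun x => (x, at_pt N (val x)) |}.

Definition line_mfd (R : realType) : mfd_data R :=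
  {| carrier := R : topologicalType;
     mdim := 1;
     cidx := unit;
     atlas := fun=> {| cdom := setT;
                       cmap := fun x => const_mx x;
                       cinv := fun v => v 0 0 |};
     at_pt := fun=> tt |}.

(** * The circle [R / Z] *)

Definition circle_eq {R : realType} : rel R :=
  fun x y => (y - x) \is a Num.int.

Lemma circle_eq_equiv {R : realType} : equiv_class_of (@circle_eq R).
Proof.
split=> [x|x y|y x z]; rewrite /circle_eq; first by rewrite subrr.
  by rewrite -rpredN opprB.
move=> xy yz; rewrite -(subrKA y) addrC; exact: rpredD.
Qed.

Canonical circle_equiv {R : realType} :=
  EquivRelPack (@circle_eq_equiv R).

Definition circle (R : realType) : topologicalType :=
  quotient_topology {eq_quot (@circle_eq R)}%qT.

Definition to_circle {R : realType} (t : R) : circle R :=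
  (\pi_({eq_quot (@circle_eq R)}) t)%qT.

Definition circle_repr {R : realType} (q : circle R) : R :=
  repr (q : {eq_quot (@circle_eq R)}%qT).

(* The chart of index [a] is the inverse of [to_circle] restricted to
   ]a, a + 1[. *)
Definition circle_chart {R : realType} (a : R) : chart R (circle R) 1 :=
  {| cdom := [set q | q <> to_circle a];
     cmap := fun q =>
       let t := circle_repr q - a in const_mx (a + (t - (Num.floor t)%:~R));
     cinv := fun v => to_circle (v 0 0) |}.

Definition circle_mfd (R : realType) : mfd_data R :=
  {| carrier := circle R;
     mdim := 1;
     cidx := R;
     atlas := circle_chart;
     at_pt := fun q => circle_repr q - 2^-1 |}.

(** * Symplectic manifolds *)

(* [symp_form i x] is the Gram matrix of the 2-form at [x] in the chart [i]:
   tangent vectors [v], [w] with coordinate rows [v], [w] are paired to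
   [v *m symp_form i x *m w^T]. *)
Record symp_data (R : realType) := SympData {
  base :> mfd_data R;
  symp_form : cidx base -> base -> 'M[R]_(mdim base) }.
Arguments symp_form {R} s _ _.

Record is_symplectic_manifold (R : realType) (N : symp_data R) : Prop := IsSymplecticManifold {
  symp_manifold : is_manifold N;
  (* change of chart: the matrices define a tensor field *)
  symp_compat : forall i j x,
    cdom (atlas N i) x -> cdom (atlas N j) x ->
    let J := 'J (cmap (atlas N j) \o cinv (atlas N i)) (cmap (atlas N i) x) in
    symp_form N i x = J *m symp_form N j x *m J^T;
  symp_smooth : forall i,
    smooth_on (cim (atlas N i)) (symp_form N i \o cinv (atlas N i));
  symp_skew : forall i x, cdom (atlas N i) x ->
    (symp_form N i x)^T = - symp_form N i x;
  symp_nondegenerate : forall i x, cdom (atlas N i) x ->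
    symp_form N i x \in unitmx;
  symp_closed : forall i y, cim (atlas N i) y ->
    forall j k l : 'I_(mdim N),
    let w k l := fun z => symp_form N i (cinv (atlas N i) z) k l in
    'D_(delta_mx 0 j) (w k l) y + 'D_(delta_mx 0 k) (w l j) y
      + 'D_(delta_mx 0 l) (w j k) y = 0 }.

(* coordinates of [dF] at [x] in the chart [i] *)
Definition differential {R : realType} (N : mfd_data R) (i : cidx N)
    (F : N -> R) (x : N) : 'rV[R]_(mdim N) :=
  \row_k 'D_(delta_mx 0 k) (F \o cinv (atlas N i)) (cmap (atlas N i) x).

(* coordinates of sgrad F at [x] in the chart [i] *)
Definition sgrad {R : realType} (N : symp_data R) (i : cidx N)
    (F : N -> R) (x : N) : 'rV[R]_(mdim N) :=
  - differential i F x *m invmx (symp_form N i x).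

Lemma sgradP {R : realType} (N : symp_data R) (i : cidx N) (F : N -> R)
    (x : N) (v : 'rV[R]_(mdim N)) : symp_form N i x \in unitmx ->
  v = sgrad i F x <->
  forall w : 'rV[R]_(mdim N),
    v *m symp_form N i x *m w^T = - (differential i F x *m w^T).
Proof.
move=> u; split=> [-> w|h]; first by rewrite mulmxKV// mulNmx.
apply: (canRL (mulmxK u)); apply/rowP => k.
have /matrixP/(_ 0 0) := h (delta_mx 0 k).
by rewrite trmx_delta -mulNmx -!colE ![col _ _ _ _]mxE.
Qed.

(* {F, G} = Omega(sgrad G, sgrad F) *)
Definition poisson {R : realType} (N : symp_data R) (F G : N -> R) (x : N) : R :=
  let i := at_pt N x in
  (sgrad i G x *m symp_form N i x *m (sgrad i F x)^T) 0 0.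

Definition unorm {R : realType} {T : Type} (H : T -> R) : \bar R :=
  ereal_sup [set `|H x|%:E | x in [set: T]].

Definition pb4 {R : realType} (N : symp_data R) (A0 A1 B0 B1 : set N) : \bar R :=
  ereal_inf [set e | exists F G : N -> R,
    [/\ Cc_infty F /\ Cc_infty G,
        (forall x, A0 x -> F x <= 0) /\ (forall x, A1 x -> 1 <= F x),
        (forall x, B0 x -> G x <= 0) /\ (forall x, B1 x -> 1 <= G x) &
        e = unorm (poisson F G)]].

(* [g] is the flow, starting from the identity at time 0, of the time-dependent
   vector field sgrad G_t. *)
Definition is_hamiltonian_flow {R : realType} (N : symp_data R)
    (G : R -> N -> R) (g : R -> N -> N) : Prop :=
  (forall x, g 0 x = x) /\
  forall (x : N) (t : R),
    {for t, continuous (fun s => g s x)} /\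
    forall i, cdom (atlas N i) (g t x) ->
      is_derive t (1 : R) (fun s : R => cmap (atlas N i) (g s x))
        (sgrad i (G t) (g t x)).

Definition prod_symp {R : realType} (N1 N2 : symp_data R) : symp_data R :=
  {| base := prod_mfd N1 N2;
     symp_form := fun i x =>
       block_mx (symp_form N1 i.1 x.1) 0 0 (symp_form N2 i.2 x.2) |}.

Definition open_symp {R : realType} (N : symp_data R) (U : set N) : symp_data R :=
  {| base := open_mfd U;
     symp_form := fun zi x => symp_form N zi.2 (val x) |}.

(* T^*S^1 = R x S^1 with coordinates (r, theta) and form dr /\ dtheta *)
Definition cotangent_circle (R : realType) : symp_data R :=
  {| base := prod_mfd (line_mfd R) (circle_mfd R);
     symp_form := fun _ _ => block_mx 0 1%:M (- 1%:M) 0 |}.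

Definition annulus (R : realType) (rho : \bar R) : symp_data R :=
  @open_symp R (cotangent_circle R) [set z | (`|z.1 : R|%:E < rho)%E].

Definition stab {R : realType} (M : symp_data R) (rho : \bar R) (X : set M) :
    set (prod_symp M (annulus rho)) :=
  [set z | X z.1 /\ (val z.2).1 = 0 :> R].

(* Main.v *)
(** Suppose that no such chord exists and put [T = 1 / p]. On the extended phase
    space [M * S^1] let [V = d/dt + sgrad G_t]. By compactness the sets swept out
    by [X0] and [X1] under the flow of [V] are still disjoint for some time
    [T' > T], and averaging a Urysohn function along the flow during the time [T']
    gives a smooth [F0] with [F0 = 0] on [X0], [F0 = 1] on [X1] and
    [|V F0| <= 1 / T' + eps < p].

    On [M * A_R] the Hamiltonian [E = r + G] has a vector field projecting to [V].
    With cutoffs [b], [c], [chi] put [F = F0 * b(E)] and [H = E * c(r) * chi(x)].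
    Since [b(E)] commutes with [E], one gets [{F, H} = b(E) * V F0], so
    [max |{F, H}| < p], contradicting [pb_4 = p]. The bound [max G - min G < R]
    leaves room for the support of [b(E)] in [A_R].

    To avoid the smooth dependence of flows on initial data, a neighbourhood of
    the relevant compact set is embedded in some [R^q] by finitely many bump
    functions and coordinates, [V] is extended to a bounded [1]-periodic field [W]
    on [R^(q+1)], and the average is taken along the iterates of the Euler map
    [z + tau * W z], which are visibly smooth and converge to the flow. *)

From HB Require Import structures.
Require Import Defs.
From mathcomp Require Import all_boot all_order all_algebra generic_quotient.
From mathcomp Require Import all_classical all_reals all_analysis.
From mathcomp Require Import ring lra zify.

Set Implicit Arguments.
Unset Strict Implicit.
Unset Printing Implicit Defensive.

Import Order.TTheory GRing.Theory Num.Theory numFieldNormedType.Exports.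

Local Open Scope classical_set_scope.
Local Open Scope ring_scope.

(** * Calculus of smooth maps *)

Section smooth_calculus.
Context {R : realType}.

(** Along [V] the derivative of the mean of [u] over a flow segment of length T' is the end value of
    [u] minus its start value, divided by T'; as [u] has values in [0, 1], it is at most 1 / T'. The
    length must exceed 1 / p strictly, because the Euler approximation costs an eps. Both sets are
    swept forward for the same time, so a common point of the two sweeps yields a chord in either
    order of the times.

    F0 has to live on M * S^1, so the sweeps must be disjoint with time taken modulo 1. A
    coincidence up to an integer k becomes a chord only if s -> g (s + k) x is again a trajectory s
    -> g s y. This, and following a trajectory through a point prescribed at time t0, uses that each
    g t is bijective. Bijectivity has to be derived from the flow equation: uniqueness by a Gronwall
    estimate in the ambient space, surjectivity by a contraction in charts.

    The ambient coordinates vanish outside a compact subset of M. Making [u] vanish near their zero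
    value as well gives F compact support in the M direction, also when M is open. *)

Lemma near_eq_differentiable {V W : normedModType R} (f g : V -> W) (x : V) :
  (\near x, f x = g x) -> differentiable f x -> differentiable g x.
Proof.
move=> fg df.
move/diff_locallyP: df => [dc dE].
have fx : f x = g x := nbhs_singleton fg.
have ce : g \o shift x = cst (g x) + ('d f x : V -> W) +o_ (0 : V) id.
  move/eqaddoP: dE => dE; apply/eqaddoP => e e0.
  have fgs : \forall h \near (0 : V), f (h + x) = g (h + x).
    by move: fg; rewrite (near_shift 0 x) /= subr0.
  have := dE e e0; apply: filter_app; apply: filterS fgs => h fgh.
  by rewrite !fctE /= fgh fx.
have E : 'd g x = 'd f x :> (V -> W) := diff_unique dc ce.
by apply/diff_locallyP; rewrite E.
Qed.

Section vec.
Context {d : nat} {W : normedModType R}.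
Implicit Types (U : set 'rV[R]_d) (f : 'rV[R]_d -> W).

(* C^(n+1) regularity: the form of [smooth_on] on which one can argue by
   induction, e.g. for products and composites. *)
Fixpoint Sm (n : nat) U f : Prop :=
  (forall x, U x -> differentiable f x) /\
  if n is n'.+1 then forall v, Sm n' U ('D_v f) else True.

Lemma Sm_diff n U f x : Sm n U f -> U x -> differentiable f x.
Proof. by case: n => [|n] [h _]; exact: h. Qed.

Lemma Sm_derive n U f v : Sm n.+1 U f -> Sm n U ('D_v f).
Proof. by move=> [_]; exact. Qed.

(** [iter_derive] applies the head of the list last, whereas [Sm] differentiates [f] itself first;
    inductions relating the two split lists at their end. *)
Lemma iter_derive_rcons s v f :
  iter_derive (rcons s v) f = iter_derive s ('D_v f).
Proof. by elim: s => //= w s ->. Qed.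

Lemma smooth_onE U f : smooth_on U f <-> forall n, Sm n U f.
Proof.
split=> [sf n|sf s x Ux].
  elim: n f sf => [|n IH] f sf; first by split => // x Ux; exact: (sf [::]).
  split=> [x Ux|v]; first exact: (sf [::]).
  by apply: IH => s x Ux; rewrite -iter_derive_rcons; exact: sf.
elim/last_ind: s f sf => [|s v IH] f sf; first exact: Sm_diff (sf 0%N) Ux.
by rewrite iter_derive_rcons; apply: IH => n; exact: Sm_derive (sf n.+1).
Qed.

Lemma near_open_eq {T : topologicalType} {S : Type} (U : set T) (f g : T -> S) x :
  open U -> U x -> (forall x, U x -> f x = g x) -> \near x, f x = g x.
Proof. by move=> oU Ux fg; apply: filterS (open_nbhs_nbhs (conj oU Ux)). Qed.

Lemma Sm_ext n U f g : open U -> (forall x, U x -> f x = g x) ->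
  Sm n U f -> Sm n U g.
Proof.
move=> oU; elim: n f g => [|n IH] f g fg [df sf]; split => //.
- by move=> x Ux; apply: near_eq_differentiable (df x Ux); exact: near_open_eq fg.
- by move=> x Ux; apply: near_eq_differentiable (df x Ux); exact: near_open_eq fg.
- move=> v; apply: IH (sf v) => x Ux; apply: near_eq_derive; exact: near_open_eq fg.
Qed.

Lemma SmW n U f : Sm n.+1 U f -> Sm n U f.
Proof.
by elim: n f => [|n IH] f [df sf]; split => // v; exact/IH/sf.
Qed.

Lemma smooth_on_sub U V f : U `<=` V -> smooth_on V f -> smooth_on U f.
Proof. by move=> UV h s x /UV; exact: h. Qed.

Lemma smooth_on_ext U f g : open U -> (forall x, U x -> f x = g x) ->
  smooth_on U f -> smooth_on U g.
Proof.
by move=> oU fg /smooth_onE sf; apply/smooth_onE => n; exact: Sm_ext (sf n).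
Qed.

Lemma smooth_on_derive U f v : smooth_on U f -> smooth_on U ('D_v f).
Proof. by move=> sf s x Ux; rewrite -iter_derive_rcons; exact: sf. Qed.

Lemma smooth_on_diff U f x : smooth_on U f -> U x -> differentiable f x.
Proof. by move=> sf Ux; exact: (sf [::]). Qed.

Lemma smooth_on_local U f :
  (forall x, U x -> exists2 V, V x & smooth_on V f) -> smooth_on U f.
Proof. by move=> h s x /h[V Vx]; exact. Qed.

Lemma Sm_cst n U (c : W) : Sm n U (cst c).
Proof.
elim: n c => [|n IH] c; split=> //; try by move=> *; exact: differentiable_cst.
move=> v; have -> : 'D_v (cst c) = cst 0 :> ('rV[R]_d -> W) by apply/funext => x; exact: derive_cst.
exact: IH.
Qed.

Lemma Sm_add n U f g : open U -> Sm n U f -> Sm n U g -> Sm n U (f + g).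
Proof.
move=> oU; elim: n f g => [|n IH] f g sf sg; split=> //.
- by move=> x Ux; apply: differentiableD; [exact: Sm_diff sf Ux|exact: Sm_diff sg Ux].
- by move=> x Ux; apply: differentiableD; [exact: Sm_diff sf Ux|exact: Sm_diff sg Ux].
- move=> v; apply: (@Sm_ext _ _ ('D_v f + 'D_v g)) => //.
  + move=> x Ux; rewrite deriveD//; apply: diff_derivable.
      exact: Sm_diff sf Ux.
    exact: Sm_diff sg Ux.
  + by apply: IH; exact: Sm_derive.
Qed.

End vec.

Section scal.
Context {d : nat}.
Implicit Types (U : set 'rV[R]_d) (f g : 'rV[R]_d -> R).

Lemma Sm_mul n U f g : open U -> Sm n U f -> Sm n U g -> Sm n U (f * g).
Proof.
move=> oU; elim: n f g => [|n IH] f g sf sg; split=> //.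
- by move=> x Ux; apply: differentiableM; [exact: Sm_diff sf Ux|exact: Sm_diff sg Ux].
- by move=> x Ux; apply: differentiableM; [exact: Sm_diff sf Ux|exact: Sm_diff sg Ux].
- move=> v; apply: (@Sm_ext _ _ _ _ (f * 'D_v g + g * 'D_v f)) => //.
  + move=> x Ux; rewrite deriveM//; apply: diff_derivable.
      exact: Sm_diff sf Ux.
    exact: Sm_diff sg Ux.
  + apply: Sm_add => //; apply: IH; [exact: SmW|exact: Sm_derive|exact: SmW|exact: Sm_derive].
Qed.

(** The derivative -(1/f)^2 * f' involves 1/f only through itself, so the induction hypothesis one
    order below closes the step. *)
Lemma Sm_inv n U f : open U -> (forall x, U x -> f x != 0) ->
  Sm n U f -> Sm n U (fun x => (f x)^-1).
Proof.
move=> oU f0; elim: n => [|n IH] sf; split=> //.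
- by move=> x Ux; apply: differentiableV; [exact: Sm_diff sf Ux|exact: f0].
- by move=> x Ux; apply: differentiableV; [exact: Sm_diff sf Ux|exact: f0].
- move=> v.
  apply: (@Sm_ext _ _ _ _ (cst (-1) * ((fun x => (f x)^-1) * (fun x => (f x)^-1)) * 'D_v f)) => //.
  + move=> x Ux; rewrite deriveV ?f0//; last exact/diff_derivable/(Sm_diff sf Ux).
    by rewrite !fctE mulN1r expr2 invfM.
  + have sfi := IH (SmW sf).
    apply: Sm_mul => //; last exact: Sm_derive.
    by apply: Sm_mul => //; [exact: Sm_cst|exact: Sm_mul].
Qed.

Lemma smooth_cst U (c : R) : smooth_on U (cst c).
Proof. by apply/smooth_onE => n; exact: Sm_cst. Qed.

Lemma smooth_add U f g : open U -> smooth_on U f -> smooth_on U g ->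
  smooth_on U (fun x => f x + g x).
Proof.
by move=> oU /smooth_onE sf /smooth_onE sg; apply/smooth_onE => n; exact: (Sm_add oU).
Qed.

Lemma smooth_mul U f g : open U -> smooth_on U f -> smooth_on U g ->
  smooth_on U (fun x => f x * g x).
Proof.
by move=> oU /smooth_onE sf /smooth_onE sg; apply/smooth_onE => n; exact: (Sm_mul oU).
Qed.

Lemma smooth_opp U f : open U -> smooth_on U f -> smooth_on U (fun x => - f x).
Proof.
move=> oU sf.
have -> : (fun x => - f x) = (fun x => cst (-1) x * f x).
  by apply/funext => x; rewrite mulN1r.
by apply: smooth_mul => //; exact: smooth_cst.
Qed.

Lemma smooth_sub U f g : open U -> smooth_on U f -> smooth_on U g ->
  smooth_on U (fun x => f x - g x).
Proof. by move=> oU sf sg; apply: smooth_add => //; exact: smooth_opp. Qed.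

Lemma smooth_inv U f : open U -> (forall x, U x -> f x != 0) ->
  smooth_on U f -> smooth_on U (fun x => (f x)^-1).
Proof.
by move=> oU f0 /smooth_onE sf; apply/smooth_onE => n; exact: Sm_inv.
Qed.

Lemma smooth_sum (I : Type) (r : seq I) (P : pred I) U (F : I -> 'rV[R]_d -> R) :
  open U -> (forall i, P i -> smooth_on U (F i)) ->
  smooth_on U (fun x => \sum_(i <- r | P i) F i x).
Proof.
move=> oU sF; elim: r => [|i r IH].
  by rewrite (_ : (fun _ => _) = cst 0); [exact: smooth_cst|apply/funext => x; rewrite big_nil].
under eq_fun do rewrite big_cons.
by have [/sF Fi|//] := boolP (P i); exact: smooth_add.
Qed.

Lemma smooth_prod (I : Type) (r : seq I) (P : pred I) U (F : I -> 'rV[R]_d -> R) :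
  open U -> (forall i, P i -> smooth_on U (F i)) ->
  smooth_on U (fun x => \prod_(i <- r | P i) F i x).
Proof.
move=> oU sF; elim: r => [|i r IH].
  by rewrite (_ : (fun _ => _) = cst 1); [exact: smooth_cst|apply/funext => x; rewrite big_nil].
under eq_fun do rewrite big_cons.
by have [/sF Fi|//] := boolP (P i); exact: smooth_mul.
Qed.

End scal.

Lemma derive_coord {V : normedModType R} {m n} (g : V -> 'M[R]_(m, n)) x v i j :
  differentiable g x -> 'D_v (fun y => g y i j) x = ('D_v g x) i j.
Proof. by move=> dg; rewrite derive_mx ?mxE//; exact: diff_derivable. Qed.

Lemma differentiable_coords {V : normedModType R} {m n} (g : V -> 'M[R]_(m, n)) x :
  (forall i j, differentiable (fun y => g y i j) x) <-> differentiable g x.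
Proof.
split=> [dg|dg i j]; last first.
  apply: (@differentiable_comp _ _ _ _ g (fun M : 'M[R]_(m, n) => M i j)) => //.
  exact: differentiable_coord.
have -> : g = \sum_i \sum_j (fun y => g y i j *: delta_mx i j).
  apply/funext => y; rewrite fct_sumE; under eq_bigr do rewrite fct_sumE.
  exact: matrix_sum_delta.
apply: (big_ind (fun h => differentiable h x)) => [|*|i _]; [exact: differentiable_cst|exact: differentiableD|].
apply: (big_ind (fun h => differentiable h x)) => [|*|j _]; [exact: differentiable_cst|exact: differentiableD|].
exact: differentiableZl.
Qed.

Lemma smooth_coord {d} (U : set 'rV[R]_d) {m n} (g : 'rV[R]_d -> 'M[R]_(m, n)) i j :
  open U -> smooth_on U g -> smooth_on U (fun y => g y i j).
Proof.
move=> oU /smooth_onE sg; apply/smooth_onE => k; move/(_ k): sg.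
elim: k g => [|k IH] g sg; split=> //.
- by move=> x /(Sm_diff sg) /differentiable_coords.
- by move=> x /(Sm_diff sg) /differentiable_coords.
- move=> v; have [_ /(_ v)/IH sv] := sg; apply: (Sm_ext oU _ sv) => x Ux.
  by rewrite derive_coord//; exact: Sm_diff sg Ux.
Qed.

(** Stated by components because the product and quotient rules above are for real-valued
    functions. *)
Definition smoothV {d q} (U : set 'rV[R]_d) (g : 'rV[R]_d -> 'rV[R]_q) :=
  forall k, smooth_on U (fun y => g y 0 k).

Lemma smoothV_diff {d q} (U : set 'rV[R]_d) (g : 'rV[R]_d -> 'rV[R]_q) x :
  smoothV U g -> U x -> differentiable g x.
Proof.
move=> sg Ux; apply/differentiable_coords => i j; rewrite ord1.
exact: smooth_on_diff (sg j) Ux.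
Qed.

Lemma diff_row_sum {q} {W : normedModType R} (f : 'rV[R]_q -> W) x w :
  differentiable f x -> 'D_w f x = \sum_k w 0 k *: 'D_(delta_mx 0 k) f x.
Proof.
move=> df; rewrite deriveE// [in LHS](row_sum_delta w) linear_sum.
by apply: eq_bigr => k _; rewrite linearZ deriveE.
Qed.

Lemma derive_comp {U V W : normedModType R} (g : U -> V) (f : V -> W) x v :
  differentiable g x -> differentiable f (g x) ->
  'D_v (f \o g) x = 'D_('D_v g x) f (g x).
Proof.
move=> dg df; rewrite !deriveE//; last exact: differentiable_comp.
by rewrite diff_comp//.
Qed.

(** The derivative of [f \o g] is a sum of products of a derivative of [g] with a partial derivative
    of [f] composed with the same [g]; hence the induction runs over all [f] smooth on [V]. *)
Lemma smooth_comp {d q} (U : set 'rV[R]_d) (V : set 'rV[R]_q)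
    (g : 'rV[R]_d -> 'rV[R]_q) (f : 'rV[R]_q -> R) :
  open U -> (forall x, U x -> V (g x)) -> smoothV U g -> smooth_on V f ->
  smooth_on U (f \o g).
Proof.
move=> oU UV sg sf; apply/smooth_onE => n.
have {sg}sg n' k : Sm n' U (fun y => g y 0 k) by move/smooth_onE: (sg k); exact.
have dg x : U x -> differentiable g x.
  move=> Ux; apply/differentiable_coords => i j; rewrite ord1.
  exact: Sm_diff (sg 0%N j) Ux.
have {sf} : forall n, Sm n V f by exact/smooth_onE.
elim: n f => [|n IH] f sf.
  split=> // x Ux; apply: differentiable_comp; first exact: dg.
  by apply: Sm_diff (sf 0%N) _; exact: UV.
split=> [x Ux|v].
  apply: differentiable_comp; first exact: dg.
  by apply: Sm_diff (sf 0%N) _; exact: UV.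
apply: (@Sm_ext _ _ _ _ (\sum_k (('D_v (fun y => g y 0 k)) * ('D_(delta_mx 0 k) f \o g)))) => //.
  move=> x Ux; rewrite derive_comp//; [|exact: dg|by apply: Sm_diff (sf 0%N) _; exact: UV].
  rewrite diff_row_sum; last by apply: Sm_diff (sf 0%N) _; exact: UV.
  rewrite fct_sumE; apply: eq_bigr => k _; rewrite !fctE derive_coord//; exact: dg.
apply: (big_ind (Sm n U)) => [|*|k _]; [exact: Sm_cst|exact: Sm_add|].
apply: Sm_mul => //; first exact: Sm_derive (sg n.+1 k).
by apply: IH => m; exact: Sm_derive (sf m.+1).
Qed.

Lemma derive_real {W : normedModType R} (p : R -> W) (y w : R) (l : W) :
  is_derive y (1 : R) p l -> 'D_w p y = w *: l.
Proof.
move=> dp; have dp' : differentiable p y.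
  by apply/derivable1_diffP; exact: ex_derive.
rewrite deriveE// (_ : w = w *: (1 : R)); last by rewrite /GRing.scale/= mulr1.
by rewrite linearZ -deriveE// derive_val /GRing.scale/= mulr1.
Qed.

(** The sequence [phi] lists the successive derivatives of [phi 0]. Taking it as data suits families
    closed under derivation, such as [eflat] and shifted sines. *)
Lemma smooth_comp1 {d} (U : set 'rV[R]_d) (phi : nat -> R -> R) (f : 'rV[R]_d -> R) :
  open U -> (forall n (x : R), is_derive x (1 : R) (phi n) (phi n.+1 x)) ->
  smooth_on U f -> smooth_on U (phi 0%N \o f).
Proof.
move=> oU dphi /smooth_onE sf; suff H n m : Sm n U (phi m \o f) by apply/smooth_onE => n; exact: H.
have df x n' : differentiable (phi n') x.
  by apply/derivable1_diffP; exact: ex_derive.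
elim: n m => [|n IH] m; split=> //.
- by move=> x Ux; apply: differentiable_comp => //; exact: Sm_diff (sf 0%N) Ux.
- by move=> x Ux; apply: differentiable_comp => //; exact: Sm_diff (sf 0%N) Ux.
- move=> v; apply: (@Sm_ext _ _ _ _ ('D_v f * (phi m.+1 \o f))) => //.
    move=> x Ux; rewrite derive_comp//; last exact: Sm_diff (sf 0%N) Ux.
    by rewrite (derive_real _ (dphi m (f x))).
  apply: Sm_mul => //.
  exact: Sm_derive (sf n.+1).
Qed.

Lemma smooth_coordf {d} (U : set 'rV[R]_d) k : smooth_on U (fun v : 'rV[R]_d => v 0 k).
Proof.
apply/smooth_onE; have dc x : differentiable (fun v : 'rV[R]_d => v 0 k) x.
  exact: differentiable_coord.
case=> [|n]; split => // v.
have -> : 'D_v (fun w : 'rV[R]_d => w 0 k) = cst (v 0 k).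
  apply/funext => x; rewrite (derive_coord v 0 k (g := idfun)) ?derive_id//.
exact: Sm_cst.
Qed.

End smooth_calculus.

(** * Flat functions, smooth steps, plateaus and bumps *)

Section bump.
Context {R : realType}.

Lemma norm_coord {m n} (x : 'M[R]_(m, n)) i j : `|x i j| <= `|x|.
Proof.
rewrite [leRHS]/Num.Def.normr/= mx_normrE.
exact: (le_bigmax _ (fun ij => `|x ij.1 ij.2|) (i, j)).
Qed.

Lemma norm_rV_le {n} (x : 'rV[R]_n) c : 0 <= c ->
  (forall k, `|x 0 k| <= c) -> `|x| <= c.
Proof.
move=> c0 h; rewrite [leLHS]/Num.Def.normr/= mx_normrE.
by apply: bigmax_le => // -[i j] _ /=; rewrite ord1.
Qed.

Lemma norm_rV_lt {n} (x : 'rV[R]_n) c : 0 < c ->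
  (forall k, `|x 0 k| < c) -> `|x| < c.
Proof.
move=> c0 h; rewrite [ltLHS]/Num.Def.normr/= mx_normrE.
by apply: bigmax_lt => // -[i j] _ /=; rewrite ord1.
Qed.

(* The functions [P(1/x) * exp(-1/x)] are closed under derivation. *)
Definition eflat (P : {poly R}) (x : R) : R :=
  if 0 < x then P.[x^-1] * expR (- x^-1) else 0.

(** In the variable y = 1/x one has d/dx = - y^2 d/dy, which turns P(y) exp(-y) into y^2 (P - P')(y)
    exp(-y). *)
Definition eflat_step (P : {poly R}) := 'X^2 * (P - P^`()).

(** exp y is the (n+1)-st power of exp (y / (n+1)), which is at least 1 + y / (n+1). *)
Lemma expR_ge_pow n (y : R) : 0 <= y -> (y / n.+1%:R) ^+ n.+1 <= expR y.
Proof.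
move=> y0; have -> : expR y = expR (y / n.+1%:R) ^+ n.+1.
  by rewrite -expRM_natl; congr expR; rewrite mulrC divfK// pnatr_eq0.
have z0 : 0 <= y / n.+1%:R by rewrite divr_ge0.
by rewrite lerXn2r// ?nnegrE// ?expR_ge0// (le_trans _ (expR_ge1Dx _))// lerDr.
Qed.

Lemma poly_le (P : {poly R}) : exists C, 0 <= C /\
  forall y, 1 <= y -> `|P.[y]| <= C * y ^+ size P.
Proof.
exists (\sum_(i < size P) `|P`_i|); split=> [|y y1]; first exact: sumr_ge0.
rewrite horner_coef (le_trans (ler_norm_sum _ _ _))// mulr_suml.
apply: ler_sum => i _; rewrite normrM ler_wpM2l// ger0_norm; last first.
  by rewrite exprn_ge0// (le_trans _ y1).
by rewrite ler_weXn2l// ltnW.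
Qed.

(** Quadratic smallness makes the difference quotient at 0 tend to 0, so every function of the
    family has derivative 0 there. *)
Lemma eflat_small (P : {poly R}) : exists C, 0 <= C /\
  forall h, `|h| < 1 -> `|eflat P h| <= C * `|h| ^+ 2.
Proof.
have [C [C0 PC]] := poly_le P.
(* The exponential bound is used with exponent [n.+1], that is [size P] plus 2: [size P] powers
   absorb [P] and two remain for [|h| ^+ 2]. *)
set n := (size P).+1.
exists (C * n.+1%:R ^+ n.+1); split; first by rewrite mulr_ge0// exprn_ge0.
move=> h h1; rewrite /eflat; case: ifPn => h0; last first.
  by rewrite normr0 mulr_ge0 ?sqr_ge0// mulr_ge0// exprn_ge0.
rewrite (gtr0_norm h0) in h1 *; set y := h^-1.
have y1 : 1 <= y by rewrite invf_ge1// ltW.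
have y0 : 0 < y by rewrite (lt_le_trans _ y1).
rewrite normrM [X in _ * X]ger0_norm ?expR_ge0// expRN.
have := expR_ge_pow n (ltW y0); rewrite expr_div_n => ey.
have e0 : 0 < expR y := expR_gt0 y.
rewrite ler_pdivrMr//.
have -> : h ^+ 2 = (y ^+ 2)^-1 by rewrite exprVn invrK.
have hn : C * y ^+ size P = C * n.+1%:R ^+ n.+1 / y ^+ 2 * (y ^+ n.+1 / n.+1%:R ^+ n.+1).
  have nn : n.+1%:R ^+ n.+1 != 0 :> R by rewrite expf_neq0// pnatr_eq0.
  have -> : y ^+ n.+1 = y ^+ 2 * y ^+ size P by rewrite -exprD.
  have yy : y != 0 by rewrite gt_eqF.
  move: (n.+1%:R ^+ n.+1 : R) (y ^+ size P) nn => N b nn.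
  by field; rewrite nn.
apply: le_trans (PC _ y1) _; rewrite hn ler_wpM2l//.
by rewrite divr_ge0 ?sqr_ge0// mulr_ge0// exprn_ge0.
Qed.

Lemma is_deriveMR (f g : R -> R) (x a b : R) :
  is_derive x (1 : R) f a -> is_derive x (1 : R) g b ->
  is_derive x (1 : R) (fun y => f y * g y) (f x * b + g x * a).
Proof. exact: is_deriveM. Qed.

Lemma is_derive_eflat (P : {poly R}) (x : R) :
  is_derive x (1 : R) (eflat P) (eflat (eflat_step P) x).
Proof.
have [x0|x0|->] := ltrgtP x 0.
- apply: (@near_eq_is_derive _ _ _ (cst 0)).
    near=> y; rewrite /eflat ltNge (_ : y <= 0)//.
    by near: y; apply: filterS (lt_nbhsl x0) => y /ltW.
  by rewrite /eflat ltNge (ltW x0)/=; exact: is_derive_cst.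
- have xN0 : x != 0 by rewrite gt_eqF.
  have dV : is_derive x (1 : R) (fun y : R => y^-1) (- x ^- 2).
    apply: is_derive_eq; first exact: (is_deriveV xN0).
    by rewrite /GRing.scale/= mulr1.
  have d1 : is_derive x (1 : R) (horner P \o (fun y : R => y^-1)) (- x ^- 2 * P^`().[x^-1]).
    by rewrite mulrC; apply: is_derive1_comp.
  have d2 : is_derive x (1 : R) (expR \o (fun y : R => - y^-1)) (x ^- 2 * expR (- x^-1)).
    rewrite mulrC; apply: is_derive1_comp.
    by rewrite -[X in is_derive _ _ _ X]opprK; exact: is_deriveN dV.
  have -> : eflat (eflat_step P) x = (horner P \o (fun y : R => y^-1)) x * (x ^- 2 * expR (- x^-1))
     + (expR \o (fun y : R => - y^-1)) x * (- x ^- 2 * P^`().[x^-1]).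
    rewrite /eflat x0 /eflat_step hornerM hornerXn hornerD hornerN /= exprVn; ring.
  apply: near_eq_is_derive (is_deriveMR d1 d2).
  near=> y; rewrite /eflat (_ : 0 < y)//.
  by near: y; exact: lt_nbhsr.
- rewrite {2}/eflat ltxx.
  have [C [C0 CP]] := eflat_small P.
  have h : h^-1 *: (eflat P (h *: 1 + 0) - eflat P 0) @[h --> (0:R)^'] --> (0 : R).
    apply/cvgrPdist_le => e e0; near=> h.
    have hN0 : h != 0 by near: h; exact: nbhs_dnbhs_neq.
    have h1 : `|h| < 1 by near: h; exact: dnbhs0_lt.
    rewrite sub0r normrN addr0 [h *: 1]mulr1 {2}/eflat ltxx subr0.
    rewrite normrM normfV ler_pdivrMl ?normr_gt0//.
    apply: le_trans (CP _ h1) _; rewrite expr2 mulrCA ler_wpM2l//.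
    have : `|h| < e / (C + 1).
      by near: h; apply: dnbhs0_lt; rewrite divr_gt0// ltr_wpDl.
    rewrite ltr_pdivlMr ?ltr_wpDl// mulrDr mulr1 mulrC => /ltW; apply: le_trans.
    by rewrite lerDl.
  by apply: DeriveDef; [apply/cvg_ex; exists 0|exact/cvg_lim].
Unshelve. all: by end_near. Qed.

Lemma eflat1_gt0 (x : R) : 0 < x -> 0 < eflat 1 x.
Proof. by move=> x0; rewrite /eflat x0 hornerC mul1r expR_gt0. Qed.

Lemma eflat1_le0 (x : R) : x <= 0 -> eflat 1 x = 0.
Proof. by move=> x0; rewrite /eflat ltNge x0. Qed.

Lemma eflat1_ge0 (x : R) : 0 <= eflat 1 x.
Proof. by have [/eflat1_le0->//|/eflat1_gt0/ltW] := leP x 0. Qed.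

Definition sstep (x : R) := eflat 1 x / (eflat 1 x + eflat 1 (1 - x)).

Lemma sstep_den (x : R) : 0 < eflat 1 x + eflat 1 (1 - x).
Proof.
have [x0|x0] := ltP 0 x; first by rewrite ltr_pwDl ?eflat1_gt0// eflat1_ge0.
by rewrite ltr_wpDl ?eflat1_ge0// eflat1_gt0// subr_gt0 (le_lt_trans x0).
Qed.

Lemma sstep_le0 x : x <= 0 -> sstep x = 0.
Proof. by move=> /eflat1_le0; rewrite /sstep => ->; rewrite mul0r. Qed.

Lemma sstep_ge1 x : 1 <= x -> sstep x = 1.
Proof.
move=> x1; rewrite /sstep (@eflat1_le0 (1 - x)) ?subr_le0// addr0 divff// gt_eqF//.
by rewrite eflat1_gt0// (lt_le_trans _ x1).
Qed.

Lemma sstep_ge0 x : 0 <= sstep x.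
Proof. by rewrite divr_ge0// ?eflat1_ge0// ltW// sstep_den. Qed.

Lemma sstep_le1 x : sstep x <= 1.
Proof. by rewrite ler_pdivrMr ?sstep_den// mul1r lerDl eflat1_ge0. Qed.

Lemma smooth_eflat {d} (U : set 'rV[R]_d) (f : 'rV[R]_d -> R) :
  open U -> smooth_on U f -> smooth_on U (fun v => eflat 1 (f v)).
Proof.
move=> oU sf.
apply: (smooth_comp1 (phi := fun n => eflat (iter n eflat_step 1)) oU _ sf) => n x.
exact: is_derive_eflat.
Qed.

Lemma smooth_sstep {d} (U : set 'rV[R]_d) (f : 'rV[R]_d -> R) :
  open U -> smooth_on U f -> smooth_on U (fun v => sstep (f v)).
Proof.
move=> oU sf; have s1 : smooth_on U (fun v => eflat 1 (1 - f v)).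
  by apply: smooth_eflat => //; apply: smooth_sub => //; exact: smooth_cst.
apply: smooth_mul => //; first exact: smooth_eflat.
apply: smooth_inv => //; last by apply: smooth_add => //; exact: smooth_eflat.
by move=> x _; rewrite gt_eqF// sstep_den.
Qed.

(** For e > 0 this is 1 on [a, b] and 0 outside ]a - e, b + e[: the shift by 1 puts the two
    transitions of width [e] outside [a, b]. *)
Definition plateau (a b e s : R) : R := sstep ((s - a) / e + 1) * sstep ((b - s) / e + 1).

Lemma plateau01 a b e s : 0 <= plateau a b e s <= 1.
Proof.
by rewrite mulr_ge0 ?sstep_ge0//= mulr_ile1// ?sstep_ge0 ?sstep_le1.
Qed.

Lemma plateau_1 a b e s : 0 < e -> a <= s <= b -> plateau a b e s = 1.
Proof.
move=> e0 /andP[sa sb].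
by rewrite /plateau !sstep_ge1 ?mulr1// lerDr divr_ge0 ?subr_ge0// ltW.
Qed.

Lemma plateau_0 a b e s : 0 < e -> (s <= a - e) || (b + e <= s) -> plateau a b e s = 0.
Proof.
move=> e0 /orP[h|h].
  rewrite /plateau (@sstep_le0 ((s - a) / e + 1)) ?mul0r//.
  by rewrite -lerBrDr sub0r ler_pdivrMr// mulN1r; lra.
rewrite /plateau (@sstep_le0 ((b - s) / e + 1)) ?mulr0//.
by rewrite -lerBrDr sub0r ler_pdivrMr// mulN1r; lra.
Qed.

Lemma smooth_plateau {d} (U : set 'rV[R]_d) f a b e : open U -> smooth_on U f ->
  smooth_on U (fun v => plateau a b e (f v)).
Proof.
move=> oU sf; have sc (c : R) : smooth_on U (cst c : 'rV[R]_d -> R) by exact: smooth_cst.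
have s1 : smooth_on U (fun v => (f v - a) / e + 1).
  exact: (smooth_add oU (smooth_mul oU (smooth_sub oU sf (sc a)) (sc e^-1)) (sc 1)).
have s2 : smooth_on U (fun v => (b - f v) / e + 1).
  exact: (smooth_add oU (smooth_mul oU (smooth_sub oU (sc b) sf) (sc e^-1)) (sc 1)).
exact: (smooth_mul oU (smooth_sstep oU s1) (smooth_sstep oU s2)).
Qed.

Lemma differentiable_plateau a b e s : differentiable (plateau a b e) s.
Proof.
have -> : plateau a b e = (fun v : 'rV[R]_1 => plateau a b e (v 0 0)) \o (fun s => const_mx s).
  by apply/funext => y; rewrite /= mxE.
apply: differentiable_comp.
  by apply/differentiable_coords => i j; rewrite (_ : (fun _ => _) = id)//; apply/funext => y; rewrite mxE.
apply: (smooth_on_diff (U := setT)) => //.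
by apply: smooth_plateau; [exact: openT|exact: smooth_coordf].
Qed.

(** Row vectors carry the maximum norm, whose balls are boxes: for r > 0 the product is 1 where |v -
    c| <= r and 0 where |v - c| >= 2 r. *)
Definition box_bump {d} (c : 'rV[R]_d) (r : R) (v : 'rV[R]_d) : R :=
  \prod_k plateau (-1) 1 1 ((v 0 k - c 0 k) / r).

Lemma bump_ge0 {d} (c : 'rV[R]_d) r v : 0 <= box_bump c r v.
Proof. by apply: prodr_ge0 => k _; case/andP: (plateau01 (-1) 1 1 ((v 0 k - c 0 k) / r)). Qed.

Lemma bump_le1 {d} (c : 'rV[R]_d) r v : box_bump c r v <= 1.
Proof. by apply: prodr_ile1 => k _; exact: plateau01. Qed.

Lemma bump_1 {d} (c : 'rV[R]_d) r v : 0 < r -> `|v - c| <= r -> box_bump c r v = 1.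
Proof.
move=> r0 vr; apply: big1 => k _; apply: plateau_1 => //.
rewrite -ler_norml normrM normfV (gtr0_norm r0) ler_pdivrMr// mul1r.
by apply: le_trans vr; have := norm_coord (v - c) 0 k; rewrite !mxE.
Qed.

Lemma bump_0 {d} (c : 'rV[R]_d) r v : 0 < r -> 2 * r <= `|v - c| -> box_bump c r v = 0.
Proof.
move=> r0 vr.
have [k vk] : exists k, 2 * r <= `|v 0 k - c 0 k|.
  apply/not_existsP => h; move: vr; rewrite leNgt => /negP; apply.
  apply: norm_rV_lt => [|k]; first by rewrite mulr_gt0.
  by rewrite !mxE ltNge; apply/negP/h.
rewrite /box_bump (bigD1 k)//= plateau_0 ?mul0r// -opprD -lerNr orbC -ler_normr.
by rewrite normrM normfV (gtr0_norm r0) ler_pdivlMr.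
Qed.

Lemma smooth_bump {d} (c : 'rV[R]_d) r U : open U -> smooth_on U (box_bump c r).
Proof.
move=> oU; apply: smooth_prod => // k _; apply: smooth_plateau => //.
apply: smooth_mul => //; last exact: smooth_cst.
by apply: smooth_sub; [by []|exact: smooth_coordf|exact: smooth_cst].
Qed.

End bump.

(** * Bounded vector fields and Euler's method *)

Section bounds.
Context {R : realType}.

(** No order between [a] and [b] is imposed, since flows are followed in both time directions. *)
Lemma curve_mvt (c dc : R -> R) (a b : R) :
  (forall t, is_derive t (1 : R) c (dc t)) ->
  exists2 s, `|s - a| <= `|b - a| & c b - c a = dc s * (b - a).
Proof.
move=> dcP.
have cc x y : {within `[x, y], continuous c}.
  apply: continuous_subspaceT => t; apply: differentiable_continuous.
  by apply/derivable1_diffP; exact: ex_derive.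
have [ab|ba] := leP a b.
  have [s] := MVT_segment ab (fun t _ => dcP t) (cc a b).
  rewrite in_itv/= => /andP[sa sb] E; exists s => //.
  by rewrite !ger0_norm ?subr_ge0// lerD2r.
have [s] := MVT_segment (ltW ba) (fun t _ => dcP t) (cc b a).
rewrite in_itv/= => /andP[sa sb] E; exists s.
  by rewrite !ler0_norm ?subr_le0 ?(ltW ba)// lerN2 lerD2r.
by apply: oppr_inj; rewrite -mulrN !opprB.
Qed.

Lemma natr_mul_sum (m : nat) (a : R) : m%:R * a = \sum_(k < m) a.
Proof. by rewrite sumr_const card_ord mulr_natl. Qed.

Section mvt.
Context {m : nat}.
Implicit Types (f : 'rV[R]_m -> R) (x v : 'rV[R]_m).

Lemma is_derive_line f x v s : differentiable f (x + s *: v) ->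
  is_derive s (1 : R) (fun s : R => f (x + s *: v)) ('D_v f (x + s *: v)).
Proof.
move=> df.
have dl : is_derive s (1 : R) (fun s : R => x + s *: v) v.
  have dlin : is_diff s (fun k : R => k *: v) (fun k : R => k *: v).
    exact: (is_diff_scalel s v).
  have dscal : is_derive s (1 : R) (fun k : R => k *: v) v.
    apply: DeriveDef; first exact/diff_derivable.
    by rewrite deriveE// diff_val scale1r.
  by rewrite -[X in is_derive _ _ _ X]add0r; exact: is_deriveD.
have dfl : differentiable (fun s : R => x + s *: v) s.
  by apply/derivable1_diffP; exact: ex_derive.
apply: DeriveDef; first exact/diff_derivable/differentiable_comp.
by rewrite (derive_comp (g := fun s : R => x + s *: v))// derive_val.
Qed.

Lemma mvt_line f x v : (forall s, 0 <= s <= 1 -> differentiable f (x + s *: v)) ->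
  exists2 s, 0 <= s <= 1 & f (x + v) - f x = 'D_v f (x + s *: v).
Proof.
move=> df.
have h (s : R) : s \in `]0, 1[%R -> is_derive s (1 : R) (fun s : R => f (x + s *: v)) ('D_v f (x + s *: v)).
  by rewrite in_itv/= => /andP[a b]; apply/is_derive_line/df; rewrite !ltW.
have cl : {within `[0, 1], continuous (fun s : R => f (x + s *: v))}.
  apply/continuous_within_itvP => //=; split.
  - move=> s /h dls; apply: differentiable_continuous.
    by apply/derivable1_diffP; exact: ex_derive.
  - apply: cvg_at_right_filter; apply: differentiable_continuous.
    apply/derivable1_diffP; have h0 : 0 <= (0 : R) <= 1 by rewrite lexx ler01.
    by have := is_derive_line (df _ h0) => ?; exact: ex_derive.
  - apply: cvg_at_left_filter; apply: differentiable_continuous.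
    apply/derivable1_diffP; have h0 : 0 <= (1 : R) <= 1 by rewrite lexx ler01.
    by have := is_derive_line (df _ h0) => ?; exact: ex_derive.
have [s] := MVT_segment ler01 h cl.
rewrite in_itv/= => sI; rewrite scale1r scale0r addr0 subr0 mulr1 => E.
by exists s.
Qed.

Lemma derive_le f x v C : differentiable f x -> 
  (forall k, `|'D_(delta_mx 0 k) f x| <= C) -> `|'D_v f x| <= m%:R * C * `|v|.
Proof.
move=> df fC; rewrite diff_row_sum// (le_trans (ler_norm_sum _ _ _))//.
rewrite -mulrA natr_mul_sum; apply: ler_sum => k _.
by rewrite normrM mulrC ler_pM// norm_coord.
Qed.

Lemma lip_line f x v C :
  (forall s, 0 <= s <= 1 -> differentiable f (x + s *: v)) ->
  (forall s k, 0 <= s <= 1 -> `|'D_(delta_mx 0 k) f (x + s *: v)| <= C) ->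
  `|f (x + v) - f x| <= m%:R * C * `|v|.
Proof.
move=> df fC; have [s s01 ->] := mvt_line df.
by apply: derive_le => [|k]; [exact: df|exact: fC].
Qed.

(** The mean value theorem writes the increment as ['D_v f] at an intermediate point; the first
    partials there and at [x] differ by a Lipschitz bound coming from the second partials. *)
Lemma taylor_line f x v C :
  (forall x, differentiable f x) ->
  (forall k x, differentiable ('D_(delta_mx 0 k) f) x) ->
  (forall k l x, `|'D_(delta_mx 0 l) ('D_(delta_mx 0 k) f) x| <= C) ->
  `|f (x + v) - f x - 'D_v f x| <= m%:R * (m%:R * C) * `|v| ^+ 2.
Proof.
move=> df ddf fC; have [//|s /andP[s0 s1] ->] := @mvt_line f x v.
rewrite !diff_row_sum// -sumrB (le_trans (ler_norm_sum _ _ _))//.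
rewrite -mulrA natr_mul_sum; apply: ler_sum => k _.
rewrite -scalerBr normrM mulrC expr2 mulrA; apply: ler_pM => //; last exact: norm_coord.
have L := @lip_line ('D_(delta_mx 0 k) f) x (s *: v) C (fun s _ => ddf k _)
  (fun s l _ => fC k l _).
apply: (le_trans L); rewrite ler_wpM2l//.
  by rewrite mulr_ge0// (le_trans _ (fC k k 0)).
by rewrite normrZ ger0_norm// ler_piMl.
Qed.

End mvt.

Definition bounded_smooth {m} (f : 'rV[R]_m -> R) :=
  smooth_on setT f /\
  forall s, exists C, forall x, `|iter_derive s f x| <= C.

Lemma bounded_smooth_coef {m} (f : 'rV[R]_m -> R) : bounded_smooth f ->
  exists C, [/\ 0 <= C, forall x, `|f x| <= C,
    forall x k, `|'D_(delta_mx 0 k) f x| <= C &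
    forall x k l, `|'D_(delta_mx 0 l) ('D_(delta_mx 0 k) f) x| <= C].
Proof.
move=> [_ bf].
have [C0 h0] := bf [::].
have /choice[C1 h1] : forall k, exists C, forall x, `|'D_(delta_mx 0 k) f x| <= C.
  by move=> k; exact: (bf [:: delta_mx 0 k]).
have /choice[C2 h2] : forall kl : 'I_m * 'I_m, exists C, forall x,
    `|'D_(delta_mx 0 kl.2) ('D_(delta_mx 0 kl.1) f) x| <= C.
  by move=> [k l]; exact: (bf [:: delta_mx 0 l; delta_mx 0 k]).
exists (`|C0| + \sum_k `|C1 k| + \sum_kl `|C2 kl|).
have s1 : 0 <= \sum_k `|C1 k| by exact: sumr_ge0.
have s2 : 0 <= \sum_kl `|C2 kl| by exact: sumr_ge0.
split=> [|x|x k|x k l].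
- by rewrite !addr_ge0.
- rewrite (le_trans (h0 x))// (le_trans (ler_norm _))// -addrA lerDl addr_ge0//.
- rewrite (le_trans (h1 k x))// (le_trans (ler_norm _))//.
  have : `|C1 k| <= \sum_k `|C1 k| by rewrite (bigD1 k)//= lerDl sumr_ge0.
  by have := normr_ge0 C0; lra.
- rewrite (le_trans (h2 (k, l) x))// (le_trans (ler_norm _))//.
  have : `|C2 (k, l)| <= \sum_kl `|C2 kl| by rewrite (bigD1 (k, l))//= lerDl sumr_ge0.
  by have := normr_ge0 C0; lra.
Qed.

Section field.
Context {m : nat}.
Variable W : 'rV[R]_m -> 'rV[R]_m.
Hypothesis WB : forall k, bounded_smooth (fun x => W x 0 k).

Lemma field_smooth : smoothV setT W.
Proof. by move=> k; case: (WB k). Qed.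

Lemma field_diff x : differentiable W x.
Proof. by apply: (smoothV_diff field_smooth). Qed.

Lemma field_bounds : exists C, [/\ 0 < C, forall x, `|W x| <= C,
  forall x v, `|'D_v W x| <= C * `|v|,
  forall x y, `|W y - W x| <= C * `|y - x| &
  forall x v, `|W (x + v) - W x - 'D_v W x| <= C * `|v| ^+ 2].
Proof.
have /choice[C0 h] : forall j, exists C, [/\ 0 <= C, forall x, `|W x 0 j| <= C,
    forall x k, `|'D_(delta_mx 0 k) (fun x => W x 0 j) x| <= C &
    forall x k l, `|'D_(delta_mx 0 l) ('D_(delta_mx 0 k) (fun x => W x 0 j)) x| <= C].
  by move=> j; exact: bounded_smooth_coef.
pose C1 := \sum_j C0 j.
have C1j j : C0 j <= C1.
  rewrite /C1 (bigD1 j)//= lerDl; apply: sumr_ge0 => i _.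
  by case: (h i).
have C10 : 0 <= C1 by apply: sumr_ge0 => i _; case: (h i).
(* The factors 1, m and m^2 come from expanding zero, one or two directional derivatives in
   coordinates; the final 1 makes [C] positive. *)
pose C := (1 + m%:R + m%:R * m%:R) * C1 + 1.
have m0 : 0 <= m%:R :> R by [].
have mm0 : 0 <= m%:R * m%:R :> R by rewrite mulr_ge0.
have leC a : 0 <= a -> a <= 1 + m%:R + m%:R * m%:R -> a * C1 <= C.
  by move=> a0 ac; rewrite /C ler_wpDr// ler_wpM2r.
have CC1 : C1 <= C by rewrite -[C1]mul1r leC// -addrA lerDl addr_ge0.
have CmC1 : m%:R * C1 <= C by rewrite leC//; lra.
have CmmC1 : m%:R * (m%:R * C1) <= C by rewrite mulrA leC//; lra.
have C0_ : 0 < C by rewrite /C ltr_wpDl// mulr_ge0// !addr_ge0.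
have dW j x : differentiable (fun y => W y 0 j) x.
  exact: smooth_on_diff (field_smooth j) _.
have ddW j k x : differentiable ('D_(delta_mx 0 k) (fun y => W y 0 j)) x.
  exact: smooth_on_diff (smooth_on_derive _ (field_smooth j)) _.
have DW j x v : ('D_v W x) 0 j = 'D_v (fun y => W y 0 j) x.
  by rewrite derive_coord//; exact: field_diff.
have lip x v : `|W (x + v) - W x| <= C * `|v|.
  apply: norm_rV_le => [|j]; first by rewrite mulr_ge0// ltW.
  have [_ _ h1 _] := h j.
  have L := @lip_line _ (fun y => W y 0 j) x v (C0 j) (fun s _ => dW j _)
    (fun s k _ => h1 _ k).
  rewrite !mxE (le_trans L)// ler_wpM2r//.
  by rewrite (le_trans _ CmC1)// ler_wpM2l.
exists C; split => [//|x|x v|x y|x v].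
- apply: norm_rV_le => [|j]; first exact: ltW.
  by have [_ h1 _ _] := h j; rewrite (le_trans (h1 x))// (le_trans (C1j j)).
- apply: norm_rV_le => [|j]; first by rewrite mulr_ge0// ltW.
  have [_ _ h1 _] := h j.
  have L := @derive_le _ (fun y => W y 0 j) x v (C0 j) (dW j _) (h1 x).
  rewrite DW (le_trans L)// ler_wpM2r//.
  by rewrite (le_trans _ CmC1)// ler_wpM2l.
- by have := lip x (y - x); rewrite (addrC x) subrK.
- apply: norm_rV_le => [|j]; first by rewrite mulr_ge0 ?sqr_ge0// ltW.
  have [_ _ _ h2] := h j.
  have L := @taylor_line _ (fun y => W y 0 j) x v (C0 j) (dW j) (ddW j)
    (fun k l y => h2 y k l).
  rewrite !mxE DW (le_trans L)//.
  rewrite ler_wpM2r ?sqr_ge0// (le_trans _ CmmC1)//.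
  by rewrite !ler_wpM2l.
Qed.

End field.
End bounds.

Section euler.
Context {R : realType} {m : nat}.
Variable W : 'rV[R]_m -> 'rV[R]_m.
Hypothesis WB : forall k, bounded_smooth (fun x => W x 0 k).

Definition is_solution (z : R -> 'rV[R]_m) :=
  forall t, is_derive t (1 : R) z (W (z t)).

Lemma is_solution_coord z k t : is_solution z ->
  is_derive t (1 : R) (fun t => z t 0 k) (W (z t) 0 k).
Proof.
move=> sz; have dz : differentiable z t.
  by apply/derivable1_diffP; exact: ex_derive.
apply: DeriveDef.
  by apply/diff_derivable; have /differentiable_coords := dz; exact.
by rewrite derive_coord// (@derive_val _ _ _ _ _ _ _ (sz t)).
Qed.

Lemma solution_lip z C s t : (forall x, `|W x| <= C) -> is_solution z ->
  `|z t - z s| <= C * `|t - s|.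
Proof.
move=> WC sz; apply: norm_rV_le => [|k].
  by rewrite mulr_ge0// (le_trans _ (WC 0)).
have [u _ E] := curve_mvt s t (fun u => is_solution_coord k u sz).
rewrite !mxE E normrM ler_wpM2r// (le_trans _ (WC (z u)))//; exact: norm_coord.
Qed.

(* Squares are used because the norm, a maximum, is not differentiable. *)
Lemma solution_gronwall : exists L, 0 < L /\ forall z z', is_solution z -> is_solution z' ->
  forall s t, `|z t - z' t| ^+ 2 <= m%:R * expR (L * `|t - s|) * `|z s - z' s| ^+ 2.
Proof.
have [C [C0 WC _ Wlip _]] := field_bounds WB.
(* [q'] is bounded by 2 m C |z - z'|^2, hence by 2 m C q; the added 1 makes [L] positive. *)
pose L := 2 * m%:R * C + 1.
have L0 : 0 < L by rewrite /L ltr_wpDl// !mulr_ge0// ltW.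
exists L; split=> // z z' sz sz' s t.
pose dk k t := z t 0 k - z' t 0 k.
pose q t := \sum_k dk k t ^+ 2.
pose q' t := \sum_k 2 * dk k t * (W (z t) 0 k - W (z' t) 0 k).
have qd u : is_derive u (1 : R) q (q' u).
  have -> : q = \sum_k (fun t => dk k t ^+ 2) by apply/funext => w; rewrite fct_sumE.
  apply: is_derive_sum => k.
  have dd : is_derive u (1 : R) (dk k) (W (z u) 0 k - W (z' u) 0 k).
    by apply: is_deriveB; exact: is_solution_coord.
  have := is_deriveMR dd dd.
  rewrite (_ : _ + _ = 2 * dk k u * (W (z u) 0 k - W (z' u) 0 k)); last by ring.
  by under eq_fun do rewrite -expr2.
have dk_le k u : `|dk k u| <= `|z u - z' u|.
  by have := norm_coord (z u - z' u) 0 k; rewrite !mxE.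
have zq u : `|z u - z' u| ^+ 2 <= q u.
  have [->|zu] := eqVneq (z u - z' u) 0.
    by rewrite normr0 expr0n/=; apply: sumr_ge0 => k _; exact: sqr_ge0.
  have zu0 : `|z u - z' u| != 0 by rewrite normr_eq0.
  have [[i j] /= E] := mx_norm_neq0 zu0.
  have -> : `|z u - z' u| = `|(z u - z' u) i j| := E.
  rewrite ord1 !mxE /q (bigD1 j)//= real_normK ?num_real// lerDl.
  by apply: sumr_ge0 => k _; exact: sqr_ge0.
have qz u : q u <= m%:R * `|z u - z' u| ^+ 2.
  rewrite natr_mul_sum; apply: ler_sum => k _.
  rewrite -[dk k u ^+ 2]real_normK ?num_real// lerXn2r// nnegrE//.
have q'le u : `|q' u| <= L * q u.
  apply: (@le_trans _ _ (2 * m%:R * C * q u)); last first.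
    rewrite ler_wpM2r ?lerDl//.
    by apply: sumr_ge0 => k _; exact: sqr_ge0.
  apply: (@le_trans _ _ (2 * m%:R * C * `|z u - z' u| ^+ 2)); last first.
    by rewrite ler_wpM2l// !mulr_ge0// ltW.
  rewrite (le_trans (ler_norm_sum _ _ _))//.
  have -> : 2 * m%:R * C * `|z u - z' u| ^+ 2 = m%:R * (2 * C * `|z u - z' u| ^+ 2) by ring.
  rewrite natr_mul_sum; apply: ler_sum => k _.
  rewrite !normrM (ger0_norm (ler0n _ 2)).
  have -> : 2 * C * `|z u - z' u| ^+ 2 = 2 * (`|z u - z' u| * (C * `|z u - z' u|)) by ring.
  rewrite -mulrA ler_wpM2l// ler_pM//.
  have := norm_coord (W (z u) - W (z' u)) 0 k; rewrite !mxE => /le_trans; apply.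
  exact: Wlip.
have expd a u : is_derive u (1 : R) (fun u => expR (a * u)) (a * expR (a * u)).
  rewrite mulrC; apply: (@is_derive1_comp _ expR (fun u => a * u) u (expR (a * u)) a).
  by apply: is_derive_eq; rewrite /GRing.scale/= mulr1.
(* [expR (- L * w) * q w] does not increase and [expR (L * w) * q w] does not decrease in [w], which
   bounds [q] in both time directions. *)
have main u v : u <= v -> q v <= expR (L * (v - u)) * q u /\ q u <= expR (L * (v - u)) * q v.
  move=> uv; split.
  - have h : forall w, is_derive w (1 : R) (fun w => expR (- L * w) * q w)
        (expR (- L * w) * (q' w - L * q w)).
      move=> w; have := is_deriveMR (expd (- L) w) (qd w).
      by rewrite (_ : _ + _ = expR (- L * w) * (q' w - L * q w))//; ring.
    have [w _ E] := curve_mvt u v h.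
    have : expR (- L * v) * q v - expR (- L * u) * q u <= 0.
      rewrite E mulr_le0_ge0 ?subr_ge0// mulr_ge0_le0 ?expR_ge0// subr_le0.
      by rewrite (le_trans (ler_norm _)).
    rewrite subr_le0 => le1.
    have -> : q v = expR (L * v) * (expR (- L * v) * q v).
      by rewrite mulrA -expRD -mulrDl subrr mul0r expR0 mul1r.
    have -> : expR (L * (v - u)) * q u = expR (L * v) * (expR (- L * u) * q u).
      by rewrite mulrA -expRD; congr (expR _ * _); ring.
    by rewrite ler_wpM2l// expR_ge0.
  - have h : forall w, is_derive w (1 : R) (fun w => expR (L * w) * q w)
        (expR (L * w) * (q' w + L * q w)).
      move=> w; have := is_deriveMR (expd L w) (qd w).
      by rewrite (_ : _ + _ = expR (L * w) * (q' w + L * q w))//; ring.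
    have [w _ E] := curve_mvt u v h.
    have : 0 <= expR (L * v) * q v - expR (L * u) * q u.
      rewrite E mulr_ge0 ?subr_ge0// mulr_ge0 ?expR_ge0//.
      have := q'le w; rewrite ler_norml => /andP[+ _].
      by rewrite -subr_ge0 opprK.
    rewrite subr_ge0 => le1.
    have -> : q u = expR (- L * u) * (expR (L * u) * q u).
      by rewrite mulrA -expRD -mulrDl addrC subrr mul0r expR0 mul1r.
    have -> : expR (L * (v - u)) * q v = expR (- L * u) * (expR (L * v) * q v).
      by rewrite mulrA -expRD; congr (expR _ * _); ring.
    by rewrite ler_wpM2l// expR_ge0.
apply: le_trans (zq t) _; rewrite [m%:R * _]mulrC -mulrA.
apply: (@le_trans _ _ (expR (L * `|t - s|) * q s)); last first.
  by rewrite ler_wpM2l ?expR_ge0.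
have [st|/ltW ts] := leP s t.
  by rewrite ger0_norm ?subr_ge0//; have [] := main s t st.
by rewrite ler0_norm ?subr_le0// opprB; have [] := main t s ts.
Qed.

Lemma solution_dep (T : R) : exists K, 0 < K /\
  forall z z', is_solution z -> is_solution z' ->
  forall s t, `|t - s| <= T -> `|z t - z' t| <= K * `|z s - z' s|.
Proof.
have [L [L0 H]] := solution_gronwall.
pose A := m%:R * expR (L * T).
have A0 : 0 <= A by rewrite mulr_ge0// expR_ge0.
(* The estimate is for squares; [A + 1] replaces a square root of [A], since A <= (A + 1)^2. *)
exists (A + 1); split=> [|z z' sz sz' s t ts]; first by rewrite ltr_wpDl.
rewrite -(@ler_pXn2r _ 2)// ?nnegrE// ?mulr_ge0// ?addr_ge0//.
apply: le_trans (H z z' sz sz' s t) _.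
rewrite exprMn ler_wpM2r ?sqr_ge0//.
apply: (@le_trans _ _ A).
  by rewrite ler_wpM2l// ler_expR ler_wpM2l// ltW.
rewrite expr2 (le_trans (y := A + 1)) ?lerDl// ler_peMr ?addr_ge0//.
by rewrite lerDr.
Qed.

Lemma solution_unique z z' s : is_solution z -> is_solution z' -> z s = z' s ->
  forall t, z t = z' t.
Proof.
move=> sz sz' zs t.
have [L [L0 H]] := solution_gronwall.
have := H z z' sz sz' s t; rewrite zs subrr normr0 expr0n/= mulr0.
rewrite exprn_even_le0//= normr_eq0 subr_eq0 => /eqP//.
Qed.

Definition euler (tau : R) (x : 'rV[R]_m) := x + tau *: W x.

(** Each step multiplies the error by at most exp (a tau) and adds b tau^2. After k <= n steps the
    error is at most k b tau^2 exp (a tau)^k, which is of order tau once n tau is fixed. *)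
Lemma discrete_gronwall (a b tau : R) (e : nat -> R) (n : nat) :
  0 <= a -> 0 <= b -> 0 <= tau -> e 0%N <= 0 ->
  (forall k, e k.+1 <= (1 + a * tau) * e k + b * tau ^+ 2) ->
  forall k, (k <= n)%N -> e k <= b * (n%:R * tau) * expR (a * (n%:R * tau)) * tau.
Proof.
move=> a0 b0 t0 e0 eS.
have E0 : 1 <= expR (a * tau) by rewrite -expR0 ler_expR mulr_ge0.
have h k : e k <= k%:R * (b * tau ^+ 2) * expR (a * tau) ^+ k.
  elim: k => [|k IH]; first by rewrite !mul0r.
  apply: le_trans (eS k) _.
  have at1 : 1 + a * tau <= expR (a * tau) by exact: expR_ge1Dx.
  have X0 : 0 <= k%:R * (b * tau ^+ 2) * expR (a * tau) ^+ k.
    by rewrite !mulr_ge0// ?sqr_ge0// exprn_ge0// expR_ge0.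
  have -> : k.+1%:R * (b * tau ^+ 2) * expR (a * tau) ^+ k.+1 =
     expR (a * tau) * (k%:R * (b * tau ^+ 2) * expR (a * tau) ^+ k) +
      b * tau ^+ 2 * expR (a * tau) ^+ k.+1 by rewrite [_ ^+ k.+1]exprS -natr1; ring.
  apply: lerD; last by rewrite ler_peMr ?exprn_ege1// mulr_ge0// sqr_ge0.
  apply: le_trans (_ : _ <= (1 + a * tau) * (k%:R * (b * tau ^+ 2) * expR (a * tau) ^+ k)) _.
    by rewrite ler_wpM2l// addr_ge0// mulr_ge0.
  by rewrite ler_wpM2r.
move=> k kn; apply: le_trans (h k) _.
have -> : expR (a * (n%:R * tau)) = expR (a * tau) ^+ n.
  by rewrite -expRM_natl; congr expR; ring.
have -> : b * (n%:R * tau) * expR (a * tau) ^+ n * tau = n%:R * (b * tau ^+ 2) * expR (a * tau) ^+ n.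
  by ring.
rewrite ler_pM//.
- by rewrite mulr_ge0 ?mulr_ge0 ?sqr_ge0 ?exprn_ge0 ?expR_ge0.
- by rewrite ler_wpM2r ?mulr_ge0 ?sqr_ge0// ler_nat.
- exact: ler_weXn2l.
Qed.

Lemma euler_cvg (T : R) : 0 < T -> exists K, 0 < K /\
  forall n, (0 < n)%N -> forall z, is_solution z -> forall t0 k, (k <= n)%N ->
  `|iter k (euler (T / n%:R)) (z t0) - z (t0 + k%:R * (T / n%:R))| <= K * (T / n%:R).
Proof.
move=> T0; have [C [C0 WC _ Wlip _]] := field_bounds WB.
exists (C * C * T * expR (C * T) + 1); split.
  by rewrite ltr_wpDl// !mulr_ge0 ?expR_ge0// ltW.
move=> n n0 z sz t0 k kn; set tau := T / n%:R.
have nT : n%:R * tau = T by rewrite mulrC divfK// pnatr_eq0 -lt0n.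
have tau0 : 0 < tau by rewrite divr_gt0// ltr0n.
pose e k := `|iter k (euler tau) (z t0) - z (t0 + k%:R * tau)|.
suff : e k <= C * C * (n%:R * tau) * expR (C * (n%:R * tau)) * tau.
  by rewrite nT => /le_trans; apply; rewrite ler_wpM2r ?(ltW tau0)// lerDl.
apply: (discrete_gronwall (e := e)) kn => //.
- exact: ltW.
- by rewrite mulr_ge0// ltW.
- exact: ltW.
- by rewrite /e /= mul0r addr0 subrr normr0.
move=> j; rewrite /e /= {2}/euler.
set y := iter j _ _; set s := t0 + j%:R * tau.
have -> : t0 + j.+1%:R * tau = s + tau by rewrite -natr1 mulrDl mul1r addrA.
have -> : y + tau *: W y - z (s + tau) =
   (y - z s) + tau *: (W y - W (z s)) - (z (s + tau) - z s - tau *: W (z s)).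
  by apply/rowP => i; rewrite !mxE; ring.
(* Local error of one step: within time tau the solution moves by at most C tau, so [W] changes by
   at most C (C tau) along it. *)
have h1 : `|z (s + tau) - z s - tau *: W (z s)| <= C * C * tau ^+ 2.
  apply: norm_rV_le => [|i]; first by rewrite !mulr_ge0 ?sqr_ge0// ltW.
  have [u us E] := curve_mvt s (s + tau) (fun u => is_solution_coord i u sz).
  rewrite !mxE E addrAC subrr add0r mulrC -mulrBr normrM (gtr0_norm tau0).
  have -> : C * C * tau ^+ 2 = tau * (C * (C * tau)) by ring.
  rewrite ler_wpM2l ?(ltW tau0)//.
  have := norm_coord (W (z u) - W (z s)) 0 i; rewrite !mxE => /le_trans; apply.
  apply: le_trans (Wlip _ _) _; rewrite ler_wpM2l ?(ltW C0)//.
  apply: le_trans (solution_lip _ _ WC sz) _; rewrite ler_wpM2l ?(ltW C0)//.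
  by move: us; rewrite addrAC subrr add0r (gtr0_norm tau0).
rewrite (le_trans (ler_normB _ _))// lerD// (le_trans (ler_normD _ _))//.
rewrite mulrDl mul1r lerD// normrZ (gtr0_norm tau0) -mulrA mulrCA.
by rewrite ler_wpM2l ?(ltW tau0).
Qed.

Lemma smoothV_euler tau : smoothV setT (euler tau).
Proof.
move=> k.
have -> : (fun y => euler tau y 0 k) = (fun y => y 0 k + tau * W y 0 k).
  by apply/funext => y; rewrite !mxE.
apply: smooth_add; [exact: openT|exact: smooth_coordf|].
apply: smooth_mul; [exact: openT|exact: smooth_cst|exact: field_smooth].
Qed.

Lemma smooth_iter_euler tau k (u : 'rV[R]_m -> R) :
  smooth_on setT u -> smooth_on setT (u \o iter k (euler tau)).
Proof.
elim: k u => [|k IH] u su.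
  by rewrite (_ : u \o _ = u).
have -> : u \o iter k.+1 (euler tau) = (u \o euler tau) \o iter k (euler tau) by [].
apply: IH; apply: smooth_comp su => //; [exact: openT|exact: smoothV_euler].
Qed.

Lemma diff_iter_euler tau k x : differentiable (iter k (euler tau)) x.
Proof.
elim: k => [|k IH]; first exact: (@ex_diff _ _ _ _ _ _ _ (is_diff_id x)).
have -> : iter k.+1 (euler tau) = euler tau \o iter k (euler tau) by [].
apply: differentiable_comp => //; apply: smoothV_diff (@smoothV_euler tau) _ => //.
Qed.

Definition euler_mean (u : 'rV[R]_m -> R) (T : R) (n : nat) (x : 'rV[R]_m) : R :=
  n%:R^-1 * \sum_(k < n) u (iter k (euler (T / n%:R)) x).

Lemma smooth_euler_mean u T n : smooth_on setT u -> smooth_on setT (euler_mean u T n).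
Proof.
move=> su; apply: smooth_mul; [exact: openT|exact: smooth_cst|].
by apply: smooth_sum => [|k _]; [exact: openT|exact: smooth_iter_euler].
Qed.

(** A flow transports its generator to itself; correspondingly, the derivative of the k-th Euler
    iterate in the direction [W x] is [W] at that iterate up to O(tau). So tau times each summand is
    nearly the increment of [u] over one step, and the increments telescope to a difference of two
    values in [0, 1]. *)
Lemma derive_euler_mean (u : 'rV[R]_m -> R) (T : R) : 0 < T ->
  bounded_smooth u -> (forall x, 0 <= u x <= 1) ->
  exists K, 0 < K /\ forall n, (0 < n)%N -> forall x,
    `|'D_(W x) (euler_mean u T n) x| <= 1 / T + K * (T / n%:R).
Proof.
move=> T0 Bu u01.
have [C [C0 WC Wd Wlip Wt]] := field_bounds WB.
have [Cu [Cu0 _ ud udd]] := bounded_smooth_coef Bu.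
have su := Bu.1.
have du x : differentiable u x by exact: smooth_on_diff su _.
have ddu k x : differentiable ('D_(delta_mx 0 k) u) x.
  exact: smooth_on_diff (smooth_on_derive _ su) _.
pose M := m%:R * Cu; have M0 : 0 <= M by rewrite mulr_ge0.
pose M2 := m%:R * (m%:R * Cu); have M20 : 0 <= M2 by rewrite !mulr_ge0.
(* Comes from [discrete_gronwall] with a = C and b = C^3: the Taylor remainder of [W] over the step
   tau W is at most C |tau W|^2 <= C^3 tau^2. *)
pose E := C ^+ 3 * T * expR (C * T).
have E0 : 0 <= E by rewrite !mulr_ge0 ?expR_ge0 ?exprn_ge0// ltW.
exists (M * E + M2 * C ^+ 2 + 1); split.
  by rewrite ltr_wpDl// addr_ge0// mulr_ge0// ?sqr_ge0.
move=> n n0 x; set tau := T / n%:R.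
have nT : n%:R * tau = T by rewrite mulrC divfK// pnatr_eq0 -lt0n.
have tau0 : 0 < tau by rewrite divr_gt0// ltr0n.
pose z k := iter k (euler tau) x.
pose v k := 'D_(W x) (iter k (euler tau)) x.
have zS k : z k.+1 = z k + tau *: W (z k) by [].
have v0 : v 0%N = W x by rewrite /v /= derive_id.
have vS k : v k.+1 = v k + tau *: 'D_(v k) W (z k).
  rewrite /v.
  have -> : iter k.+1 (euler tau) = euler tau \o iter k (euler tau) by [].
  rewrite derive_comp; last 2 first.
  - exact: diff_iter_euler.
  - by apply: smoothV_diff (@smoothV_euler tau) _.
  rewrite -/(v k) -/(z k).
  have -> : euler tau = id + tau *: W by [].
  rewrite deriveD; [|exact: derivable_id|exact/derivableZ/diff_derivable/field_diff].
  by rewrite derive_id deriveZ//; exact/diff_derivable/field_diff.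
have ve k : (k <= n)%N -> `|v k - W (z k)| <= E * tau.
  move=> kn; pose e k := `|v k - W (z k)|.
  suff : e k <= C ^+ 3 * (n%:R * tau) * expR (C * (n%:R * tau)) * tau by rewrite nT.
  apply: (discrete_gronwall (e := e)) kn => //; [exact: ltW|by rewrite exprn_ge0// ltW|exact: ltW|by rewrite /e v0 subrr normr0|].
  move=> j; rewrite /e vS zS.
  have -> : v j + tau *: 'D_(v j) W (z j) - W (z j + tau *: W (z j)) =
    (v j - W (z j)) + tau *: 'D_(v j - W (z j)) W (z j)
      - (W (z j + tau *: W (z j)) - W (z j) - 'D_(tau *: W (z j)) W (z j)).
    have dW := field_diff WB (z j).
    rewrite !deriveE// linearB linearZ /= scalerBr.
    by apply/rowP => i; rewrite !mxE; ring.
  rewrite (le_trans (ler_normB _ _))// lerD//.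
    rewrite (le_trans (ler_normD _ _))// mulrDl mul1r lerD// normrZ (gtr0_norm tau0).
    by rewrite -mulrA mulrCA ler_wpM2l ?(ltW tau0).
  rewrite (le_trans (Wt _ _))// normrZ (gtr0_norm tau0) exprMn.
  have -> : C ^+ 3 * tau ^+ 2 = C * (tau ^+ 2 * C ^+ 2) by ring.
  by rewrite ler_wpM2l ?(ltW C0)// ler_wpM2l ?sqr_ge0// lerXn2r// nnegrE// ltW.
have ue k : (k < n)%N ->
  `|tau * 'D_(W x) (u \o iter k (euler tau)) x - (u (z k.+1) - u (z k))| <=
   (M * E + M2 * C ^+ 2) * tau ^+ 2.
  move=> kn; rewrite derive_comp//; last exact: diff_iter_euler.
  rewrite -/(v k) -/(z k) zS.
  have -> : tau * 'D_(v k) u (z k) - (u (z k + tau *: W (z k)) - u (z k)) =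
     tau * 'D_(v k - W (z k)) u (z k) - (u (z k + tau *: W (z k)) - u (z k) - 'D_(tau *: W (z k)) u (z k)).
    rewrite !deriveE// linearB linearZ /= /GRing.scale/=; ring.
  rewrite (le_trans (ler_normB _ _))// mulrDl lerD//.
    have -> : M * E * tau ^+ 2 = tau * (M * (E * tau)) by ring.
    rewrite normrM (gtr0_norm tau0) ler_wpM2l ?(ltW tau0)//.
    apply: le_trans (derive_le (v k - W (z k)) (du _) (ud _)) _.
    by rewrite ler_wpM2l// ve// ltnW.
  apply: le_trans (@taylor_line _ _ u (z k) (tau *: W (z k)) Cu du ddu (fun k l y => udd y k l)) _.
  rewrite -/M2 -mulrA ler_wpM2l// normrZ (gtr0_norm tau0) exprMn mulrC ler_wpM2r ?sqr_ge0//.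
  by rewrite lerXn2r// nnegrE// ltW.
have -> : 'D_(W x) (euler_mean u T n) x =
    n%:R^-1 * \sum_(k < n) 'D_(W x) (u \o iter k (euler tau)) x.
  have duk k : derivable (u \o iter k (euler tau)) x (W x).
    by apply: diff_derivable; apply: differentiable_comp => //; exact: diff_iter_euler.
  have -> : euler_mean u T n = n%:R^-1 *: \sum_(k < n) (u \o iter k (euler tau)).
    by apply/funext => y; rewrite /euler_mean fctE fct_sumE.
  by rewrite deriveZ ?derive_sum//; exact: derivable_sum.
have tele : \sum_(k < n) (u (z k.+1) - u (z k)) = u (z n) - u x.
  by rewrite -(big_mkord xpredT (fun k => u (z k.+1) - u (z k))) telescope_sumr.
set S := \sum_(k < n) _.
have hS : `|tau * S - (u (z n) - u x)| <= T * (M * E + M2 * C ^+ 2) * tau.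
  rewrite -tele /S mulr_sumr -sumrB (le_trans (ler_norm_sum _ _ _))//.
  apply: (@le_trans _ _ (\sum_(k < n) ((M * E + M2 * C ^+ 2) * tau ^+ 2))).
    by apply: ler_sum => k _; exact: ue.
  move: (M * E + M2 * C ^+ 2) => X.
  have -> : T * X * tau = n%:R * tau * X * tau by rewrite nT.
  rewrite sumr_const card_ord -[leLHS]mulr_natl.
  by rewrite (_ : _ * (X * _) = n%:R * tau * X * tau) //; ring.
have u1 : `|u (z n) - u x| <= 1.
  have /andP[a b] := u01 (z n); have /andP[c d] := u01 x.
  by rewrite ler_norml; apply/andP; split; lra.
have -> : n%:R^-1 * S = T^-1 * (tau * S).
  rewrite -nT invfM mulrA; congr (_ * S).
  by rewrite -mulrA mulVf ?mulr1// gt_eqF.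
rewrite normrM gtr0_norm ?invr_gt0// mulrC ler_pdivrMr// mulrDl mul1r mulVf ?gt_eqF//.
have : `|tau * S| <= T * (M * E + M2 * C ^+ 2) * tau + 1.
  by rewrite -[tau * S](subrK (u (z n) - u x)) (le_trans (ler_normD _ _))// lerD.
move=> /le_trans; apply; rewrite addrC lerD2l.
move: (M * E + M2 * C ^+ 2) => X.
have -> : T * X * tau = X * (tau * T) by ring.
by rewrite -[leRHS]mulrA ler_wpM2r ?lerDl ?mulr_ge0 ?(ltW tau0) ?(ltW T0).
Qed.

End euler.

(** The filter [F] is generated by the sets of sequences that contain a given finite list of points
    of [K]. A sequence containing [x] covers all of [P x], a neighbourhood of [x]; the near-covering
    form of compactness turns this into one sequence for the whole of [K]. *)
Lemma compact_seq_cover (T : topologicalType) (K : set T) (P : T -> set T) :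
  compact K -> (forall x, K x -> nbhs x (P x)) ->
  exists s : seq T, (forall x, x \in s -> K x) /\
    forall y, K y -> exists2 x, x \in s & P x y.
Proof.
move=> /compact_near_coveringP cK hP.
pose F : set_system (seq T) := [set Q : set (seq T) | exists s0 : seq T,
  (forall x, x \in s0 -> K x) /\ forall s : seq T, {subset s0 <= s} -> Q s].
have FF : Filter F.
  split.
  - by exists [::].
  - move=> P1 P2 [s1 [s1K h1]] [s2 [s2K h2]]; exists (s1 ++ s2); split.
      by move=> x; rewrite mem_cat => /orP[/s1K|/s2K].
    move=> s ss; split; [apply: h1|apply: h2] => x xs; apply: ss;
    by rewrite mem_cat xs ?orbT.
  - by move=> P1 P2 P12 [s1 [s1K h1]]; exists s1; split=> // s /h1/P12.
have [x Kx|s [sK h]] := cK _ F (fun (s : seq T) y => exists2 x, x \in s & P x y) FF.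
  exists (P x, [set s : seq T | x \in s]).
    split; first exact: hP.
    exists [:: x]; split; first by move=> y; rewrite inE => /eqP ->.
    by move=> s; apply; rewrite inE.
  by move=> [y s] [/= Py xs]; exists x.
by exists s; split => // y Ky; apply: h.
Qed.

(** * Smooth Urysohn functions *)

Section urysohn.
Context {R : realType}.

Lemma cont_norm_sub {n} (c : 'rV[R]_n) : continuous (fun v : 'rV[R]_n => `|v - c|).
Proof.
have h : continuous (fun v : 'rV[R]_n => v - c).
  by move=> w; apply: continuousB; [exact: id|exact: cst_continuous].
by move=> v; apply: (continuous_comp (h v)); exact: norm_continuous.
Qed.

Lemma closed_ball_rV_compact {n} (c : 'rV[R]_n) r : compact [set v : 'rV[R]_n | `|v - c| <= r].
Proof.
apply: bounded_closed_compact.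
  exists (r + `|c|); split; first exact: num_real.
  move=> x xr v /= vr; rewrite (le_trans _ (ltW xr))//.
  by rewrite -[v](subrK c) (le_trans (ler_normD _ _))// lerD2r.
apply: (@preimage_closed _ _ (fun v : 'rV[R]_n => `|v - c|) [set x : R | x <= r]); last exact: closed_le.
by move=> v _; exact: cont_norm_sub.
Qed.

Lemma open_ball_rV {n} (c : 'rV[R]_n) r : open [set v : 'rV[R]_n | `|v - c| < r].
Proof.
have -> : [set v : 'rV[R]_n | `|v - c| < r] = (fun v => `|v - c|) @^-1` [set x : R | x < r] by [].
apply: open_comp; last exact: open_lt.
by move=> v _; exact: cont_norm_sub.
Qed.

Lemma nbhs_ball_le {n} (O : set 'rV[R]_n) (c : 'rV[R]_n) : nbhs c O ->
  exists2 r : R, 0 < r & forall v : 'rV[R]_n, `|v - c| <= r -> O v.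
Proof.
move=> /nbhs_ballP[e /= e0 eO]; exists (e / 2); first by rewrite divr_gt0.
move=> v vc; apply: eO; rewrite -ball_normE /ball_/= distrC (le_lt_trans vc)//.
by rewrite ltr_pdivrMr// ltr_pMr// ltr1n.
Qed.

Lemma compact_ball_sub {n} (K O : set 'rV[R]_n) : compact K -> open O -> K `<=` O ->
  exists2 d, 0 < d & forall z, K z -> forall z', `|z' - z| < d -> O z'.
Proof.
move=> /compact_near_coveringP cK oO KO.
have H : \forall d \near 0^'+, K `<=` (fun z => forall z', `|z' - z| < d -> O z').
  apply: (cK _ _ (fun (d : R) z => forall z', `|z' - z| < d -> O z')) => z Kz.
  have [r r0 rO] := nbhs_ball_le (open_nbhs_nbhs (conj oO (KO z Kz))).
  exists ([set z1 | `|z1 - z| < r / 2], [set d : R | d < r / 2]).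
    split=> /=; last by apply: nbhs_right_lt; rewrite divr_gt0.
    apply: open_nbhs_nbhs; split; first exact: open_ball_rV.
    by rewrite /= subrr normr0 divr_gt0.
  move=> [z1 d] [/= z1z dr] z' z'd; apply: rO.
  rewrite -[z'](subrK z1) -addrA (le_trans (ler_normD _ _))// [leRHS](splitr r).
  by rewrite lerD// ltW// (lt_trans z'd).
have [d [dH d0]] : exists d : R, K `<=` (fun z => forall z', `|z' - z| < d -> O z') /\ 0 < d.
  apply: (@filter_ex _ (0^'+ : set_system R)); near=> d; split; first by near: d.
  by near: d; exact: nbhs_right_gt.
by exists d => // z Kz; exact: dH.
Unshelve. all: by end_near. Qed.

(** The function 1 - prod (1 - bump) is 1 as soon as one bump is 1, and 0 where all bumps vanish. It
    has to be constant on neighbourhoods of [K] and [C], because it will be evaluated at Euler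
    iterates, which only approximate the orbits. *)
Lemma smooth_urysohn {n} (K C : set 'rV[R]_n) : compact K -> closed C ->
  K `&` C = set0 ->
  exists u : 'rV[R]_n -> R, [/\ smooth_on setT u, forall z, 0 <= u z <= 1,
    exists B, forall z, B <= `|z| -> u z = 0,
    exists O, [/\ open O, K `<=` O & forall z, O z -> u z = 1] &
    exists O, [/\ open O, C `<=` O & forall z, O z -> u z = 0] ].
Proof.
move=> cK cC KC.
have H c : exists r, K c -> 0 < r /\ forall v, `|v - c| <= 2 * r -> ~ C v.
  have [Kc|nKc] := pselect (K c); last by exists 0.
  have [|r r0 rC] := @nbhs_ball_le n (~` C) c.
    apply: open_nbhs_nbhs; split; first exact: closed_openC.
    by move=> Cc; have : (K `&` C) c by []; rewrite KC.
  by exists (r / 2) => _; split; [rewrite divr_gt0|rewrite mulrC divfK].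
have {H} /choice[r rP] := H.
have [|s [sK cov]] := @compact_seq_cover _ K (fun c => [set v | `|v - c| < r c]) cK.
  move=> c Kc; apply: open_nbhs_nbhs; split; first exact: open_ball_rV.
  by rewrite /= subrr normr0; exact: (rP c Kc).1.
pose u (z : 'rV[R]_n) : R := 1 - \prod_(c <- (s : seq 'rV[R]_n)) (1 - box_bump c (r c) z).
have b01 (c z : 'rV[R]_n) : 0 <= 1 - box_bump c (r c) z <= 1.
  by rewrite subr_ge0 bump_le1 lerBlDr lerDl bump_ge0.
exists u; split.
- apply: smooth_sub; [exact: openT|exact: smooth_cst|].
  apply: smooth_prod => [|c _]; first exact: openT.
  by apply: smooth_sub; [exact: openT|exact: smooth_cst|apply: smooth_bump; exact: openT].
- move=> z; rewrite subr_ge0 lerBlDr lerDl; apply/andP; split.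
    by apply: prodr_ile1 => c _; exact: b01.
  by apply: prodr_ge0 => c _; case/andP: (b01 c z).
- exists (\sum_(c <- s) (`|c| + 2 * `|r c|)) => z zB.
  rewrite /u big_seq big1 ?subrr// => c cs.
  have [r0 _] := rP c (sK c cs).
  rewrite bump_0 ?subr0//.
  have : `|c| + 2 * `|r c| <= `|z|.
    apply: le_trans zB; rewrite (big_rem c)//= lerDl.
    by apply: sumr_ge0 => i _; rewrite addr_ge0// mulr_ge0.
  rewrite (gtr0_norm r0) => le1.
  have := lerB_dist z c; lra.
- exists (\bigcup_(c in [set` s]) [set v | `|v - c| < r c]); split.
  + by apply: bigcup_open => c _; exact: open_ball_rV.
  + by move=> y /cov[c cs yc]; exists c.
  + move=> z [c /= cs zc]; rewrite /u (big_rem c)//= bump_1 ?subrr ?mul0r ?subr0//.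
      by have [] := rP c (sK c cs).
    exact: ltW.
- exists (\bigcap_(c in [set` s]) [set v | 2 * r c < `|v - c|]); split.
  + rewrite bigcap_seq; apply: big_rec; first exact: openT.
    move=> c U cs oU; apply: openI => //.
    have -> : [set v : 'rV[R]_n | 2 * r c < `|v - c|] = (fun v => `|v - c|) @^-1` [set x : R | 2 * r c < x] by [].
    apply: open_comp; last exact: open_gt.
    by move=> v _; exact: cont_norm_sub.
  + move=> v Cv c /= cs; rewrite ltNge; apply/negP => vc.
    by have [_ /(_ v vc)] := rP c (sK c cs).
  + move=> z zs; rewrite /u big_seq big1 ?subrr// => c cs.
    have [r0 _] := rP c (sK c cs).
    by rewrite bump_0 ?subr0// ltW//; exact: zs.
Qed.

End urysohn.

(** * Functions on a strip, 1-periodic in time *)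

Section periodic.
Context {R : realType} {q : nat}.
Implicit Types (z : 'rV[R]_(q + 1)).

Definition tvec : 'rV[R]_(q + 1) := row_mx 0 (const_mx 1).
Definition tcoord z : R := rsubmx z 0 0.

Lemma norm_lsubmx z : `|lsubmx z| <= `|z|.
Proof. by apply: norm_rV_le => // k; rewrite mxE; exact: norm_coord. Qed.

Lemma lsubmx_continuous : continuous (lsubmx : 'rV[R]_(q + 1) -> 'rV[R]_q).
Proof. by move=> z; apply: differentiable_continuous; exact: differentiable_lsubmx. Qed.

Lemma periodicZ (f : 'rV[R]_(q + 1) -> R) : (forall z, f (z + tvec) = f z) ->
  forall (k : int) z, f (z + k%:~R *: tvec) = f z.
Proof.
move=> ft.
have ftN n z : f (z + n%:R *: tvec) = f z.
  elim: n => [|n IH]; first by rewrite scale0r addr0.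
  by rewrite -natr1 scalerDl scale1r addrA ft IH.
case=> n z; first by rewrite ftN.
by rewrite NegzE -(ftN n.+1) -addrA -scalerDl mulrNz addNr scale0r addr0.
Qed.

(* Such functions have bounded derivatives of all orders. *)
Definition strip_fun (f : 'rV[R]_(q + 1) -> R) :=
  [/\ smooth_on setT f, (exists B, forall z, B < `|lsubmx z| -> f z = 0) &
      forall z, f (z + tvec) = f z].

Lemma strip_derive f v : strip_fun f -> strip_fun ('D_v f).
Proof.
move=> [sf [B fB] ft]; split; first exact: smooth_on_derive.
- exists B => z zB; rewrite (near_eq_derive (g := cst 0)) ?derive_cst//.
  have oO : open [set z : 'rV[R]_(q + 1) | B < `|lsubmx z|].
    have -> : [set z : 'rV[R]_(q + 1) | B < `|lsubmx z|] =
       ((fun w : 'rV[R]_q => `|w|) \o lsubmx) @^-1` [set x : R | B < x] by [].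
    apply: open_comp; last exact: open_gt.
    move=> w _; apply: continuous_comp; first exact: lsubmx_continuous.
    exact: norm_continuous.
  by apply: filterS (open_nbhs_nbhs (conj oO zB)).
- move=> z; rewrite /derive; set d1 := fun h => _; set d2 := (X in _ = lim (X @ _)).
  suff -> : d1 = d2 by [].
  by apply/funext => h; rewrite /d1 /d2 /= addrA !ft.
Qed.

(** Periodicity brings the time coordinate into [0, 1], and beyond [B] in the other coordinates the
    function is 0; what remains lies in a compact ball. *)
Lemma strip_bounded f : strip_fun f -> exists C, forall z, `|f z| <= C.
Proof.
move=> [sf [B fB] ft].
pose r := Num.max B 1.
pose K := [set z : 'rV[R]_(q + 1) | `|z - 0| <= r].
have cf : continuous f.
  by move=> z; apply: differentiable_continuous; exact: smooth_on_diff sf _.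
have r0 : 0 <= r by rewrite le_max ler01 orbT.
have [||| c _ cmax] := @EVT_max_rV R _ (fun z => `|f z|) K.
- by exists 0; rewrite /K/= subrr normr0.
- exact: closed_ball_rV_compact.
- apply: continuous_subspaceT => z; apply: continuous_comp; first exact: cf.
  exact: norm_continuous.
exists (`|f c|) => z.
have [zB|zB] := ltP B `|lsubmx z|; first by rewrite fB// normr0.
pose k := Num.floor (tcoord z).
rewrite -(periodicZ ft (- k) z); apply: cmax; rewrite inE /K/= subr0.
apply: norm_rV_le => // i; rewrite mxE [X in _ + X]mxE.
rewrite /tvec; case: (split_ordP i) => j ->.
  rewrite row_mxEl mxE mulr0 addr0 le_max; apply/orP; left.
  by apply: le_trans zB; have := norm_coord (lsubmx z) 0 j; rewrite mxE.
rewrite row_mxEr mxE mulr1 mulrNz le_max; apply/orP; right.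
have -> : z 0 (rshift q j) = tcoord z by rewrite /tcoord mxE ord1.
have /andP[a b] := floor_itv (tcoord z).
rewrite ger0_norm ?subr_ge0// lerBlDl ltW//.
by move: b; rewrite intrD.
Qed.

Lemma strip_bounded_smooth f : strip_fun f -> bounded_smooth f.
Proof.
move=> sf; split; first by case: sf.
move=> s; suff : strip_fun (iter_derive s f) by exact: strip_bounded.
by elim: s => //= v s; exact: strip_derive.
Qed.

End periodic.

(** * Manifolds and symplectic gradients in charts *)

Section manifold.
Context {R : realType} {N : mfd_data R}.
Hypothesis mN : is_manifold N.
Implicit Types (i j : cidx N) (x : N) (v : 'rV[R]_(mdim N)).

Lemma cim_cmap i x : cdom (atlas N i) x -> cim (atlas N i) (cmap (atlas N i) x).
Proof. by move=> ?; exists x. Qed.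

Lemma cdom_cinv i v : cim (atlas N i) v -> cdom (atlas N i) (cinv (atlas N i) v).
Proof. by move=> [x dx <-]; rewrite mfd_mapK. Qed.

Lemma cmapK i v : cim (atlas N i) v -> cmap (atlas N i) (cinv (atlas N i) v) = v.
Proof. by move=> [x dx <-]; rewrite mfd_mapK. Qed.

Lemma open_chart_preim i (O : set N) : open O ->
  open [set v | cim (atlas N i) v /\ O (cinv (atlas N i) v)].
Proof.
move=> oO; rewrite openE => v [iv Ov].
have nO := @mfd_inv_cont _ _ mN i v iv O (open_nbhs_nbhs (conj oO Ov)).
have nI := open_nbhs_nbhs (conj (@mfd_im_open _ _ mN i) iv).
exact: (filterI nI nO).
Qed.

Lemma transition_smooth i j k :
  smooth_on [set v | cim (atlas N i) v /\ cdom (atlas N j) (cinv (atlas N i) v)]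
    (fun v => cmap (atlas N j) (cinv (atlas N i) v) 0 k).
Proof.
have oU := @open_chart_preim i _ (@mfd_dom_open _ _ mN j).
apply: (@smooth_coord _ _ _ _ _ (cmap (atlas N j) \o cinv (atlas N i)) 0 k) => //.
apply: (smooth_on_sub _ (@mfd_transition _ _ mN i j)) => v [iv jv].
by exists (cinv (atlas N i) v); [split => //; exact: cdom_cinv|exact: cmapK].
Qed.

Lemma smooth_fun_continuous (f : N -> R) : smooth_fun f -> continuous f.
Proof.
move=> sf x; pose i := at_pt N x.
have dx : cdom (atlas N i) x := mfd_at_pt mN x.
have E : \forall y \near x, (f \o cinv (atlas N i)) (cmap (atlas N i) y) = f y.
  apply: filterS (open_nbhs_nbhs (conj (@mfd_dom_open _ _ mN i) dx)) => y dy /=.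
  by rewrite mfd_mapK.
have c1 : {for cmap (atlas N i) x, continuous (f \o cinv (atlas N i))}.
  apply: differentiable_continuous; exact: smooth_on_diff (sf i) (cim_cmap dx).
rewrite /continuous_at -(nbhs_singleton E); apply: cvg_trans; first exact: near_eq_cvg E.
by apply: continuous_comp c1; exact: (@mfd_map_cont _ _ mN i x dx).
Qed.

Definition chart_ext i (phi : 'rV[R]_(mdim N) -> R) (x : N) : R :=
  if pselect (cdom (atlas N i) x) then phi (cmap (atlas N i) x) else 0.

Lemma chart_extE i phi x : cdom (atlas N i) x ->
  chart_ext i phi x = phi (cmap (atlas N i) x).
Proof. by rewrite /chart_ext; case: pselect. Qed.

Lemma chart_ext_supp i phi (K : set 'rV[R]_(mdim N)) x :
  (forall v, ~ K v -> phi v = 0) ->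
  ~ (cinv (atlas N i) @` K) x -> chart_ext i phi x = 0.
Proof.
move=> phiK nx; rewrite /chart_ext; case: pselect => // dx; apply: phiK => Kx.
by apply: nx; exists (cmap (atlas N i) x) => //; rewrite mfd_mapK.
Qed.

Lemma compact_cinv i (K : set 'rV[R]_(mdim N)) : compact K ->
  K `<=` cim (atlas N i) -> compact (cinv (atlas N i) @` K).
Proof.
move=> cK Ki; apply: continuous_compact => //; apply: continuous_in_subspaceT => v.
by rewrite inE => /Ki iv; exact: (@mfd_inv_cont _ _ mN i v iv).
Qed.

(** Since [N] is Hausdorff, the image of [K] is closed. Its complement, where the function is 0, and
    the chart domain, where it is [phi] in coordinates, form an open cover. *)
Lemma chart_ext_smooth i phi (K : set 'rV[R]_(mdim N)) :
  smooth_on setT phi -> compact K -> K `<=` cim (atlas N i) ->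
  (forall v, ~ K v -> phi v = 0) -> smooth_fun (chart_ext i phi).
Proof.
move=> sphi cK Ki phiK j; apply: smooth_on_local => v jv.
have clK : closed (cinv (atlas N i) @` K).
  by apply: compact_closed; [exact: mfd_hausdorff mN|exact: compact_cinv].
have oU := @open_chart_preim j _ (@mfd_dom_open _ _ mN i).
have oV := @open_chart_preim j _ (closed_openC clK).
have [iv|niv] := pselect (cdom (atlas N i) (cinv (atlas N j) v)).
  exists [set v | cim (atlas N j) v /\ cdom (atlas N i) (cinv (atlas N j) v)] => //.
  apply: (@smooth_on_ext _ _ _ _ (phi \o (cmap (atlas N i) \o cinv (atlas N j)))) => //.
    by move=> w [jw iw] /=; rewrite chart_extE.
  apply: smooth_comp sphi => //; exact: transition_smooth.
exists [set v | cim (atlas N j) v /\ (~` (cinv (atlas N i) @` K)) (cinv (atlas N j) v)].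
  split => // -[w Kw E]; apply: niv; rewrite -E; apply: cdom_cinv; exact: Ki.
apply: (@smooth_on_ext _ _ _ _ (cst 0)) => //; last exact: smooth_cst.
by move=> w [jw Kw] /=; rewrite (chart_ext_supp phiK).
Qed.

End manifold.

Section derive_row.
Context {R : realType} {a b : nat} {W : normedModType R}.

Lemma derive_row_l (f : 'rV[R]_(a + b) -> W) c x v :
  'D_v (fun x => f (row_mx x c)) x = 'D_(row_mx v 0) f (row_mx x c).
Proof.
rewrite /derive; set d1 := fun h => _; set d2 := (X in _ = lim (X @ _)).
suff -> : d1 = d2 by [].
by apply/funext => h; rewrite /d1 /d2 /= scale_row_mx add_row_mx scaler0 add0r.
Qed.

End derive_row.

Section symplectic.
Context {R : realType} {M : symp_data R}.
Hypothesis sM : is_symplectic_manifold M.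
Let mM := symp_manifold sM.

Lemma differentialE (i : cidx M) (F : M -> R) x w :
  differentiable (F \o cinv (atlas M i)) (cmap (atlas M i) x) ->
  (differential i F x *m w^T) 0 0 = 'D_w (F \o cinv (atlas M i)) (cmap (atlas M i) x).
Proof.
move=> dF; rewrite diff_row_sum// mxE; apply: eq_bigr => k _.
by rewrite !mxE mulrC.
Qed.

Lemma transition_diff (i j : cidx M) x : cdom (atlas M i) x -> cdom (atlas M j) x ->
  differentiable (cmap (atlas M j) \o cinv (atlas M i)) (cmap (atlas M i) x).
Proof.
move=> ix jx; apply: (@smoothV_diff _ _ _
  [set v | cim (atlas M i) v /\ cdom (atlas M j) (cinv (atlas M i) v)]).
  by move=> k; exact: (@transition_smooth _ _ mM i j k).
by split; [exact: cim_cmap|rewrite mfd_mapK].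
Qed.

Lemma derive_transition (W : normedModType R) (i j : cidx M) (f : M -> W) x v :
  cdom (atlas M i) x -> cdom (atlas M j) x ->
  differentiable (f \o cinv (atlas M j)) (cmap (atlas M j) x) ->
  let J := 'J (cmap (atlas M j) \o cinv (atlas M i)) (cmap (atlas M i) x) in
  'D_v (f \o cinv (atlas M i)) (cmap (atlas M i) x) =
  'D_(v *m J) (f \o cinv (atlas M j)) (cmap (atlas M j) x).
Proof.
move=> ix jx df J; rewrite -deriveEjacobian; last exact: transition_diff.
set T := cmap (atlas M j) \o cinv (atlas M i).
have Tx : T (cmap (atlas M i) x) = cmap (atlas M j) x by rewrite /T /= mfd_mapK.
rewrite -Tx -derive_comp; [|exact: transition_diff|by rewrite Tx].
apply: near_eq_derive.
have oU := @open_chart_preim _ _ mM i _ (@mfd_dom_open _ _ mM j).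
have Ux : cim (atlas M i) (cmap (atlas M i) x) /\
    cdom (atlas M j) (cinv (atlas M i) (cmap (atlas M i) x)).
  by split; [exact: cim_cmap|rewrite mfd_mapK].
apply: filterS (open_nbhs_nbhs (conj oU Ux)) => y [iy jy] /=.
by rewrite mfd_mapK.
Qed.

(** Gram matrices and differentials transform by the same Jacobian, so the equation that defines
    sgrad in chart [i] becomes the one in chart [j]. *)
Lemma sgrad_transition (i j : cidx M) (F : M -> R) x : smooth_fun F ->
  cdom (atlas M i) x -> cdom (atlas M j) x ->
  let J := 'J (cmap (atlas M j) \o cinv (atlas M i)) (cmap (atlas M i) x) in
  sgrad i F x *m J = sgrad j F x.
Proof.
move=> sF ix jx J.
have uj := symp_nondegenerate sM jx.
apply/(@sgradP _ _ j F x _ uj) => w.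
have ui := symp_nondegenerate sM ix.
have compat : symp_form M i x = J *m symp_form M j x *m J^T := symp_compat sM ix jx.
(* [J] is a factor of the invertible [symp_form M i x]; being invertible, it lets every test vector
   [w] be written as some w' times [J]. *)
have Ju : J \in unitmx.
  by move: ui; rewrite compat !unitmx_mul => /andP[/andP[]].
have dFi : differentiable (F \o cinv (atlas M i)) (cmap (atlas M i) x).
  exact: smooth_on_diff (sF i) (cim_cmap ix).
have dFj : differentiable (F \o cinv (atlas M j)) (cmap (atlas M j) x).
  exact: smooth_on_diff (sF j) (cim_cmap jx).
have [w' wE] : exists w', w = w' *m J by exists (w *m invmx J); rewrite mulmxKV.
have : sgrad i F x *m symp_form M i x *m w'^T = - (differential i F x *m w'^T).
  by have /(@sgradP _ _ i F x _ ui) := erefl (sgrad i F x).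
rewrite compat {1}wE trmx_mul !mulmxA => ->.
apply/matrixP => k l; rewrite !ord1 [LHS]mxE [RHS]mxE; congr (- _).
by rewrite !differentialE// wE; exact: derive_transition.
Qed.

Lemma derive_sgrad_chart (W : normedModType R) (i j : cidx M) (F : M -> R) (f : M -> W) x :
  smooth_fun F -> cdom (atlas M i) x -> cdom (atlas M j) x ->
  differentiable (f \o cinv (atlas M j)) (cmap (atlas M j) x) ->
  'D_(sgrad i F x) (f \o cinv (atlas M i)) (cmap (atlas M i) x) =
  'D_(sgrad j F x) (f \o cinv (atlas M j)) (cmap (atlas M j) x).
Proof.
by move=> sF ix jx df; rewrite (derive_transition _ ix jx df) sgrad_transition.
Qed.

Lemma sgrad_near0 (i : cidx M) (F : M -> R) x : cdom (atlas M i) x ->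
  (\forall y \near x, F y = 0) -> sgrad i F x = 0.
Proof.
move=> ix F0; rewrite /sgrad (_ : differential i F x = 0) ?oppr0 ?mul0mx//.
apply/rowP => k; rewrite !mxE.
rewrite (near_eq_derive (g := cst 0)) ?derive_cst//.
have c := @mfd_inv_cont _ _ mM i (cmap (atlas M i) x) (cim_cmap ix).
by apply: (c [set y | F y = 0]); rewrite mfd_mapK.
Qed.

End symplectic.

(** * The circle *)

Section circle.
Context {R : realType}.

Lemma to_circle_eq (s t : R) : to_circle s = to_circle t <-> t - s \is a Num.int.
Proof.
have E := eqmodE (@circle_equiv R) s t.
rewrite -[_ \is a _]/(circle_eq s t) -[circle_eq s t]E.
by split=> [h|/eqP//]; apply/eqP.
Qed.

Lemma to_circleD1 (t : R) : to_circle (t + 1) = to_circle t.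
Proof. by apply/to_circle_eq; rewrite opprD addNKr rpredN rpred1. Qed.

Lemma circle_reprK (x : circle R) : to_circle (circle_repr x) = x.
Proof. exact: reprK. Qed.

Lemma to_circle_continuous : continuous (to_circle : R -> circle R).
Proof. exact: pi_continuous. Qed.

Lemma circle_chartE (a t : R) : a < t < a + 1 ->
  cdom (circle_chart a) (to_circle t) /\ cmap (circle_chart a) (to_circle t) = const_mx t.
Proof.
move=> /andP[at_ ta]; split => /=.
  move=> /to_circle_eq /intrP[k E].
  have : (-1)%:~R < k%:~R :> R by rewrite -E; rewrite mulrN1z; lra.
  have : k%:~R < 0%:~R :> R by rewrite -E mulr0z; lra.
  by rewrite !ltr_int; lia.
have /to_circle_eq/intrP[k E] := circle_reprK (to_circle t).
have -> : circle_repr (to_circle t) = t - k%:~R by rewrite -E; lra.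
have -> : Num.floor (t - k%:~R - a) = - k.
  apply: Num.Theory.floor_def; rewrite intrD mulrNz; apply/andP; split; lra.
by congr const_mx; rewrite mulrNz; lra.
Qed.

End circle.

Section smooth_mx.
Context {R : realType} {d : nat}.
Variable U : set 'rV[R]_d.
Hypothesis oU : open U.

Lemma smooth_det n (A : 'rV[R]_d -> 'M[R]_n) :
  (forall i j, smooth_on U (fun v => A v i j)) -> smooth_on U (fun v => \det (A v)).
Proof.
move=> sA; rewrite /determinant; apply: smooth_sum => // s _.
by apply: smooth_mul => //; [exact: smooth_cst|exact: smooth_prod].
Qed.

(** Cramer's rule: the entries of the inverse are polynomials in those of [A], divided by the
    nonvanishing determinant. *)
Lemma smooth_invmx n (A : 'rV[R]_d -> 'M[R]_n) :
  (forall i j, smooth_on U (fun v => A v i j)) -> (forall v, U v -> A v \in unitmx) ->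
  forall i j, smooth_on U (fun v => invmx (A v) i j).
Proof.
move=> sA uA i j.
apply: (@smooth_on_ext _ _ _ _ (fun v => (\det (A v))^-1 * ((-1) ^+ (j + i) *
   \det (row' j (col' i (A v)))))) => //.
  by move=> v Uv; rewrite /invmx uA// !mxE.
apply: smooth_mul => //.
  apply: smooth_inv => //; last exact: smooth_det.
  by move=> v /uA; rewrite unitmxE unitfE.
apply: smooth_mul => //; first exact: smooth_cst.
apply: smooth_det => k l.
by rewrite (_ : (fun v => _) = (fun v => A v (lift j k) (lift i l)))//; apply/funext => v; rewrite !mxE.
Qed.

End smooth_mx.

Section row_maps.
Context {R : realType}.

Lemma smoothV_lsubmx {a b} (U : set 'rV[R]_(a + b)) : smoothV U (lsubmx : _ -> 'rV[R]_a).
Proof.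
move=> k; rewrite (_ : (fun y => _) = (fun y : 'rV[R]_(a + b) => y 0 (lshift b k))).
  exact: smooth_coordf.
by apply/funext => y; rewrite mxE.
Qed.

Lemma smoothV_rsubmx {a b} (U : set 'rV[R]_(a + b)) : smoothV U (rsubmx : _ -> 'rV[R]_b).
Proof.
move=> k; rewrite (_ : (fun y => _) = (fun y : 'rV[R]_(a + b) => y 0 (rshift a k))).
  exact: smooth_coordf.
by apply/funext => y; rewrite mxE.
Qed.

Lemma smoothV_row_mx {d a b} (U : set 'rV[R]_d) (f : 'rV[R]_d -> 'rV[R]_a) (g : 'rV[R]_d -> 'rV[R]_b) :
  smoothV U f -> smoothV U g -> smoothV U (fun x => row_mx (f x) (g x)).
Proof.
move=> sf sg k; case: (split_ordP k) => l ->.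
  by rewrite (_ : (fun y => _) = (fun y => f y 0 l))//; apply/funext => y; rewrite row_mxEl.
by rewrite (_ : (fun y => _) = (fun y => g y 0 l))//; apply/funext => y; rewrite row_mxEr.
Qed.

Lemma smoothV_cst {d a} (U : set 'rV[R]_d) (c : 'rV[R]_a) : smoothV U (cst c).
Proof. by move=> k; exact: smooth_cst. Qed.

Lemma smoothV_id {d} (U : set 'rV[R]_d) : smoothV U id.
Proof. by move=> k; exact: smooth_coordf. Qed.

Lemma open_lsubmx {a b} (U : set 'rV[R]_a) : open U ->
  open [set z : 'rV[R]_(a + b) | U (lsubmx z)].
Proof.
move=> oU; apply: (@open_comp _ _ (lsubmx : 'rV[R]_(a + b) -> 'rV[R]_a) U) => // z _.
by apply: differentiable_continuous; exact: differentiable_lsubmx.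
Qed.

Lemma const_mx11 (v : 'rV[R]_1) : v = const_mx (v 0 0).
Proof. by apply/rowP => i; rewrite !mxE !ord1. Qed.

Lemma tcoord_row {a} (v : 'rV[R]_a) (t : R) : tcoord (row_mx v (const_mx t)) = t.
Proof. by rewrite /tcoord row_mxKr mxE. Qed.

End row_maps.

Section time_dependent.
Context {R : realType} {M : mfd_data R}.
Hypothesis mM : is_manifold M.

(* [f] read in the chart [i] of [M] and on the universal cover of the circle. *)
Definition lift_fun (i : cidx M) {T : Type} (f : M * circle R -> T) (z : 'rV[R]_(mdim M + 1)) : T :=
  f (cinv (atlas M i) (lsubmx z), to_circle (tcoord z)).

Definition lift_dom (i : cidx M) : set 'rV[R]_(mdim M + 1) :=
  [set z | cim (atlas M i) (lsubmx z)].

Lemma open_lift_dom i : open (lift_dom i).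
Proof. by apply: open_lsubmx; exact: (@mfd_im_open _ _ mM i). Qed.

Lemma smooth_lift (f : M * circle R -> R) :
  smooth_fun (N := prod_mfd M (circle_mfd R)) f ->
  forall i, smooth_on (lift_dom i) (lift_fun i f).
Proof.
move=> sf i; apply: smooth_on_local => z iz.
(* The chart of the circle cut half a turn away from [tcoord z] is the identity on times at distance
   less than 1/2 from it. *)
pose a := tcoord z - 2^-1.
exists [set z' | cim (atlas M i) (lsubmx z') /\ a < tcoord z' < a + 1].
  by split => //; apply/andP; split; rewrite /a; lra.
apply: smooth_on_sub (sf (i, a)) => z' [[x dx xz] tz].
have [d1 d2] := circle_chartE tz.
exists (x, to_circle (tcoord z')); first by split.
rewrite -[LHS]/(row_mx (cmap (atlas M i) x)
  (cmap (circle_chart a) (to_circle (tcoord z')))).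
by rewrite xz d2 -const_mx11 hsubmxK.
Qed.

Lemma smooth_slice (f : M * circle R -> R) c :
  smooth_fun (N := prod_mfd M (circle_mfd R)) f -> smooth_fun (fun x => f (x, c)).
Proof.
move=> sf i; rewrite -(circle_reprK c).
have -> : (fun x => f (x, to_circle (circle_repr c))) \o cinv (atlas M i) =
  lift_fun i f \o (fun v => row_mx v (const_mx (circle_repr c))).
  by apply/funext => v; rewrite /lift_fun /= row_mxKl tcoord_row.
apply: (smooth_comp _ _ _ (@smooth_lift f sf i)); first exact: (@mfd_im_open _ _ mM i).
  by move=> v iv; rewrite /lift_dom /= row_mxKl.
by apply: smoothV_row_mx; [exact: smoothV_id|exact: smoothV_cst].
Qed.

End time_dependent.

(** * The strip modulo integer times, embedded in a Euclidean space *)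

Section circle_embedding.
Context {R : realType}.

Lemma is_derive_sin_shift (a x : R) :
  is_derive x (1 : R) (fun x => sin (x + a)) (cos (x + a)).
Proof.
have d1 : is_derive x (1 : R) (fun x : R => x + a) 1.
  by rewrite -[X in is_derive _ _ _ X]addr0; apply: is_deriveD.
by rewrite -[cos _]mulr1; exact: (@is_derive1_comp _ sin (fun x : R => x + a)).
Qed.

Lemma smooth_sin {d} (U : set 'rV[R]_d) (f : 'rV[R]_d -> R) :
  open U -> smooth_on U f -> smooth_on U (fun v => sin (f v)).
Proof.
move=> oU sf.
have -> : (fun v => sin (f v)) = (fun x => sin (x + 0%N%:R * (pi / 2))) \o f.
  by apply/funext => v; rewrite /= mul0r addr0.
apply: (smooth_comp1 (phi := fun n x => sin (x + n%:R * (pi / 2))) oU _ sf) => n x.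
have := is_derive_sin_shift (n%:R * (pi / 2)) x.
have -> : n.+1%:R * (pi / 2) = n%:R * (pi / 2) + pi / 2 :> R.
  by rewrite -[n.+1%:R]natr1 mulrDl mul1r.
by rewrite addrA sinDpihalf.
Qed.

Lemma smooth_cos {d} (U : set 'rV[R]_d) (f : 'rV[R]_d -> R) :
  open U -> smooth_on U f -> smooth_on U (fun v => cos (f v)).
Proof.
move=> oU sf.
have -> : (fun v => cos (f v)) = (fun v => sin (f v + pi / 2)).
  by apply/funext => v; rewrite sinDpihalf.
by apply: smooth_sin => //; apply: smooth_add => //; exact: smooth_cst.
Qed.

(* Turns statements about 1-periodic subsets of a strip into statements about
   compact sets. *)
Definition circle_emb (t : R) : 'rV[R]_2 :=
  \row_(i < 2) if i == 0 then cos (2 * pi * t) else sin (2 * pi * t).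

(** The hypothesis gives cos (2 pi (s - t)) = 1. For the fractional part f of s - t this forces sin
    (pi f) = 0, while sin is positive on ]0, pi[; hence f = 0. *)
Lemma circle_emb_eq s t : circle_emb s = circle_emb t -> exists k : int, s = t + k%:~R.
Proof.
move=> /rowP E; have := E 0; have := E 1; rewrite !mxE/= => Es Ec.
have c1 : cos (2 * pi * (s - t)) = 1.
  by rewrite mulrBr cosB Es Ec -!expr2 cos2Dsin2.
pose k := Num.floor (s - t); pose f := s - t - k%:~R.
have /andP[k1 k2] := floor_itv (s - t).
exists k; suff : f = 0 by rewrite /f => /eqP; rewrite subr_eq0 => /eqP <-; rewrite addrC subrK.
have f0 : 0 <= f by rewrite subr_ge0.
have f1 : f < 1 by move: k2; rewrite /f intrD; lra.
have cperN (n : nat) (x : R) : cos (x + 2 * pi * n%:R) = cos x.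
  elim: n => [|n IH]; first by rewrite mulr0 addr0.
  rewrite -[n.+1%:R]natr1 mulrDr mulr1 addrA.
  by rewrite (_ : x + 2 * pi * n%:R + 2 * pi = x + 2 * pi * n%:R + pi *+ 2) ?cosD2pi// mulr_natl.
have cper (x : R) : cos (x + 2 * pi * k%:~R) = cos x.
  case: k {k1 k2 f f0 f1} => n; first exact: cperN.
  by rewrite NegzE -(cperN n.+1) -addrA -mulrDr mulrNz addNr mulr0 addr0.
have : cos (2 * pi * f) = 1.
  by apply: etrans c1; rewrite -(cper (2 * pi * f)) -mulrDr /f subrK.
have -> : 2 * pi * f = pi * f + pi * f by ring.
rewrite cosD -!expr2 => c2.
have s0 : sin (pi * f) = 0.
  have := cos2Dsin2 (pi * f); move=> c3; apply/eqP; rewrite -sqrf_eq0; apply/eqP; lra.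
apply/eqP; rewrite eq_le f0 andbT leNgt; apply/negP => fp.
have : 0 < sin (pi * f).
  by apply: sin_gt0_pi; rewrite mulr_gt0 ?pi_gt0//= -[X in _ < X]mulr1 ltr_pM2l ?pi_gt0.
by rewrite s0 ltxx.
Qed.

Lemma circle_embD1 t : circle_emb (t + 1) = circle_emb t.
Proof.
have E : 2 * pi * (t + 1) = 2 * pi * t + pi *+ 2 :> R by rewrite mulrDr mulr1 -[pi *+ 2]mulr_natl.
by apply/rowP => i; rewrite !mxE E cosD2pi sinD2pi.
Qed.

Lemma circle_emb_lip s t : `|circle_emb t - circle_emb s| <= 2 * pi * `|t - s|.
Proof.
have p0 : 0 <= 2 * pi :> R by rewrite mulr_ge0// pi_ge0.
have dm u : is_derive u (1 : R) (fun u : R => 2 * pi * u) (2 * pi).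
  by apply: is_derive_eq; rewrite /GRing.scale/= mulr1.
have dc u : is_derive u (1 : R) (cos \o (fun u : R => 2 * pi * u)) (- sin (2 * pi * u) * (2 * pi)).
  exact: (@is_derive1_comp _ cos (fun u : R => 2 * pi * u)).
have ds u : is_derive u (1 : R) (sin \o (fun u : R => 2 * pi * u)) (cos (2 * pi * u) * (2 * pi)).
  exact: (@is_derive1_comp _ sin (fun u : R => 2 * pi * u)).
apply: norm_rV_le => [|i]; first by rewrite mulr_ge0.
rewrite !mxE; case: ifPn => _.
  have [u _ /= ->] := curve_mvt s t dc.
  rewrite !normrM normrN -[X in X * _]mulrC ler_wpM2r// -normrM (ger0_norm p0) ler_piMr//.
  by rewrite ler_norml sin_geN1 sin_le1.
have [u _ /= ->] := curve_mvt s t ds.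
rewrite !normrM -[X in X * _]mulrC ler_wpM2r// -normrM (ger0_norm p0) ler_piMr//.
by rewrite ler_norml cos_geN1 cos_le1.
Qed.

Context {q : nat}.

Definition strip_emb (z : 'rV[R]_(q + 1)) : 'rV[R]_(q + 2) :=
  row_mx (lsubmx z) (circle_emb (tcoord z)).

Lemma smooth_tcoord (U : set 'rV[R]_(q + 1)) : smooth_on U (tcoord : _ -> R).
Proof. by have := @smoothV_rsubmx R q 1 U 0; exact. Qed.

Lemma smoothV_strip_emb : smoothV setT strip_emb.
Proof.
have oT := @openT ('rV[R]_(q + 1)).
apply: smoothV_row_mx; first exact: smoothV_lsubmx.
have s2 : smooth_on setT (fun z : 'rV[R]_(q + 1) => 2 * pi * tcoord z).
  by apply: smooth_mul => //; [exact: smooth_cst|exact: smooth_tcoord].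
move=> i; have [->|i0] := eqVneq i 0.
  rewrite (_ : (fun y => _) = (fun z : 'rV[R]_(q + 1) => cos (2 * pi * tcoord z))).
    exact: smooth_cos.
  by apply/funext => z; rewrite mxE eqxx.
rewrite (_ : (fun y => _) = (fun z : 'rV[R]_(q + 1) => sin (2 * pi * tcoord z))).
  exact: smooth_sin.
by apply/funext => z; rewrite mxE (negbTE i0).
Qed.

Lemma strip_embD z : strip_emb (z + tvec) = strip_emb z.
Proof.
rewrite /strip_emb; congr row_mx; first by rewrite linearD /= /tvec row_mxKl addr0.
by rewrite /tcoord linearD /= /tvec row_mxKr mxE [X in _ + X]mxE circle_embD1.
Qed.

Lemma strip_emb_lip z z' : `|strip_emb z - strip_emb z'| <= (1 + 2 * pi) * `|z - z'|.
Proof.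
have p0 : 0 <= 2 * pi :> R by rewrite mulr_ge0// pi_ge0.
apply: norm_rV_le => [|k]; first by rewrite mulr_ge0// addr_ge0.
rewrite /strip_emb opp_row_mx add_row_mx; case: (split_ordP k) => j ->.
  rewrite row_mxEl -linearB /=.
  apply: le_trans (norm_coord _ _ _) _; apply: le_trans (norm_lsubmx _) _.
  by rewrite ler_peMl// lerDl.
rewrite row_mxEr; apply: le_trans (norm_coord _ _ _) _.
apply: le_trans (circle_emb_lip _ _) _; rewrite ler_pM//; first by rewrite lerDr.
by have := norm_coord (z - z') 0 (rshift q 0); rewrite /tcoord !mxE.
Qed.

(** This is how a function [u] obtained from [smooth_urysohn] becomes 1-periodic in time with
    bounded derivatives of all orders. *)
Lemma strip_fun_comp (u : 'rV[R]_(q + 2) -> R) B :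
  smooth_on setT u -> (forall v, B <= `|v| -> u v = 0) -> strip_fun (u \o strip_emb).
Proof.
move=> su uB; split.
- apply: (@smooth_comp _ _ _ setT setT strip_emb u) => //; first exact: openT.
  exact: smoothV_strip_emb.
- exists B => z zB; apply: uB; apply: (le_trans (ltW zB)).
  apply: norm_rV_le => // k.
  by have := norm_coord (strip_emb z) 0 (lshift 2 k); rewrite row_mxEl.
- by move=> z; rewrite /= strip_embD.
Qed.

End circle_embedding.

(** * Embedding a compact set and extending the Hamiltonian field *)

Section embedding.
Context {R : realType} {M : symp_data R}.
Hypothesis sM : is_symplectic_manifold M.
Let mM := symp_manifold sM.
Let d := mdim M.

(* Coordinate balls with centres [cc a]: [bump_at a] is 1 on the ball of radius
   [rr a] and vanishes outside that of radius [2 * rr a], where [coord_at a] still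
   gives the true coordinates. *)
Variables (n : nat) (ic : 'I_n -> cidx M) (cc : 'I_n -> 'rV[R]_d) (rr : 'I_n -> R).
Hypothesis rr0 : forall a, 0 < rr a.
Hypothesis rr_cim : forall a v, `|v - cc a| <= 4 * rr a -> cim (atlas M (ic a)) v.

Definition bump_at a : M -> R := chart_ext (ic a) (box_bump (cc a) (rr a)).

Definition coord_at a k : M -> R :=
  chart_ext (ic a) (fun v => box_bump (cc a) (2 * rr a) v * v 0 k).

Let rr2 a : 0 < 2 * rr a. Proof. by rewrite mulr_gt0. Qed.

Lemma bump_at_ge0 a x : 0 <= bump_at a x.
Proof. by rewrite /bump_at /chart_ext; case: pselect => // ?; exact: bump_ge0. Qed.

Lemma bump_at_le1 a x : bump_at a x <= 1.
Proof. by rewrite /bump_at /chart_ext; case: pselect => // ?; exact: bump_le1. Qed.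

Lemma bump_at_gt0 a x : 0 < bump_at a x ->
  cdom (atlas M (ic a)) x /\ `|cmap (atlas M (ic a)) x - cc a| < 2 * rr a.
Proof.
rewrite /bump_at /chart_ext; case: pselect => [dx|ndx] /=; last by rewrite ltxx.
move=> h; split=> //; rewrite ltNge; apply/negP => /(bump_0 (rr0 a)) E.
by move: h; rewrite E ltxx.
Qed.

Lemma bump_at_1 a x : cdom (atlas M (ic a)) x ->
  `|cmap (atlas M (ic a)) x - cc a| <= rr a -> bump_at a x = 1.
Proof. by move=> dx h; rewrite /bump_at chart_extE// bump_1. Qed.

Lemma coord_at_E a x k : 0 < bump_at a x ->
  coord_at a k x = cmap (atlas M (ic a)) x 0 k.
Proof.
move=> /bump_at_gt0[dx h]; rewrite /coord_at chart_extE// bump_1 ?mul1r//.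
exact: ltW.
Qed.

(** Contains the supports of both cutoffs, whose radii are 2 rr a for [bump_at] and 4 rr a for
    [coord_at], and still lies inside the chart. *)
Definition ball4 a := [set v : 'rV[R]_d | `|v - cc a| <= 4 * rr a].

Lemma ball4_compact a : compact (ball4 a).
Proof. exact: closed_ball_rV_compact. Qed.

Lemma ball4_cim a : ball4 a `<=` cim (atlas M (ic a)).
Proof. by move=> v; exact: rr_cim. Qed.

Lemma bump_out a v : ~ ball4 a v -> box_bump (cc a) (rr a) v = 0.
Proof.
move=> /negP; rewrite -ltNge => h; apply: bump_0 => //.
by apply: le_trans (ltW h); rewrite ler_wpM2r ?ltW// ltr_nat.
Qed.

Lemma bump2_out a v : ~ ball4 a v -> box_bump (cc a) (2 * rr a) v = 0.
Proof.
move=> /negP; rewrite -ltNge => h; apply: bump_0 => //.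
by rewrite mulrA -natrM ltW.
Qed.

Lemma smooth_bump_at a : smooth_fun (bump_at a).
Proof.
apply: (chart_ext_smooth mM (K := ball4 a)).
- by apply: smooth_bump; exact: openT.
- exact: ball4_compact.
- exact: ball4_cim.
- exact: bump_out.
Qed.

Lemma smooth_coord_at a k : smooth_fun (coord_at a k).
Proof.
apply: (chart_ext_smooth mM (K := ball4 a)).
- apply: smooth_mul; [exact: openT|apply: smooth_bump; exact: openT|exact: smooth_coordf].
- exact: ball4_compact.
- exact: ball4_cim.
- by move=> v /bump2_out ->; rewrite mul0r.
Qed.

Definition emb_idx : finType := ('I_n * option 'I_d)%type.
Definition emb_dim : nat := #|{: emb_idx}|.
Local Notation q := emb_dim.

(* The entry [(a, None)] is a bump, the entries [(a, Some j)] are cut-off chart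
   coordinates: the latter determine the point where the former is positive. *)
Definition emb (x : M) : 'rV[R]_q :=
  \row_k match enum_val k : emb_idx with
         | (a, None) => bump_at a x
         | (a, Some j) => coord_at a j x end.

Definition scal_of a (y : 'rV[R]_q) : R := y 0 (enum_rank ((a, None) : emb_idx)).
Definition vec_of a (y : 'rV[R]_q) : 'rV[R]_d :=
  \row_j y 0 (enum_rank ((a, Some j) : emb_idx)).

Lemma scal_emb a x : scal_of a (emb x) = bump_at a x.
Proof. by rewrite /scal_of mxE enum_rankK. Qed.

Lemma vec_emb a x : 0 < bump_at a x -> vec_of a (emb x) = cmap (atlas M (ic a)) x.
Proof. by move=> h; apply/rowP => j; rewrite !mxE enum_rankK coord_at_E. Qed.

Lemma smooth_emb k : smooth_fun (fun x => emb x 0 k).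
Proof.
move=> i; rewrite (_ : _ \o _ = (match enum_val k : emb_idx with
    | (a, None) => bump_at a | (a, Some j) => coord_at a j end) \o cinv (atlas M i)).
  case: (enum_val k) => a [j|]; [exact: smooth_coord_at|exact: smooth_bump_at].
by apply/funext => v; rewrite /= mxE; case: (enum_val k) => a [].
Qed.

Lemma emb_chart_smooth i : smoothV (cim (atlas M i)) (emb \o cinv (atlas M i)).
Proof. by move=> k; exact: smooth_emb. Qed.

Lemma emb_diff i v : cim (atlas M i) v -> differentiable (emb \o cinv (atlas M i)) v.
Proof. by move=> iv; apply: smoothV_diff (@emb_chart_smooth i) iv. Qed.

Lemma emb_cont : continuous emb.
Proof.
move=> x; apply/cvgrPdist_le => e e0.
suff : \forall t \near x, forall k, `|(emb x - emb t) 0 k| <= e.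
  by apply: filterS => t h; apply: norm_rV_le => //; exact: ltW.
apply: filter_forall => k.
have /cvgrPdist_le/(_ e e0) := @smooth_fun_continuous _ _ mM _ (smooth_emb k) x.
by apply: filterS => t; rewrite !mxE.
Qed.

Lemma emb_inj a x x' : 0 < bump_at a x -> 0 < bump_at a x' ->
  vec_of a (emb x) = vec_of a (emb x') -> x = x'.
Proof.
move=> h h'; rewrite !vec_emb// => E.
have [dx _] := bump_at_gt0 h; have [dx' _] := bump_at_gt0 h'.
by rewrite -(mfd_mapK mM dx) E mfd_mapK.
Qed.

Lemma emb_inj1 a x x' : 0 < bump_at a x -> emb x = emb x' -> x = x'.
Proof.
move=> h E; have h' : 0 < bump_at a x' by rewrite -scal_emb -E scal_emb.
by apply: (emb_inj h h'); rewrite E.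
Qed.

Definition emb_bound : R := 1 + \sum_a (`|cc a| + 4 * rr a).

Lemma emb_bound_gt0 : 0 < emb_bound.
Proof. by rewrite ltr_pwDl// sumr_ge0// => a _; rewrite addr_ge0// mulr_ge0// ltW. Qed.

Lemma emb_le x : `|emb x| <= emb_bound.
Proof.
have s0 : 0 <= \sum_a (`|cc a| + 4 * rr a).
  by apply: sumr_ge0 => a _; rewrite addr_ge0// mulr_ge0// ltW.
apply: norm_rV_le => [|k]; first exact: ltW emb_bound_gt0.
rewrite mxE; case: (enum_val k) => a [j|]; last first.
  by rewrite ger0_norm ?bump_at_ge0// (le_trans (bump_at_le1 _ _))// lerDl.
rewrite /coord_at /chart_ext; case: pselect => dx; last first.
  by rewrite normr0 ltW// emb_bound_gt0.
set v := cmap _ _.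
have [vb|vb] := pselect (ball4 a v); last first.
  by rewrite bump2_out// mul0r normr0 ltW// emb_bound_gt0.
have vle : `|v| <= `|cc a| + 4 * rr a.
  by rewrite -[v](subrK (cc a)) (le_trans (ler_normD _ _))// addrC lerD2l.
rewrite normrM (le_trans (y := `|v|))//.
  rewrite ger0_norm ?bump_ge0// (le_trans _ (norm_coord v 0 j))//.
  by rewrite ler_piMl// bump_le1.
rewrite /emb_bound (bigD1 a)//= (le_trans vle)// addrCA lerDl addr_ge0//.
by apply: sumr_ge0 => b _; rewrite addr_ge0// mulr_ge0// ltW.
Qed.

Definition emb_supp : set M :=
  \big[setU/set0]_(a < n) (cinv (atlas M (ic a)) @` ball4 a).

Lemma emb_supp_compact : compact emb_supp.
Proof.
apply: (big_ind compact); [exact: compact0|by move=> *; exact: compactU|].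
by move=> a _; apply: (compact_cinv mM); [exact: ball4_compact|exact: ball4_cim].
Qed.

Lemma sub_emb_supp a : cinv (atlas M (ic a)) @` ball4 a `<=` emb_supp.
Proof. by move=> x h; rewrite /emb_supp (bigD1 a)//=; left. Qed.

Lemma emb_out x : ~ emb_supp x -> emb x = 0.
Proof.
move=> nx; apply/rowP => k; rewrite !mxE; case: (enum_val k) => a [j|].
  apply: (chart_ext_supp mM (K := ball4 a)); first by move=> v /bump2_out ->; rewrite mul0r.
  by move=> h; apply: nx; exact: sub_emb_supp h.
apply: (chart_ext_supp mM (K := ball4 a)); first exact: bump_out.
by move=> h; apply: nx; exact: sub_emb_supp h.
Qed.

(** Indexed by numbers, with value 0 from [n] on, so that [weight] can run over all b < k and its
    sums can be treated by induction. *)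
Definition scal_nat (k : nat) (y : 'rV[R]_q) : R :=
  if insub k is Some a then scal_of a y else 0.

Lemma scal_natE (a : 'I_n) y : scal_nat a y = scal_of a y.
Proof. by rewrite /scal_nat valK. Qed.

Lemma smooth_scal_nat k U : smooth_on U (scal_nat k).
Proof.
rewrite /scal_nat; case: insub => [a|]; [exact: smooth_coordf|exact: smooth_cst].
Qed.

(* A partition of unity on the part of the image of [emb] where some bump is 1,
   expressed through the coordinates of the ambient space. *)
Definition weight (k : nat) (y : 'rV[R]_q) : R :=
  scal_nat k y * \prod_(b < k) (1 - scal_nat b y).

Lemma smooth_weight k U : open U -> smooth_on U (weight k).
Proof.
move=> oU; apply: smooth_mul => //; first exact: smooth_scal_nat.
apply: smooth_prod => // b _; apply: smooth_sub => //; [exact: smooth_cst|exact: smooth_scal_nat].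
Qed.

(** With P_k the product of 1 - [scal_nat b y] over b < k, [weight k y] is P_k - P_(k+1), so the sum
    telescopes. *)
Lemma sum_weight y m : \sum_(k < m) weight k y = 1 - \prod_(k < m) (1 - scal_nat k y).
Proof.
elim: m => [|m IH]; first by rewrite !big_ord0 subrr.
by rewrite !big_ord_recr/= IH /weight; ring.
Qed.

Lemma sum_weight1 a x : bump_at a x = 1 -> \sum_(k < n) weight k (emb x) = 1.
Proof.
move=> b1; rewrite sum_weight (bigD1 a)//= scal_natE scal_emb b1 subrr mul0r.
exact: subr0.
Qed.

Lemma weight_bump (a : 'I_n) x : weight a (emb x) != 0 -> 0 < bump_at a x.
Proof.
rewrite /weight scal_natE scal_emb lt_def bump_at_ge0 andbT.
by apply: contraNneq => ->; rewrite mul0r.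
Qed.

Lemma weight0 k : weight k 0 = 0.
Proof. by rewrite /weight /scal_nat; case: insub => [a|]; rewrite ?/scal_of ?mxE mul0r. Qed.

Variable G : M * circle R -> R.
Hypothesis sG : smooth_fun (N := prod_mfd M (circle_mfd R)) G.

Definition Gt (t : R) (x : M) : R := G (x, to_circle t).

Lemma smooth_Gt t : smooth_fun (Gt t).
Proof. exact: smooth_slice. Qed.

(** The push-forward of sgrad G_t under [emb], read in the chart [i], with t the last coordinate of
    [z]. *)
Definition emb_sgrad (i : cidx M) (z : 'rV[R]_(d + 1)) : 'rV[R]_q :=
  'D_(sgrad i (Gt (tcoord z)) (cinv (atlas M i) (lsubmx z)))
     (emb \o cinv (atlas M i)) (lsubmx z).

Lemma smooth_emb_sgrad i : smoothV (lift_dom i) (emb_sgrad i).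
Proof.
have oU := @open_lift_dom _ _ mM i.
have oI : open (cim (atlas M i)) := @mfd_im_open _ _ mM i.
have lU z : lift_dom i z -> cim (atlas M i) (lsubmx z) by [].
have sgs l : smooth_on (lift_dom i)
    (fun z => sgrad i (Gt (tcoord z)) (cinv (atlas M i) (lsubmx z)) 0 l).
  (* The differential of a time slice consists of partial derivatives of [lift_fun i G]; this form
     shows joint smoothness in position and time. *)
  apply: (@smooth_on_ext _ _ _ _ (fun z => - \sum_m ('D_(row_mx (delta_mx 0 m) 0) (lift_fun i G) z *
      invmx (symp_form M i (cinv (atlas M i) (lsubmx z))) m l))) => //.
    move=> z iz; rewrite /sgrad mulNmx [RHS]mxE; congr (- _); rewrite [RHS]mxE.
    apply: eq_bigr => m _; congr (_ * _); rewrite mxE cmapK//.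
    have -> : Gt (tcoord z) \o cinv (atlas M i) = (fun v => lift_fun i G (row_mx v (rsubmx z))).
      apply/funext => v; rewrite /Gt /lift_fun /= row_mxKl.
      by rewrite [rsubmx z]const_mx11 tcoord_row.
    by rewrite derive_row_l hsubmxK.
  apply: smooth_opp => //; apply: smooth_sum => // m _; apply: smooth_mul => //.
    by apply: smooth_on_derive; exact: smooth_lift.
  apply: (@smooth_comp _ _ _ _ _ lsubmx (fun v => invmx (symp_form M i (cinv (atlas M i) v)) m l) oU lU).
    exact: smoothV_lsubmx.
  apply: smooth_invmx => // [k1 k2|v iv].
    by apply: (@smooth_coord _ _ _ _ _ (symp_form M i \o cinv (atlas M i))) => //; exact: (@symp_smooth _ _ sM i).
  by apply: (@symp_nondegenerate _ _ sM); exact: cdom_cinv.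
move=> k.
apply: (@smooth_on_ext _ _ _ _ (fun z => \sum_l (sgrad i (Gt (tcoord z)) (cinv (atlas M i) (lsubmx z)) 0 l *
   'D_(delta_mx 0 l) (fun v => emb (cinv (atlas M i) v) 0 k) (lsubmx z)))) => //.
  move=> z iz; rewrite /emb_sgrad -derive_coord; last exact: emb_diff.
  rewrite diff_row_sum//.
  exact: smooth_on_diff (@emb_chart_smooth i k) _.
apply: smooth_sum => // l _; apply: smooth_mul => //.
apply: (@smooth_comp _ _ _ _ _ lsubmx ('D_(delta_mx 0 l) (fun v => emb (cinv (atlas M i) v) 0 k)) oU lU).
  exact: smoothV_lsubmx.
by apply: smooth_on_derive; exact: emb_chart_smooth.
Qed.

Definition local_field (a : 'I_n) (z : 'rV[R]_(d + 1)) : 'rV[R]_q :=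
  box_bump (cc a) (2 * rr a) (lsubmx z) *: emb_sgrad (ic a) z.

Lemma smooth_local_field a : smoothV setT (local_field a).
Proof.
move=> k; apply: smooth_on_local => z _.
have oI := @open_lift_dom _ _ mM (ic a).
have oC : open [set z : 'rV[R]_(d + 1) | (~` ball4 a) (lsubmx z)].
  apply: open_lsubmx; apply: closed_openC; apply: compact_closed; last exact: ball4_compact.
  exact: norm_hausdorff.
have [vb|vb] := pselect (ball4 a (lsubmx z)).
  exists (lift_dom (ic a)); first exact: ball4_cim.
  apply: (@smooth_on_ext _ _ _ _ (fun z => box_bump (cc a) (2 * rr a) (lsubmx z) * emb_sgrad (ic a) z 0 k)) => //.
    by move=> w _; rewrite [RHS]mxE.
  apply: smooth_mul => //; last exact: smooth_emb_sgrad.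
  apply: (@smooth_comp _ _ _ _ setT lsubmx) => //; first exact: smoothV_lsubmx.
  by apply: smooth_bump; exact: openT.
exists [set z | (~` ball4 a) (lsubmx z)] => //.
apply: (@smooth_on_ext _ _ _ _ (cst 0)) => //; last exact: smooth_cst.
by move=> w /= wb; rewrite mxE bump2_out// mul0r.
Qed.

(** At a point [emb x], a nonzero weight of [a] forces [bump_at a x] to be positive; then [vec_of a]
    returns the chart coordinates of [x], and the local field is the push-forward of sgrad G_t. The
    outer bump is 1 on the image of [emb] and gives the field bounded support in these
    coordinates. *)
Definition ext_field (z : 'rV[R]_(q + 1)) : 'rV[R]_q :=
  box_bump 0 emb_bound (lsubmx z) *:
  \sum_(a < n) weight a (lsubmx z) *:
     local_field a (row_mx (vec_of a (lsubmx z)) (rsubmx z)).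

Definition field (z : 'rV[R]_(q + 1)) : 'rV[R]_(q + 1) :=
  row_mx (ext_field z) (const_mx 1).

Lemma local_field_periodic a z : local_field a (z + tvec) = local_field a z.
Proof.
rewrite /local_field /emb_sgrad.
have -> : lsubmx (z + tvec) = lsubmx z by rewrite linearD /= /tvec row_mxKl addr0.
have -> : tcoord (z + tvec) = tcoord z + 1.
  by rewrite /tcoord linearD /= /tvec row_mxKr !mxE.
by rewrite /Gt to_circleD1.
Qed.

Opaque local_field.
Lemma ext_field_periodic z : ext_field (z + tvec) = ext_field z.
Proof.
have zl : lsubmx (z + tvec) = lsubmx z by rewrite linearD /= /tvec row_mxKl addr0.
have zr : rsubmx (z + tvec) = rsubmx z + const_mx 1 by rewrite linearD /= /tvec row_mxKr.
have L a v : local_field a (row_mx v (rsubmx (z + tvec))) = local_field a (row_mx v (rsubmx z)).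
  by rewrite -[RHS]local_field_periodic zr /tvec add_row_mx addr0.
have E : (fun a : 'I_n => weight a (lsubmx z) *:
    local_field a (row_mx (vec_of a (lsubmx z)) (rsubmx (z + tvec)))) =
  (fun a => weight a (lsubmx z) *: local_field a (row_mx (vec_of a (lsubmx z)) (rsubmx z))).
  by apply/funext => a; rewrite L.
rewrite /ext_field zl.
exact: (congr1 (fun F : 'I_n -> 'rV[R]_q => box_bump 0 emb_bound (lsubmx z) *: \sum_(a < n) F a) E).
Qed.

Transparent local_field.

Lemma strip_ext_field k : strip_fun (fun z => ext_field z 0 k).
Proof.
have oT := @openT ('rV[R]_(q + 1)).
have slsub : smoothV setT (lsubmx : 'rV[R]_(q + 1) -> 'rV[R]_q) by exact: smoothV_lsubmx.
split.
- have -> : (fun z => ext_field z 0 k) = (fun z => box_bump 0 emb_bound (lsubmx z) *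
     \sum_(a < n) (weight a (lsubmx z) * local_field a (row_mx (vec_of a (lsubmx z)) (rsubmx z)) 0 k)).
    apply/funext => z; rewrite [LHS]mxE; congr (_ * _); rewrite summxE.
    by apply: eq_bigr => a _; rewrite [LHS]mxE.
  apply: smooth_mul => //.
    apply: (@smooth_comp _ _ _ _ setT lsubmx) => //.
    by apply: smooth_bump; exact: openT.
  apply: smooth_sum => // a _; apply: smooth_mul => //.
    apply: (@smooth_comp _ _ _ _ setT lsubmx) => //.
    by apply: smooth_weight; exact: openT.
  apply: (@smooth_comp _ _ _ _ setT (fun z => row_mx (vec_of a (lsubmx z)) (rsubmx z)) (fun z => local_field a z 0 k)) => //.
    apply: smoothV_row_mx; last exact: smoothV_rsubmx.
    move=> j; rewrite (_ : (fun z => _) = (fun z => lsubmx z 0 (enum_rank ((a, Some j) : emb_idx)))).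
      exact: slsub.
    by apply/funext => z; rewrite /vec_of [LHS]mxE.
  exact: smooth_local_field.
- exists (2 * emb_bound) => z zb; rewrite mxE bump_0 ?mul0r ?emb_bound_gt0//.
  by rewrite subr0 ltW.
- by move=> z; rewrite ext_field_periodic.
Qed.

Lemma bounded_smooth_cst m (c : R) : bounded_smooth (cst c : 'rV[R]_m -> R).
Proof.
split; first exact: smooth_cst.
suff H (s : seq 'rV[R]_m) : exists c', iter_derive s (cst c : 'rV[R]_m -> R) = cst c'.
  by move=> s; have [c' ->] := H s; exists `|c'| => x.
elim: s => [|v s [c' /= ->]]; first by exists c.
by exists 0; apply/funext => x; exact: derive_cst.
Qed.

Lemma field_bounded_smooth k : bounded_smooth (fun z => field z 0 k).
Proof.
case: (split_ordP k) => l ->.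
  rewrite (_ : (fun z => _) = (fun z => ext_field z 0 l)); last first.
    by apply/funext => z; rewrite row_mxEl.
  exact/strip_bounded_smooth/strip_ext_field.
rewrite (_ : (fun z => _) = cst 1); first exact: bounded_smooth_cst.
by apply/funext => z; rewrite row_mxEr mxE.
Qed.

Lemma field_periodic z : field (z + tvec) = field z.
Proof.
by rewrite /field ext_field_periodic.
Qed.

Lemma ext_field0 z : lsubmx z = 0 -> ext_field z = 0.
Proof.
move=> z0; rewrite /ext_field z0 big1 ?scaler0// => a _.
by rewrite weight0 scale0r.
Qed.

(** By chart independence all terms of nonzero weight are multiples of one vector [D]. A bump equal
    to 1 makes the weights add up to 1; where sgrad vanishes, [D] is 0 and the sum of the weights
    does not matter. *)
Lemma ext_fieldE i x t : cdom (atlas M i) x ->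
  (sgrad i (Gt t) x = 0 \/ exists a, bump_at a x = 1) ->
  ext_field (row_mx (emb x) (const_mx t)) =
  'D_(sgrad i (Gt t) x) (emb \o cinv (atlas M i)) (cmap (atlas M i) x).
Proof.
move=> ix alt; rewrite /ext_field row_mxKl row_mxKr bump_1 ?emb_bound_gt0 ?subr0 ?emb_le// scale1r.
set D := 'D_ _ _ _.
rewrite (eq_bigr (fun a : 'I_n => weight a (emb x) *: D)); last first.
  move=> a _; have [->|w0] := eqVneq (weight a (emb x)) 0; first by rewrite !scale0r.
  congr (_ *: _); have ba := weight_bump w0; have [ia xa] := bump_at_gt0 ba.
  rewrite /local_field row_mxKl vec_emb// bump_1 ?(ltW xa)// scale1r.
  rewrite /emb_sgrad row_mxKl tcoord_row (mfd_mapK mM ia).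
  apply: (derive_sgrad_chart sM (smooth_Gt t) ia ix).
  by apply: emb_diff; exact: cim_cmap.
rewrite -scaler_suml; case: alt => [s0|[a ba]]; last by rewrite (sum_weight1 ba) scale1r.
have -> : D = 0 by rewrite /D s0 derive0.
exact: scaler0.
Qed.

End embedding.

(** * Fixed points, Lipschitz bounds and curves *)

HB.instance Definition _ (R : realType) (m n : nat) :=
  Complete.copy 'M[R]_(m, n) 'M[R]_(m, n).

Section local_tools.
Context {R : realType}.

(* Banach's fixed point theorem for [v |-> v0 - (Phi v - v)]. *)
Lemma near_id_surj {d} (v0 : 'rV[R]_d) r (Phi : 'rV[R]_d -> 'rV[R]_d) : 0 < r ->
  (forall v, `|v - v0| <= r -> `|Phi v - v| <= r) ->
  (forall v v', `|v - v0| <= r -> `|v' - v0| <= r ->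
     `|(Phi v - v) - (Phi v' - v')| <= 2^-1 * `|v - v'|) ->
  exists2 v, `|v - v0| <= r & Phi v = v0.
Proof.
move=> r0 h1 h2.
pose B := [set v : 'rV[R]_d | `|v - v0| <= r].
pose T v := v0 - (Phi v - v).
have TB : set_fun B B T.
  by move=> v /= vB; rewrite /B /T /= addrAC subrr add0r normrN; exact: h1.
pose TM := isFun.Build _ _ B B T TB.
pose TF : {fun B >-> B} := HB.pack T TM.
have half0 : 0 <= 2^-1 :> R by [].
have ctr : is_contraction TF.
  exists (NngNum half0); split; first by rewrite /= invf_lt1// ltr1n.
  move=> [v v'] [/= vB v'B].
  have -> : T v - T v' = - ((Phi v - v) - (Phi v' - v')).
    by apply/rowP => i; rewrite !mxE; ring.
  by rewrite normrN; exact: h2.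
have [||v vB E] := banach_fixed_point ctr.
- apply: compact_closed; [exact: norm_hausdorff|exact: closed_ball_rV_compact].
- by exists v0; rewrite /B /= subrr normr0 ltW.
exists v => //; move: E => /= /eqP; rewrite /T eq_sym subr_eq => /eqP E.
by apply/esym; rewrite E addrC subrK.
Qed.

Lemma bounded_on_compact {d} (U K : set 'rV[R]_d) (f : 'rV[R]_d -> R) :
  smooth_on U f -> compact K -> K `<=` U -> exists C, 0 <= C /\ forall v, K v -> `|f v| <= C.
Proof.
move=> sf cK KU.
have cf : compact (f @` K).
  apply: continuous_compact => //; apply: continuous_in_subspaceT => v.
  rewrite inE => /KU Uv; apply: differentiable_continuous; exact: smooth_on_diff sf Uv.
have [B [_ BP]] := compact_bounded cf.
exists (`|B| + 1); split; first by rewrite addr_ge0.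
move=> v Kv; apply: (BP (`|B| + 1)); last by exists v.
by rewrite (le_lt_trans (ler_norm _))// ltrDl.
Qed.

Lemma lip_on_ball {d} (U : set 'rV[R]_d) (f : 'rV[R]_d -> R) c r :
  smooth_on U f -> [set v | `|v - c| <= r] `<=` U ->
  exists L, 0 <= L /\ forall v v', `|v - c| <= r -> `|v' - c| <= r ->
    `|f v - f v'| <= L * `|v - v'|.
Proof.
move=> sf BU.
have /choice[C CP] : forall k, exists C, 0 <= C /\ forall v, `|v - c| <= r ->
    `|'D_(delta_mx 0 k) f v| <= C.
  move=> k; have sd := @smooth_on_derive _ _ _ U f (delta_mx 0 k) sf.
  have [C [C0 CP]] := bounded_on_compact sd (@closed_ball_rV_compact R d c r) BU.
  by exists C; split => // v vc; exact: CP.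
pose Cs := \sum_k C k.
have Ck k : C k <= Cs.
  rewrite /Cs (bigD1 k)//= lerDl; apply: sumr_ge0 => l _; exact: (CP l).1.
exists (d%:R * Cs); split.
  by rewrite mulr_ge0// sumr_ge0// => l _; exact: (CP l).1.
move=> v v' vB v'B.
have seg s : 0 <= s <= 1 -> `|v' + s *: (v - v') - c| <= r.
  move=> /andP[s0 s1].
  have -> : v' + s *: (v - v') - c = s *: (v - c) + (1 - s) *: (v' - c).
    by apply/rowP => i; rewrite !mxE; ring.
  rewrite (le_trans (ler_normD _ _))// !normrZ !ger0_norm ?subr_ge0//.
  have -> : r = s * r + (1 - s) * r by ring.
  by rewrite lerD// ler_wpM2l// subr_ge0.
have dseg s : 0 <= s <= 1 -> differentiable f (v' + s *: (v - v')).
  by move=> s01; apply: smooth_on_diff sf _; apply: BU; exact: seg.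
have := @lip_line _ _ f v' (v - v') Cs dseg.
rewrite (addrC v') subrK; apply => s k s01.
by apply: le_trans (Ck k); apply: (CP k).2; exact: seg.
Qed.

(** For times within 1 of [s], the difference of two solutions moves with speed at most C K |z s -
    z' s|: [W] is Lipschitz and the solutions stay close. This gives the contraction in [g_step]. *)
Lemma solution_diff {m} (W : 'rV[R]_m -> 'rV[R]_m) :
  (forall k, bounded_smooth (fun x => W x 0 k)) ->
  exists K, 0 < K /\ forall z z', is_solution W z -> is_solution W z' ->
  forall s t, `|t - s| <= 1 ->
   `|(z t - z' t) - (z s - z' s)| <= K * `|t - s| * `|z s - z' s|.
Proof.
move=> WB; have [C [C0 _ _ Wlip _]] := field_bounds WB.
have [K [K0 KP]] := solution_dep WB 1.
exists (C * K); split; first by rewrite mulr_gt0.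
move=> z z' sz sz' s t ts; apply: norm_rV_le => [|k].
  by rewrite !mulr_ge0// ltW.
have dk u : is_derive u (1 : R) (fun u => z u 0 k - z' u 0 k)
    (W (z u) 0 k - W (z' u) 0 k).
  by apply: is_deriveB; exact: is_solution_coord.
have [u us E] := curve_mvt s t dk.
rewrite !mxE E normrM mulrAC ler_wpM2r//.
have := norm_coord (W (z u) - W (z' u)) 0 k; rewrite !mxE => /le_trans; apply.
apply: le_trans (Wlip _ _) _; rewrite -mulrA ler_wpM2l ?(ltW C0)//.
by apply: KP => //; exact: le_trans us ts.
Qed.

End local_tools.

Lemma is_derive_row_mx {R : realType} {a b} (f : R -> 'rV[R]_a) (g : R -> 'rV[R]_b) t df dg :
  is_derive t (1 : R) f df -> is_derive t (1 : R) g dg ->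
  is_derive t (1 : R) (fun t => row_mx (f t) (g t)) (row_mx df dg).
Proof.
move=> hf hg.
have ff : differentiable f t by apply/derivable1_diffP; exact: ex_derive.
have gg : differentiable g t by apply/derivable1_diffP; exact: ex_derive.
have fl i k : (fun t => row_mx (f t) (g t) i (lshift b k)) = (fun t => f t i k).
  by apply/funext => s; rewrite row_mxEl.
have fr i k : (fun t => row_mx (f t) (g t) i (rshift a k)) = (fun t => g t i k).
  by apply/funext => s; rewrite row_mxEr.
have dd : differentiable (fun t => row_mx (f t) (g t)) t.
  apply/differentiable_coords => i j; case: (split_ordP j) => k ->.
    by rewrite fl; exact: (differentiable_coords f t).2.
  by rewrite fr; exact: (differentiable_coords g t).2.
apply: DeriveDef; first exact: diff_derivable.
apply/matrixP => i j; rewrite -(derive_coord _ i j dd).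
case: (split_ordP j) => k ->; rewrite ?row_mxEl ?row_mxEr ?fl ?fr derive_coord//.
  by rewrite (@derive_val _ _ _ _ _ _ _ hf).
by rewrite (@derive_val _ _ _ _ _ _ _ hg).
Qed.

Lemma is_derive_const_mx {R : realType} (t : R) :
  is_derive t (1 : R) (fun t : R => const_mx t : 'rV[R]_1) (const_mx 1).
Proof.
have dlin : is_diff t (fun k : R => k *: (const_mx 1 : 'rV[R]_1))
    (fun k : R => k *: (const_mx 1 : 'rV[R]_1)).
  exact: (is_diff_scalel t (const_mx 1)).
have E : (fun k : R => k *: (const_mx 1 : 'rV[R]_1)) = (fun k : R => const_mx k).
  by apply/funext => s; apply/rowP => k; rewrite !mxE mulr1.
rewrite -E; apply: DeriveDef; first exact/diff_derivable.
by rewrite deriveE// diff_val scale1r.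
Qed.

Lemma continuous_pair_at {X Y Z : topologicalType} (f : X -> Y) (g : X -> Z) (a : X) :
  {for a, continuous f} -> {for a, continuous g} ->
  {for a, continuous (fun x => (f x, g x))}.
Proof.
move=> cf cg P [[A B] [/= hA hB] hP].
have fA : \forall x \near a, A (f x) by exact: cf.
have gB : \forall x \near a, B (g x) by exact: cg.
suff : \forall x \near a, P (f x, g x) by [].
by apply: filterS2 fA gB => x Ax Bx; exact: (hP (f x, g x)).
Qed.

(* The set where [c] takes its initial value is both closed and open. *)
Lemma stay_const {R : realType} {T : topologicalType} (c : R -> T) (O : set T) (s0 : R) :
  hausdorff_space T -> continuous c ->
  open O -> (forall s, O (c s) -> \forall t \near s, c t = c s) ->
  O (c s0) -> forall t, c t = c s0.
Proof.
move=> hT cc oO loc O0.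
pose A := [set t | c t = c s0].
suff AT : A = setT by move=> t; have : A t by rewrite AT.
have clA : closed A.
  have -> : A = c @^-1` [set c s0] by [].
  apply: preimage_closed; first by move=> t _; exact: cc.
  exact: (compact_closed hT (@compact_set1 _ _)).
have opA : open A.
  rewrite openE => s As; have Os : O (c s) by rewrite As.
  by apply: filterS (loc s Os) => t; rewrite /A /= => ->.
have conn : connected [set: R] by apply/connected_intervalP.
apply: conn; [by exists s0|by exists A => //; rewrite setTI|by exists A => //; rewrite setTI].
Qed.

(** * The Hamiltonian flow in the ambient space *)

Section flow.
Context {R : realType} {M : symp_data R}.
Hypothesis sM : is_symplectic_manifold M.
Let mM := symp_manifold sM.
Variables (n : nat) (ic : 'I_n -> cidx M) (cc : 'I_n -> 'rV[R]_(mdim M)) (rr : 'I_n -> R).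
Hypothesis rr0 : forall a, 0 < rr a.
Hypothesis rr_cim : forall a v, `|v - cc a| <= 4 * rr a -> cim (atlas M (ic a)) v.
Variable G : M * circle R -> R.
Hypothesis sG : smooth_fun (N := prod_mfd M (circle_mfd R)) G.
Variables (K1 K : set M).
Hypothesis K1cl : closed K1.
Hypothesis G0 : forall x c, ~ K1 x -> G (x, c) = 0.
Hypothesis K1K : K1 `<=` K.
Hypothesis Kcore : forall x, K x -> exists a, cdom (atlas M (ic a)) x /\
  `|cmap (atlas M (ic a)) x - cc a| <= rr a / 2.
Variable g : R -> M -> M.
Hypothesis gflow : is_hamiltonian_flow (fun t x => G (x, to_circle t)) g.

Local Notation emb := (emb ic cc rr).
Local Notation W := (field ic cc rr G).
Local Notation bump_at := (bump_at ic cc rr).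

Definition core x := exists a, bump_at a x = 1.

Lemma K_core x : K x -> core x.
Proof.
move=> /Kcore[a [dx ax]]; exists a; apply: bump_at_1 => //.
by rewrite (le_trans ax)// ler_pdivrMr// ler_peMr ?ler1n// ltW.
Qed.

Lemma sgrad_out i x t : cdom (atlas M i) x -> ~ K1 x -> sgrad i (Gt G t) x = 0.
Proof.
move=> ix nx; apply: (sgrad_near0 sM ix).
apply: filterS (open_nbhs_nbhs (conj (closed_openC K1cl) nx)) => y ny.
exact: G0.
Qed.

Lemma ext_field_emb i x t : cdom (atlas M i) x ->
  ext_field ic cc rr G (row_mx (emb x) (const_mx t)) =
  'D_(sgrad i (Gt G t) x) (emb \o cinv (atlas M i)) (cmap (atlas M i) x).
Proof.
move=> ix; apply: (ext_fieldE sM rr0 rr_cim sG ix).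
have [Kx|nKx] := pselect (K1 x); last by left; exact: sgrad_out.
by right; exact/K_core/K1K.
Qed.

Definition zcurve (c : R -> M) (t : R) := row_mx (emb (c t)) (const_mx t : 'rV[R]_1).

(* The second condition takes over where [emb] fails to be injective. *)
Definition traj (c : R -> M) :=
  is_solution W (zcurve c) /\ (forall s0, ~ K1 (c s0) -> forall s, c s = c s0).

Lemma g_cont x : continuous (fun t => g t x).
Proof. by move=> t; exact: (gflow.2 x t).1. Qed.

Lemma g_solution x : is_solution W (zcurve (fun t => g t x)).
Proof.
move=> t; rewrite /field; apply: is_derive_row_mx.
  rewrite /zcurve; pose i := at_pt M (g t x).
  have ix : cdom (atlas M i) (g t x) := mfd_at_pt mM _.
  rewrite (ext_field_emb t ix).
  have [ct dt] := gflow.2 x t; have {}dt := dt i ix.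
  have near_i : \forall s \near t, cdom (atlas M i) (g s x).
    by apply: ct; exact: open_nbhs_nbhs (conj (@mfd_dom_open _ _ mM i) ix).
  apply: (@near_eq_is_derive _ _ _ ((emb \o cinv (atlas M i)) \o (fun s => cmap (atlas M i) (g s x)))).
    by apply: filterS near_i => s is_; rewrite /= mfd_mapK.
  have dc : differentiable (fun s => cmap (atlas M i) (g s x)) t.
    by apply/derivable1_diffP; exact: ex_derive.
  have de : differentiable (emb \o cinv (atlas M i)) (cmap (atlas M i) (g t x)).
    by apply: (emb_diff sM rr0 rr_cim); exact: cim_cmap.
  apply: DeriveDef.
    by apply: diff_derivable; exact: differentiable_comp.
  by rewrite (derive_comp _ dc de) (@derive_val _ _ _ _ _ _ _ dt).
exact: is_derive_const_mx.
Qed.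

(** On the open complement of [K1] the field vanishes, so a trajectory there has zero velocity in
    charts and is locally constant; [stay_const] extends this to all times. *)
Lemma g_stationary x s0 : ~ K1 (g s0 x) -> forall s, g s x = g s0 x.
Proof.
move=> nK; apply: (stay_const (O := ~` K1)) nK.
- exact: mfd_hausdorff mM.
- exact: g_cont.
- exact: closed_openC.
move=> s Os; pose i := at_pt M (g s x).
have ix : cdom (atlas M i) (g s x) := mfd_at_pt mM _.
have oU : open (cdom (atlas M i) `&` ~` K1).
  by apply: openI; [exact: (@mfd_dom_open _ _ mM i)|exact: closed_openC].
have : \forall t \near s, (cdom (atlas M i) `&` ~` K1) (g t x).
  by apply: (gflow.2 x s).1; exact: open_nbhs_nbhs (conj oU (conj ix Os)).
move=> /nbhs_ballP[e /= e0 eP].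
apply/nbhs_ballP; exists e => //= t bt.
have [it _] := eP t bt.
rewrite -(mfd_mapK mM it) -(mfd_mapK mM ix); congr (cinv _ _).
apply/rowP => k.
pose f u := cmap (atlas M i) (g u x) 0 k.
have seg u : `|u - s| <= `|t - s| -> ball s e u.
  move=> us; rewrite /ball /= distrC (le_lt_trans us)//.
  by move: bt; rewrite /ball /= distrC.
have df u : `|u - s| <= `|t - s| -> is_derive u (1 : R) f 0.
  move=> /seg/eP[iu nu]; have [_ du] := gflow.2 x u; have {}du := du i iu.
  have dd : differentiable (fun s => cmap (atlas M i) (g s x)) u.
    by apply/derivable1_diffP; exact: ex_derive.
  apply: DeriveDef; first by apply: diff_derivable; exact: (differentiable_coords _ u).2.
  rewrite derive_coord// (@derive_val _ _ _ _ _ _ _ du).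
  by rewrite (sgrad_out u iu nu) mxE.
suff : f t = f s by [].
have cf u : `|u - s| <= `|t - s| -> {for u, continuous f}.
  move=> /df du; apply: differentiable_continuous.
  by apply/derivable1_diffP; exact: ex_derive.
have [st|ts] := leP s t.
  have [u ut||u _ E] := @MVT_segment _ f (fun=> 0) s t st.
  - apply: df; move: ut; rewrite in_itv/= => /andP[a b].
    by rewrite !ger0_norm ?subr_ge0 ?(ltW a)// lerD2r ltW.
  - apply: continuous_in_subspaceT => u; rewrite inE/= in_itv/= => /andP[a b].
    by apply: cf; rewrite !ger0_norm ?subr_ge0// lerD2r.
  by move: E => /eqP; rewrite mul0r subr_eq0 => /eqP.
have [u ut||u _ E] := @MVT_segment _ f (fun=> 0) t s (ltW ts).
- apply: df; move: ut; rewrite in_itv/= => /andP[a b].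
  by rewrite !ler0_norm ?subr_le0 ?(ltW ts) ?(ltW b)// lerN2 lerD2r ltW.
- apply: continuous_in_subspaceT => u; rewrite inE/= in_itv/= => /andP[a b].
  by apply: cf; rewrite !ler0_norm ?subr_le0 ?(ltW ts)// lerN2 lerD2r.
by move: E => /eqP; rewrite mul0r subr_eq0 => /eqP.
Qed.

Lemma g_traj x : traj (fun t => g t x).
Proof. by split; [exact: g_solution|exact: g_stationary]. Qed.

Let WB k : bounded_smooth (fun z => W z 0 k).
Proof. exact: (field_bounded_smooth sM rr0 rr_cim sG). Qed.

Lemma traj_shift c : traj c -> traj (fun s => c (s + 1)).
Proof.
move=> [sc st]; split; last by move=> s0 h s; rewrite (st _ h).
have zE s : zcurve (fun s => c (s + 1)) s = zcurve c (s + 1) - tvec.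
  rewrite /zcurve /tvec; apply/eqP; rewrite eq_sym subr_eq add_row_mx addr0.
  by apply/eqP; congr row_mx; apply/rowP => k; rewrite !mxE.
move=> t; rewrite zE.
have -> : zcurve (fun s => c (s + 1)) = (zcurve c \o (fun s => s + 1)) - cst tvec.
  by apply/funext => s; exact: zE.
have d1 : is_derive t (1 : R) (fun s : R => s + 1) 1.
  by rewrite -[X in is_derive _ _ _ X]addr0; apply: is_deriveD.
have dd : differentiable (zcurve c) (t + 1).
  by apply/derivable1_diffP; have := sc (t + 1) => ?; exact: ex_derive.
have d11 : differentiable (fun s : R => s + 1) t.
  by apply/derivable1_diffP; exact: ex_derive.
rewrite -[X in is_derive _ _ _ X]subr0; apply: is_deriveB.
apply: DeriveDef; first by apply: diff_derivable; exact: differentiable_comp.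
rewrite derive_comp// (@derive_val _ _ _ _ _ _ _ d1) (@derive_val _ _ _ _ _ _ _ (sc (t + 1))).
have := field_periodic ic cc rr G (zcurve c (t + 1) - tvec).
by rewrite subrK => ->.
Qed.

Lemma core_inj x x' : core x -> emb x = emb x' -> x = x'.
Proof. by move=> [a ba]; apply: (emb_inj1 sM rr0 (a := a)); rewrite ba ltr01. Qed.

(** Uniqueness in the ambient space gives equal images under [emb]. If one of the two points lies in
    [K1], [emb] is injective there; otherwise both trajectories are constant, and they agree at
    [s0]. *)
Lemma traj_eq c1 c2 s0 : traj c1 -> traj c2 -> c1 s0 = c2 s0 -> forall s, c1 s = c2 s.
Proof.
move=> [sc1 st1] [sc2 st2] E s.
have : zcurve c1 s = zcurve c2 s.
  by apply: (solution_unique WB sc1 sc2 (s := s0)); rewrite /zcurve E.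
move=> /eq_row_mx[Es _].
have [k1|k1] := pselect (K1 (c1 s)); first by apply: core_inj Es; exact/K_core/K1K.
have [k2|k2] := pselect (K1 (c2 s)); first by apply/esym; apply: core_inj (esym Es); exact/K_core/K1K.
by rewrite -(st1 _ k1 s0) E; exact: st2.
Qed.

(** As the field is periodic, both sides are trajectories in [s]; they agree at s = 0. *)
Lemma g_shift1 x s : g (s + 1) x = g s (g 1 x).
Proof.
apply: (traj_eq (s0 := 0) (traj_shift (g_traj x)) (g_traj (g 1 x))).
by rewrite add0r (gflow.1 (g 1 x)).
Qed.

Lemma g_inj t x x' : g t x = g t x' -> x = x'.
Proof.
move=> E; have := traj_eq (g_traj x) (g_traj x') E 0.
by rewrite !gflow.1.
Qed.

Lemma near0_mul_le (c b : R) : 0 < b -> \forall e \near (0 : R)^'+, c * e <= b.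
Proof.
move=> b0; near=> e.
have e0 : 0 < e by near: e; exact: nbhs_right_gt.
have : e < b / (`|c| + 1).
  by near: e; apply: nbhs_right_lt; rewrite divr_gt0// ltr_wpDl.
rewrite ltr_pdivlMr ?ltr_wpDl// mulrDr mulr1 => eb.
have : c * e <= e * `|c| by rewrite mulrC ler_wpM2l ?(ltW e0)// ler_norm.
lra.
Unshelve. all: by end_near. Qed.

Lemma emb_chart_lip a : exists L, 0 <= L /\ forall v v',
  `|v - cc a| <= rr a -> `|v' - cc a| <= rr a ->
  `|emb (cinv (atlas M (ic a)) v) - emb (cinv (atlas M (ic a)) v')| <= L * `|v - v'|.
Proof.
have BU : [set v | `|v - cc a| <= rr a] `<=` cim (atlas M (ic a)).
  by move=> v va; apply: rr_cim; rewrite (le_trans va)// ler_peMl ?(ltW (rr0 a))// ler1n.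
have /choice[L LP] : forall k, exists L, 0 <= L /\ forall v v',
  `|v - cc a| <= rr a -> `|v' - cc a| <= rr a ->
  `|emb (cinv (atlas M (ic a)) v) 0 k - emb (cinv (atlas M (ic a)) v') 0 k| <= L * `|v - v'|.
  move=> k; have sk := @emb_chart_smooth _ _ sM n ic cc rr rr0 rr_cim (ic a) k.
  have [L [L0 H]] := lip_on_ball sk BU.
  by exists L; split => // v v' va va'; exact: H.
exists (\sum_k L k); split; first by apply: sumr_ge0 => k _; exact: (LP k).1.
move=> v v' va va'; apply: norm_rV_le => [|k].
  by rewrite mulr_ge0// sumr_ge0// => k _; exact: (LP k).1.
rewrite mxE [X in _ + X]mxE (le_trans ((LP k).2 v v' va va'))// ler_wpM2r//.
by rewrite (bigD1 k)//= lerDl sumr_ge0// => l _; exact: (LP l).1.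
Qed.

Lemma norm_zcurve_eq c1 c2 s : `|zcurve c1 s - zcurve c2 s| <= `|emb (c1 s) - emb (c2 s)|.
Proof.
apply: norm_rV_le => // k; rewrite /zcurve opp_row_mx add_row_mx.
case: (split_ordP k) => l ->; first by rewrite row_mxEl norm_coord.
by rewrite row_mxEr !mxE subrr normr0.
Qed.

Lemma norm_emb_lip c s t : `|emb (c t) - emb (c s)| <= `|zcurve c t - zcurve c s|.
Proof.
apply: norm_rV_le => // k.
have := norm_coord (zcurve c t - zcurve c s) 0 (lshift 1 k).
by rewrite /zcurve opp_row_mx add_row_mx row_mxEl.
Qed.

Lemma vec_of_le a (y y' : 'rV[R]_(emb_dim (M := M) n)) : `|vec_of a y - vec_of a y'| <= `|y - y'|.
Proof.
apply: norm_rV_le => // k.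
have := norm_coord (y - y') 0 (enum_rank ((a, Some k) : emb_idx (M := M) n)).
by rewrite !mxE.
Qed.

(* [is_hamiltonian_flow] does not say that [g t] is onto. In a chart, [g t]
   composed with a section of [g s] is a small perturbation of the identity; the
   admissible time step does not depend on [s]. *)
Lemma g_step : exists2 eps : R, 0 < eps & forall s t, `|t - s| <= eps ->
  (forall p, exists x, g s x = p) -> forall p, exists x, g t x = p.
Proof.
have [C [C0 WC _ _ _]] := field_bounds WB.
have [K2 [K20 diffP]] := solution_diff WB.
have /choice[L LP] := emb_chart_lip.
(* eps <= 1 is what [solution_diff] asks for; C eps <= 1/2 keeps the bump positive at the moved
   point; C eps <= rr a / 2 is the displacement allowed by [near_id_surj], and K2 L a eps <= 1/2 its
   contraction factor. There are finitely many [a], so one [eps] serves all. *)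
have [eps [eps0 [eps1 Ceps epsa]]] : exists eps : R, 0 < eps /\
    [/\ 1 * eps <= 1, C * eps <= 2^-1 &
     forall a : 'I_n, C * eps <= rr a / 2 /\ (K2 * L a) * eps <= 2^-1].
  apply: (@filter_ex _ (0^'+ : set_system R)); near=> e.
  split; first by near: e; exact: nbhs_right_gt.
  split; [by near: e; exact: near0_mul_le|by near: e; apply: near0_mul_le; rewrite invr_gt0|].
  near: e; apply: filter_forall => a'.
  have ra : 0 < rr a' / 2 by rewrite divr_gt0.
  have h2 : 0 < 2^-1 :> R by rewrite invr_gt0.
  exact: filterI (near0_mul_le C ra) (near0_mul_le (K2 * L a') h2).
exists eps => // s t ts surj p.
have [nKp|Kp] := pselect (~ K1 p).
  by have [x xp] := surj p; exists x; rewrite -xp; apply: g_stationary; rewrite xp.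
have {Kp}Kp : K1 p by apply: contrapT.
have [a [ap pa]] := Kcore (K1K Kp).
have [Ca La] := epsa a.
have /choice[ginv ginvP] := surj.
set ca := atlas M (ic a).
pose v0 := cmap ca p.
(* By [Kcore] the point [v0] is within rr a / 2 of the centre, so the ball of radius [r] about [v0]
   stays where [bump_at a] is 1. *)
pose r := rr a / 2.
have r0 : 0 < r by rewrite divr_gt0.
have vr v : `|v - v0| <= r -> `|v - cc a| <= rr a.
  move=> vv; have -> : v - cc a = (v - v0) + (v0 - cc a) by rewrite addrA subrK.
  by rewrite (le_trans (ler_normD _ _))// [leRHS](splitr (rr a)) lerD.
have vi v : `|v - v0| <= r -> cim ca v.
  move=> /vr va; apply: rr_cim; rewrite (le_trans va)// ler_peMl ?(ltW (rr0 a))// ler1n//.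
have b1 v : `|v - v0| <= r -> bump_at a (cinv ca v) = 1.
  move=> vv; apply: bump_at_1 => //; first by apply: cdom_cinv => //; exact: vi.
  by rewrite cmapK//; [exact: vr|exact: vi].
pose xv v := ginv (cinv ca v).
have gxv v : g s (xv v) = cinv ca v by exact: ginvP.
pose Phi v := vec_of a (emb (g t (xv v))).
have vE v : `|v - v0| <= r -> v = vec_of a (emb (g s (xv v))).
  move=> vv; rewrite gxv (vec_emb rr0) ?b1//; first by rewrite cmapK//; exact: vi.
have lipt v : `|emb (g t (xv v)) - emb (g s (xv v))| <= C * eps.
  apply: le_trans (norm_emb_lip (fun t => g t (xv v)) s t) _.
  apply: le_trans (solution_lip s t WC (g_solution (xv v))) _.
  by rewrite ler_wpM2l ?(ltW C0).
have [|v v' vv vv'|v vv PhiE] := @near_id_surj R _ v0 r Phi r0.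
- move=> v vv; rewrite [X in _ - X](vE v vv) (le_trans (vec_of_le _ _ _))//.
  exact: le_trans (lipt v) Ca.
- rewrite {2}(vE v vv) {2}(vE v' vv') /Phi.
  set z := zcurve (fun t => g t (xv v)); set z' := zcurve (fun t => g t (xv v')).
  have D := diffP z z' (g_solution (xv v)) (g_solution (xv v')) s t.
  have ts1 : `|t - s| <= 1 by rewrite (le_trans ts)//; move: eps1; rewrite mul1r.
  have {}D := D ts1.
  have comp k : (vec_of a (emb (g t (xv v))) - vec_of a (emb (g s (xv v))) -
    (vec_of a (emb (g t (xv v'))) - vec_of a (emb (g s (xv v'))))) 0 k =
    ((z t - z' t) - (z s - z' s)) 0 (lshift 1 (enum_rank ((a, Some k) : emb_idx (M := M) n))).
    rewrite /z /z' /zcurve !opp_row_mx !add_row_mx !opp_row_mx !add_row_mx row_mxEl.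
    move: (emb (g t (xv v))) (emb (g s (xv v))) (emb (g t (xv v'))) (emb (g s (xv v'))) => y1 y2 y3 y4.
    by rewrite /vec_of !mxE; ring.
  apply: norm_rV_le => [|k]; first by rewrite mulr_ge0// invr_ge0.
  rewrite comp (le_trans (norm_coord _ _ _))// (le_trans D)//.
  have zs : `|z s - z' s| <= L a * `|v - v'|.
    apply: le_trans (norm_zcurve_eq _ _ _) _; rewrite !gxv.
    by apply: (LP a).2; exact: vr.
  apply: (@le_trans _ _ (K2 * eps * (L a * `|v - v'|))).
    by apply: ler_pM; rewrite ?mulr_ge0 ?(ltW K20)// ler_wpM2l ?(ltW K20).
  have -> : K2 * eps * (L a * `|v - v'|) = (K2 * L a) * eps * `|v - v'| by ring.
  by rewrite ler_wpM2r.
exists (xv v).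
have bp : bump_at a p = 1.
  by apply: bump_at_1 => //; rewrite (le_trans pa)// ler_pdivrMr// ler_peMr ?ler1n// ltW.
have bg : 0 < bump_at a (g t (xv v)).
  have : `|bump_at a (g t (xv v)) - bump_at a (g s (xv v))| <= C * eps.
    apply: le_trans (lipt v).
    have := norm_coord (emb (g t (xv v)) - emb (g s (xv v))) 0 (enum_rank ((a, None) : emb_idx (M := M) n)).
    by rewrite mxE [X in _ + X]mxE -!/(scal_of a _) !scal_emb.
  rewrite gxv b1// ler_norml => /andP[+ _].
  have := Ceps; have : (2^-1 : R) < 1 by rewrite invf_lt1// ltr1n.
  lra.
apply: (emb_inj sM rr0 bg); first by rewrite bp ltr01.
by rewrite -/(Phi v) PhiE /v0 (vec_emb rr0) ?bp ?ltr01.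
Unshelve. all: by end_near. Qed.

(** Time [t] is reached from time 0, where [g] is the identity, by equal steps of length at most
    [eps]. *)
Lemma g_surj t p : exists x, g t x = p.
Proof.
have [eps e0 step] := g_step.
have H (m : nat) : forall t, `|t| <= m%:R * eps -> forall p, exists x, g t x = p.
  elim: m => [|m IH] u um q.
    move: um; rewrite mul0r normr_le0 => /eqP ->.
    by exists q; exact: gflow.1.
  pose s := u * (m%:R / m.+1%:R).
  have m0 : 0 < m.+1%:R :> R by rewrite ltr0n.
  have u1 : `|u| / m.+1%:R <= eps by rewrite ler_pdivrMr// mulrC.
  apply: (step s) => [|q'].
    have -> : u - s = u / m.+1%:R.
      by rewrite /s -[X in X - _]mulr1 -mulrBr -[X in X - _](@divff _ (m.+1%:R : R)) ?gt_eqF// -mulrBl -natr1 addrAC subrr add0r mul1r.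
    by rewrite normrM normfV (gtr0_norm m0).
  apply: IH; rewrite /s normrM [X in _ * X]ger0_norm ?divr_ge0//.
  by rewrite mulrCA ler_wpM2l.
have [m _ mt] : exists2 m : nat, True & `|t| <= m%:R * eps.
  exists (Num.trunc (`|t| / eps)).+1 => //.
  by rewrite -ler_pdivrMr// ltW// truncnS_gt.
exact: (H m).
Qed.

(** For negative [k] the point [y] arises from [x] by repeated preimages under [g 1], which [g_surj]
    provides. *)
Lemma g_shiftZ (k : int) x : exists y, forall s, g (s + k%:~R) x = g s y.
Proof.
have pos (m : nat) y0 : exists y, forall s, g (s + m%:R) y0 = g s y.
  elim: m => [|m [y IH]]; first by exists y0 => s; rewrite addr0.
  exists (g 1 y) => s.
  by rewrite -[m.+1%:R]natr1 [m%:R + 1]addrC addrA IH g_shift1.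
have neg (m : nat) y0 : exists y, forall s, g (s - m%:R) y0 = g s y.
  elim: m => [|m [y IH]]; first by exists y0 => s; rewrite subr0.
  have [y1 y1E] := g_surj 1 y; exists y1 => s.
  rewrite -[m.+1%:R]natr1 opprD [- m%:R - 1]addrC addrA IH -y1E -g_shift1.
  by rewrite subrK.
case: k => m; first exact: pos.
have [y yE] := neg m.+1 x; exists y => s.
by rewrite NegzE mulrNz.
Qed.

Lemma emb_core_neq0 x : core x -> emb x != 0.
Proof.
move=> [a ba]; apply/eqP => e0.
have := scal_emb ic cc rr a x; rewrite ba e0 /scal_of mxE => /eqP.
by rewrite eq_sym oner_eq0.
Qed.

Lemma core_orbit x s0 : core (g s0 x) -> forall s, core (g s x).
Proof.
move=> c0 s; have [k1|nk1] := pselect (K1 (g s x)); first exact/K_core/K1K.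
by have := g_stationary nk1 s0 => <-.
Qed.

Lemma g_section : exists ginv : R -> M -> M, forall t p, g t (ginv t p) = p.
Proof.
have /choice[f fP] : forall tp : R * M, exists x, g tp.1 x = tp.2.
  by move=> [t p]; exact: g_surj.
by exists (fun t p => f (t, p)) => t p; exact: (fP (t, p)).
Qed.

(** * Swept sets and the almost first integral *)

Section orbit_map.
Variable ginv : R -> M -> M.
Hypothesis ginvK : forall t p, g t (ginv t p) = p.

(* With [w = ((p, t0), s)]: the trajectory through [p] at time [t0], followed for
   the time [s]. *)
Definition orbit_map (w : M * R * R) : 'rV[R]_(emb_dim (M := M) n + 1) :=
  zcurve (fun t => g t (ginv w.1.2 w.1.1)) (w.1.2 + w.2).

Definition orbit_circle (w : M * R * R) := strip_emb (orbit_map w).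

(** [ginv] is an arbitrary choice of preimages, but the trajectory that it selects passes through
    (emb p, t0) at time t0, and this point depends continuously on p and t0. Gronwall and the speed
    bound carry the continuity to time t0 + s. *)
Lemma orbit_map_cont : continuous orbit_map.
Proof.
move=> [[p t0] s0].
have [C [C0 WC _ _ _]] := field_bounds WB.
have [K2 [K20 KP]] := solution_dep WB `|s0|.
have bound p' t' s' : `|orbit_map (p, t0, s0) - orbit_map (p', t', s')| <=
    C * (`|t' - t0| + `|s' - s0|) + K2 * (C * `|t' - t0| + (`|emb p' - emb p| + `|t' - t0|)).
  rewrite /orbit_map /=.
  set z := zcurve (fun t => g t (ginv t0 p)).
  set z' := zcurve (fun t => g t (ginv t' p')).
  have sz : is_solution W z := g_solution _.
  have sz' : is_solution W z' := g_solution _.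
  have h1 : `|z (t0 + s0) - z' (t0 + s0)| <= K2 * `|z t0 - z' t0|.
    by apply: KP => //; rewrite addrAC subrr add0r.
  have h2 : `|z' (t0 + s0) - z' (t' + s')| <= C * (`|t' - t0| + `|s' - s0|).
    apply: le_trans (solution_lip _ _ WC sz') _; rewrite ler_wpM2l ?(ltW C0)//.
    rewrite (_ : t0 + s0 - (t' + s') = (t0 - t') + (s0 - s')); last by ring.
    by rewrite (le_trans (ler_normD _ _))// ![`|t' - _|]distrC ![`|s' - _|]distrC.
  have h3 : `|z' t' - z' t0| <= C * `|t' - t0| by exact: solution_lip WC sz'.
  have h4 : `|z t0 - z' t'| <= `|emb p' - emb p| + `|t' - t0|.
    rewrite /z /z' /zcurve !ginvK opp_row_mx add_row_mx.
    apply: norm_rV_le => [|k]; first by rewrite addr_ge0.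
    case: (split_ordP k) => l ->; rewrite ?row_mxEl ?row_mxEr.
      by rewrite (le_trans (norm_coord _ _ _))// distrC lerDl.
    by rewrite !mxE distrC lerDr.
  have -> : z (t0 + s0) - z' (t' + s') = (z (t0 + s0) - z' (t0 + s0)) + (z' (t0 + s0) - z' (t' + s')).
    by rewrite addrA subrK.
  rewrite (le_trans (ler_normD _ _))// addrC lerD// (le_trans h1)// ler_wpM2l ?(ltW K20)//.
  have -> : z t0 - z' t0 = (z' t' - z' t0) + (z t0 - z' t') by rewrite [RHS]addrC addrA subrK.
  by rewrite (le_trans (ler_normD _ _))// lerD.
apply/cvgrPdist_le => e e0.
pose A := 2 * C + K2 * (C + 2) + 1.
have A0 : 0 < A by rewrite /A ltr_wpDl// !addr_ge0// mulr_ge0// ?addr_ge0// ltW.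
have eA : 0 < e / A by rewrite divr_gt0.
have n1 : \forall w \near (p, t0, s0), `|emb w.1.1 - emb p| <= e / A.
  have c1 : {for (p, t0, s0), continuous (fun w : M * R * R => emb w.1.1)}.
    apply: (@continuous_comp _ _ _ (fun w : M * R * R => w.1.1) emb).
      by apply: continuous_comp; exact: cvg_fst.
    exact: (emb_cont sM rr0 rr_cim).
  have /cvgrPdist_le/(_ _ eA) := c1.
  by apply: filterS => w; rewrite distrC.
have n2 : \forall w \near (p, t0, s0), `|w.1.2 - t0| <= e / A.
  have c1 : {for (p, t0, s0), continuous (fun w : M * R * R => w.1.2)}.
    by apply: (@continuous_comp _ _ _ (fun w : M * R * R => w.1) snd); [exact: cvg_fst|exact: cvg_snd].
  have /cvgrPdist_le/(_ _ eA) := c1.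
  by apply: filterS => w; rewrite distrC.
have n3 : \forall w \near (p, t0, s0), `|w.2 - s0| <= e / A.
  have c1 : {for (p, t0, s0), continuous (fun w : M * R * R => w.2)} by exact: cvg_snd.
  have /cvgrPdist_le/(_ _ eA) := c1.
  by apply: filterS => w; rewrite distrC.
apply: filterS3 n1 n2 n3 => -[[p' t'] s'] /= h1 h2 h3.
apply: le_trans (bound p' t' s') _.
apply: (@le_trans _ _ (A * (e / A))); last by rewrite mulrC divfK ?gt_eqF.
set x := e / A in eA h1 h2 h3 *.
apply: (@le_trans _ _ (C * (x + x) + K2 * (C * x + (x + x)))).
  apply: lerD; first by rewrite ler_wpM2l ?(ltW C0)// lerD.
  rewrite ler_wpM2l ?(ltW K20)// lerD ?lerD// ler_wpM2l ?(ltW C0)//.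
have -> : A * x = C * (x + x) + K2 * (C * x + (x + x)) + x by rewrite /A; ring.
by rewrite lerDl ltW.
Qed.

Lemma orbit_circle_cont : continuous orbit_circle.
Proof.
move=> w; apply: (@continuous_comp _ _ _ orbit_map strip_emb); first exact: orbit_map_cont.
apply: differentiable_continuous; exact: smoothV_diff smoothV_strip_emb _.
Qed.

(** Times on the circle agree only up to an integer [k]. By [g_shiftZ] the first trajectory shifted
    by [k] is a trajectory too; it meets the second one at one moment, hence coincides with it. The
    chord is read off at the times t0 and t1 + k. *)
Lemma orbit_circle_chord p0 t0 s0 p1 t1 s1 : core p0 -> core p1 ->
  orbit_circle (p0, t0, s0) = orbit_circle (p1, t1, s1) ->
  exists x u, [/\ g t0 x = p0, g u x = p1 & t0 - u = s1 - s0].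
Proof.
move=> c0 c1; rewrite /orbit_circle /orbit_map /strip_emb /zcurve /=.
move=> /eq_row_mx[]; rewrite !row_mxKl !tcoord_row => Ee /circle_emb_eq[k Ek].
set x0 := ginv t0 p0; set x1 := ginv t1 p1.
have [y yE] := g_shiftZ k x0.
have cx0 : core (g (t0 + s0) x0) by apply: (core_orbit (s0 := t0)); rewrite ginvK.
have E : g (t1 + s1) y = g (t1 + s1) x1 by rewrite -yE -Ek; exact: core_inj Ee.
have yx : y = x1 := g_inj E.
exists x0, (t1 + k%:~R); split; first exact: ginvK.
  by rewrite yE yx ginvK.
by move: Ek; lra.
Qed.

Lemma orbit_circle_neq0 p t s : core p -> lsubmx (orbit_circle (p, t, s)) != 0.
Proof.
move=> cp; rewrite /orbit_circle /orbit_map /strip_emb /zcurve /= !row_mxKl.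
by apply: emb_core_neq0; apply: (core_orbit (s0 := t)); rewrite ginvK.
Qed.

End orbit_map.

Variables X0 X1 : set M.
Hypotheses (X0_compact : compact X0) (X1_compact : compact X1).
Hypotheses (X0K : X0 `<=` K) (X1K : X1 `<=` K).

(** Sweeping times are written c T' with c in [0, 1], so that one compact parameter set serves all
    T'. There [D] is nonzero for T' = T, by the absence of chords; being jointly continuous, it
    stays nonzero for slightly larger T'. *)
Lemma longer_time (T : R) ginv : 0 < T -> (forall t p, g t (ginv t p) = p) ->
  (forall x t0 t1, `|t0 - t1| <= T -> X0 (g t0 x) -> X1 (g t1 x) -> False) ->
  exists2 T', T < T' & forall p0 t0 s0 p1 t1 s1, X0 p0 -> X1 p1 ->
    0 <= t0 <= 1 -> 0 <= t1 <= 1 -> 0 <= s0 <= T' -> 0 <= s1 <= T' ->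
    orbit_circle ginv (p0, t0, s0) <> orbit_circle ginv (p1, t1, s1).
Proof.
move=> T0 ginvK nochord.
pose I := [set x : R | 0 <= x <= 1].
have cI : compact I.
  have -> : I = `[0, 1]%classic by apply/seteqP; split => x; rewrite /= in_itv.
  exact: segment_compact.
pose A0 := X0 `*` I `*` I; pose A1 := X1 `*` I `*` I.
have cA : compact (A0 `*` A1) by repeat apply: compact_setX => //.
pose D (T' : R) (w : (M * R * R) * (M * R * R)) :=
  orbit_circle ginv (w.1.1, w.1.2 * T') - orbit_circle ginv (w.2.1, w.2.2 * T').
have H : \forall T' \near T^'+, A0 `*` A1 `<=` (fun w => D T' w != 0).
  move/compact_near_coveringP : cA; apply => -[[[p0 t0] c0] [[p1 t1] c1]].
  move=> [[[/= Xp0 It0] Ic0] [[/= Xp1 It1] Ic1]].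
  have DT : D T (p0, t0, c0, (p1, t1, c1)) != 0.
    rewrite /D subr_eq0; apply/eqP => /=.
    move=> /(orbit_circle_chord ginvK (K_core (X0K Xp0)) (K_core (X1K Xp1)))[x [u [gx0 gx1 E]]].
    apply: (nochord x t0 u); rewrite ?gx0 ?gx1// E.
    move: Ic0 Ic1; rewrite /I/= => /andP[a b] /andP[c d].
    have : 0 <= c0 * T <= T by rewrite mulr_ge0 ?(ltW T0)//= ler_piMl// ltW.
    have : 0 <= c1 * T <= T by rewrite mulr_ge0 ?(ltW T0)//= ler_piMl// ltW.
    by move=> /andP[? ?] /andP[? ?]; rewrite ler_norml; apply/andP; split; lra.
  pose DD (v : ((M * R * R) * (M * R * R)) * R) := D v.2 v.1.
  have cD : {for ((p0, t0, c0, (p1, t1, c1)), T), continuous DD}.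
    set w0 := (_, T).
    have ctf (X Y : topologicalType) (f : (M * R * R) * (M * R * R) * R -> X * Y) :
        {for w0, continuous f} -> {for w0, continuous (fun v => (f v).1)}.
      by move=> cf; apply: (continuous_comp cf); exact: cvg_fst.
    have cts (X Y : topologicalType) (f : (M * R * R) * (M * R * R) * R -> X * Y) :
        {for w0, continuous f} -> {for w0, continuous (fun v => (f v).2)}.
      by move=> cf; apply: (continuous_comp cf); exact: cvg_snd.
    have k1 : {for w0, continuous (fun v : (M * R * R) * (M * R * R) * R => v.1)} by exact: cvg_fst.
    have k2 : {for w0, continuous (fun v : (M * R * R) * (M * R * R) * R => v.2)} by exact: cvg_snd.
    have k11 := ctf _ _ _ k1; have k12 := cts _ _ _ k1.
    pose VT := ((M * R * R) * (M * R * R) * R)%type.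
    have m1 : {for w0, continuous (fun v : VT => v.1.1.2 * v.2)}.
      by exact: (cvgM (cts _ _ _ k11) k2).
    have m2 : {for w0, continuous (fun v : VT => v.1.2.2 * v.2)}.
      by exact: (cvgM (cts _ _ _ k12) k2).
    have o1 : {for w0, continuous (fun v : VT => (v.1.1.1, v.1.1.2 * v.2))}.
      exact: (continuous_pair_at (g := fun v : VT => v.1.1.2 * v.2) (ctf _ _ _ k11) m1).
    have o2 : {for w0, continuous (fun v : VT => (v.1.2.1, v.1.2.2 * v.2))}.
      exact: (continuous_pair_at (g := fun v : VT => v.1.2.2 * v.2) (ctf _ _ _ k12) m2).
    have oc := orbit_circle_cont ginvK.
    have q1 := continuous_comp o1 (oc _).
    have q2 := continuous_comp o2 (oc _).
    exact: (cvgB q1 q2).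
  have op : open [set y : 'rV[R]_(emb_dim (M := M) n + 2) | y != 0].
    have -> : [set y : 'rV[R]_(emb_dim (M := M) n + 2) | y != 0] = ~` [set 0].
      by apply/seteqP; split => y /= /eqP.
    apply: closed_openC; apply: compact_closed; [exact: norm_hausdorff|exact: compact_set1].
  have : \forall v \near ((p0, t0, c0, (p1, t1, c1)), T), DD v != 0.
    exact: (cD _ (open_nbhs_nbhs (conj op DT))).
  move=> [[/= B1 B2] [hB1 hB2] hB]; exists (B1, B2).
    split; first exact: hB1.
    exact: (@cvg_within _ _ _ (fun y : R => T < y) B2 hB2).
  by move=> [w T'] /= [b1 b2]; exact: (hB (w, T')).
have [T' [HT' TT']] : exists T' : R, A0 `*` A1 `<=` (fun w => D T' w != 0) /\ T < T'.
  apply: (@filter_ex _ (T^'+ : set_system R)); near=> T'; split; first by near: T'.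
  by near: T'; exact: nbhs_right_gt.
exists T' => // p0 t0 s0 p1 t1 s1 Xp0 Xp1 It0 It1 /andP[a b] /andP[c d] E.
have T'0 : 0 < T' by exact: lt_trans TT'.
have := HT' (p0, t0, s0 / T', (p1, t1, s1 / T')).
rewrite /D /= !divfK ?gt_eqF// E subrr eqxx => /(_ _)/negP; apply => //.
by split; split => //=; rewrite /I/= divr_ge0 ?(ltW T'0)//= ler_pdivrMr// mul1r.
Unshelve. all: by end_near. Qed.

Lemma euler_iter_shift tau k z : iter k (euler W tau) (z + tvec) = iter k (euler W tau) z + tvec.
Proof.
by elim: k => [//|k /= ->]; rewrite /euler field_periodic addrAC.
Qed.

Lemma euler_iter0 tau k z : lsubmx z = 0 -> lsubmx (iter k (euler W tau) z) = 0.
Proof.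
move=> z0; elim: k => [//|k IH]; rewrite [iter _ _ _]/=.
move: (iter k _ _) IH => y y0.
rewrite /euler /field (ext_field0 _ _ _ _ y0) linearD /= y0 add0r linearZ /= row_mxKl.
exact: scaler0.
Qed.

Lemma almost_first_integral (T : R) : 0 < T ->
  (forall x t0 t1, `|t0 - t1| <= T -> X0 (g t0 x) -> X1 (g t1 x) -> False) ->
  exists2 T', T < T' & forall eps, 0 < eps ->
  exists F : 'rV[R]_(emb_dim (M := M) n + 1) -> R,
  [/\ smooth_on setT F, forall z, F (z + tvec) = F z,
      forall z, lsubmx z = 0 -> F z = 0,
      forall x t, (X0 x -> F (row_mx (emb x) (const_mx t)) = 0) /\
                  (X1 x -> F (row_mx (emb x) (const_mx t)) = 1) &
      forall z, `|'D_(W z) F z| <= 1 / T' + eps].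
Proof.
move=> T0 nochord.
have [ginv ginvK] := g_section.
have [T' TT' disj] := longer_time T0 ginvK nochord.
exists T' => // eps eps0.
have T'0 : 0 < T' := lt_trans T0 TT'.
pose orb (X : set M) := orbit_circle ginv @` (X `*` [set x : R | 0 <= x <= 1] `*` [set x : R | 0 <= x <= T']).
have cI a : compact [set x : R | 0 <= x <= a].
  have -> : [set x : R | 0 <= x <= a] = `[0, a]%classic by apply/seteqP; split => x; rewrite /= in_itv.
  exact: segment_compact.
have corb X : compact X -> compact (orb X).
  move=> cX; apply: continuous_compact.
    by apply: continuous_subspaceT; exact: orbit_circle_cont.
  by apply: compact_setX => //; exact: compact_setX.
(* The function [u] shall also vanish near the points with M-part 0, the value of [emb] outside a
   compact set. The sweep of [X1] avoids them, since [emb] is nonzero on the core. *)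
pose Z := [set y : 'rV[R]_(emb_dim (M := M) n + 2) | lsubmx y = 0].
have cZ : closed Z.
  have -> : Z = lsubmx @^-1` [set 0] by [].
  apply: preimage_closed.
    by move=> y _; apply: differentiable_continuous; exact: differentiable_lsubmx.
  by apply: compact_closed; [exact: norm_hausdorff|exact: compact_set1].
have clC : closed (orb X0 `|` Z).
  apply: closedU => //; apply: compact_closed; [exact: norm_hausdorff|exact: corb].
have dis : orb X1 `&` (orb X0 `|` Z) = set0.
  rewrite -subset0 => y [[[[p1 t1] s1] [[/= Xp1 It1] Is1] E1] [|]].
    move=> [[[p0 t0] s0] [[/= Xp0 It0] Is0] E0].
    by apply: (disj p0 t0 s0 p1 t1 s1) => //; rewrite E0 E1.
  rewrite -E1 /Z /= => /eqP; apply/negP; apply: orbit_circle_neq0 => //.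
  exact/K_core/X1K.
have [u [su u01 [B uB] [V1 [oV1 O1s O1u]] [V0 [oV0 O0s O0u]]]] :=
  smooth_urysohn (corb _ X1_compact) clC dis.
have bu : bounded_smooth (u \o strip_emb) by exact/strip_bounded_smooth/(strip_fun_comp su uB).
have [d0 d00 hd0] := compact_ball_sub (corb _ X0_compact) oV0 (fun y h => O0s y (or_introl h)).
have [d1 d10 hd1] := compact_ball_sub (corb _ X1_compact) oV1 O1s.
have [Ke [Ke0 KeP]] := euler_cvg WB T'0.
have v01 z : 0 <= (u \o strip_emb) z <= 1 by exact: u01.
have [Kd [Kd0 KdP]] := derive_euler_mean WB T'0 bu v01.
pose Lp : R := 1 + 2 * pi.
have Lp0 : 0 < Lp by rewrite /Lp ltr_pwDl// mulr_ge0// pi_ge0.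
(* [m] is so large that the derivative exceeds 1 / T' by at most eps and that the Euler iterates,
   after [strip_emb], stay within d0 or d1 of the exact orbits, where [u] is 0 or 1. *)
have [m m0 [m1 m2 m3]] : exists2 m : nat, (0 < m)%N &
   [/\ Kd * (T' / m%:R) <= eps, Lp * (Ke * (T' / m%:R)) < d0 & Lp * (Ke * (T' / m%:R)) < d1].
  pose A := T' * (Kd / eps + Lp * Ke / d0 + Lp * Ke / d1).
  have a1 : 0 < Kd / eps by rewrite divr_gt0.
  have a2 : 0 < Lp * Ke / d0 by rewrite divr_gt0// mulr_gt0.
  have a3 : 0 < Lp * Ke / d1 by rewrite divr_gt0// mulr_gt0.
  have [m Am] : exists m : nat, A < m%:R by exists (Num.trunc A).+1; exact: truncnS_gt.
  have A0 : 0 < A by rewrite mulr_gt0// !addr_gt0.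
  have m0 : 0 < m%:R :> R by exact: lt_trans Am.
  exists m; first by rewrite -(ltr0n R).
  have key c b : 0 < b -> T' * (c / b) <= A -> c * (T' / m%:R) < b.
    move=> b0 /le_lt_trans/(_ Am) h; rewrite mulrA ltr_pdivrMr//.
    by move: h; rewrite mulrA ltr_pdivrMr// mulrC [b * _]mulrC.
  split; first apply: ltW; rewrite ?[Lp * (_ * _)]mulrA; apply: key => //;
    rewrite /A ler_wpM2l ?(ltW T'0)//; lra.
exists (euler_mean W (u \o strip_emb) T' m).
have near_orb (X : set M) p t k : (k <= m)%N -> X p -> 0 <= t <= 1 ->
    exists2 y, orb X y & `|strip_emb (iter k (euler W (T' / m%:R)) (row_mx (emb p) (const_mx t))) - y| <= Lp * (Ke * (T' / m%:R)).
  move=> km Xp It.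
  pose x := ginv t p; pose z := zcurve (fun t => g t x).
  have zt : z t = row_mx (emb p) (const_mx t) by rewrite /z /zcurve /x ginvK.
  exists (strip_emb (z (t + k%:R * (T' / m%:R)))).
    exists (p, t, k%:R * (T' / m%:R)) => //; split => //=.
    rewrite mulr_ge0 ?divr_ge0 ?(ltW T'0)//= mulrCA ler_piMr ?(ltW T'0)//.
    by rewrite ler_pdivrMr ?mul1r ?ler_nat// ltr0n.
  apply: le_trans (strip_emb_lip _ _) _; rewrite ler_wpM2l ?(ltW Lp0)//.
  rewrite -zt; apply: KeP => //; exact: g_solution.
have per z : euler_mean W (u \o strip_emb) T' m (z + tvec) = euler_mean W (u \o strip_emb) T' m z.
  rewrite /euler_mean; congr (_ * _); apply: eq_bigr => k _.
  by rewrite euler_iter_shift /= strip_embD.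
(* The swept sets only start at times in [0, 1], so [t] is first replaced by its fractional part. *)
have val c (O : set 'rV[R]_(emb_dim (M := M) n + 2)) X : (forall y, O y -> u y = c) ->
    (forall p t k, (k <= m)%N -> X p -> 0 <= t <= 1 ->
      O (strip_emb (iter k (euler W (T' / m%:R)) (row_mx (emb p) (const_mx t))))) ->
    forall x t, X x -> euler_mean W (u \o strip_emb) T' m (row_mx (emb x) (const_mx t)) = c.
  move=> Oc near x t Xx.
  have -> : row_mx (emb x) (const_mx t) =
     row_mx (emb x) (const_mx (t - (Num.floor t)%:~R)) + (Num.floor t)%:~R *: tvec :> 'rV[R]_(emb_dim (M := M) n + 1).
    rewrite /tvec scale_row_mx add_row_mx scaler0 addr0; congr row_mx.
    by apply/rowP => i; rewrite !mxE mulr1 subrK.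
  rewrite periodicZ// /euler_mean.
  have It : 0 <= t - (Num.floor t)%:~R <= 1.
    have /andP[a b] := floor_itv t; rewrite subr_ge0 a /= lerBlDl ltW//.
    by move: b; rewrite intrD.
  rewrite (eq_bigr (fun=> c)); last by move=> k _; apply: Oc; apply: near => //; exact: ltnW.
  by rewrite sumr_const card_ord -[c *+ m]mulr_natl mulrA mulVf ?mul1r// pnatr_eq0 -lt0n.
split.
- by apply: smooth_euler_mean => //; case: bu.
- exact: per.
- move=> z z0; rewrite /euler_mean big1 ?mulr0// => k _ /=; apply: O0u; apply: O0s; right.
  by rewrite /Z /= /strip_emb row_mxKl euler_iter0.
- move=> x t; split => Xx.
    apply: (val 0 V0 X0) => // p t' k km Xp It.
    have [y oy hy] := near_orb X0 p t' k km Xp It.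
    by apply: (hd0 y oy); exact: le_lt_trans hy m2.
  apply: (val 1 V1 X1) => // p t' k km Xp It.
  have [y oy hy] := near_orb X1 p t' k km Xp It.
  by apply: (hd1 y oy); exact: le_lt_trans hy m3.
- move=> z; apply: le_trans (KdP m m0 z) _; by rewrite lerD2l.
Qed.

End flow.

(** * The Poisson bracket on the stabilization *)

Lemma coordinate_ball_cover {R : realType} {N : mfd_data R} (mN : is_manifold N) (K : set N) :
  compact K -> exists n (ic : 'I_n -> cidx N) (cc : 'I_n -> 'rV[R]_(mdim N)) (rr : 'I_n -> R),
  [/\ forall a, 0 < rr a,
      forall a v, `|v - cc a| <= 4 * rr a -> cim (atlas N (ic a)) v &
      forall x, K x -> exists a, cdom (atlas N (ic a)) x /\
        `|cmap (atlas N (ic a)) x - cc a| <= rr a / 2].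
Proof.
move=> cK.
pose ctr x := cmap (atlas N (at_pt N x)) x.
have /choice[r rP] : forall x, exists r, 0 < r /\
    forall v, `|v - ctr x| <= 4 * r -> cim (atlas N (at_pt N x)) v.
  move=> x; have dx := mfd_at_pt mN x.
  have [r r0 rP] := nbhs_ball_le (open_nbhs_nbhs (conj (@mfd_im_open _ _ mN _) (cim_cmap dx))).
  exists (r / 4); split; first by rewrite divr_gt0.
  by move=> v; rewrite mulrC divfK// => /rP.
have [|s [sK cov]] := @compact_seq_cover _ K (fun x => [set y | cdom (atlas N (at_pt N x)) y /\
    `|cmap (atlas N (at_pt N x)) y - ctr x| <= r x / 2]) cK.
  move=> x Kx; have dx := mfd_at_pt mN x; have [r0 _] := rP x.
  have h1 := open_nbhs_nbhs (conj (@mfd_dom_open _ _ mN (at_pt N x)) dx).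
  have r20 : 0 < r x / 2 by rewrite divr_gt0.
  have h2 : \forall y \near x, `|cmap (atlas N (at_pt N x)) y - ctr x| <= r x / 2.
    have /cvgrPdist_le/(_ _ r20) := @mfd_map_cont _ _ mN _ x dx.
    by apply: filterS => y; rewrite distrC.
  exact: filterI h1 h2.
exists (size s), (fun a => at_pt N (tnth (in_tuple s) a)),
  (fun a => ctr (tnth (in_tuple s) a)), (fun a => r (tnth (in_tuple s) a)).
split=> [a|a|x /cov[y ys [dy yx]]]; [exact: (rP _).1|exact: (rP _).2|].
have ys' : y \in in_tuple s by [].
by have /tnthP[a ya] := ys'; exists a; rewrite -ya.
Qed.

Lemma manifold_cutoff {R : realType} {M : symp_data R} (sM : is_symplectic_manifold M) (K : set M) :
  compact K -> exists chi : M -> R,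
  [/\ smooth_fun chi, forall x, 0 <= chi x,
      exists S : set M, compact S /\ forall x, ~ S x -> chi x = 0 &
      exists O : set M, [/\ open O, K `<=` O & forall x, O x -> chi x = 1] ].
Proof.
move=> cK; have mM := symp_manifold sM.
have [n [ic [cc [rr [rr0 rr_cim core]]]]] := coordinate_ball_cover mM cK.
pose b := bump_at ic cc rr.
have b01 a x : 0 <= 1 - b a x <= 1.
  by rewrite subr_ge0 bump_at_le1 lerBlDr lerDl bump_at_ge0.
exists (fun x => 1 - \prod_a (1 - b a x)); split.
- move=> i; have oI := @mfd_im_open _ _ mM i.
  apply: smooth_sub => //; first exact: smooth_cst.
  apply: smooth_prod => // a _; apply: smooth_sub => //; first exact: smooth_cst.
  exact: (smooth_bump_at sM rr0 rr_cim).
- by move=> x; rewrite subr_ge0; apply: prodr_ile1 => a _; exact: b01.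
- exists (emb_supp ic cc rr); split; first exact: (emb_supp_compact sM rr_cim).
  move=> x nx; rewrite big1 ?subrr// => a _.
  have e0 := emb_out sM rr0 nx.
  by rewrite /b -(scal_emb ic cc rr a x) e0 /scal_of mxE subr0.
- exists (\bigcup_(a in setT) [set x | cdom (atlas M (ic a)) x /\
    [set v | `|v - cc a| < rr a] (cmap (atlas M (ic a)) x)]); split.
  + apply: bigcup_open => a _; rewrite openE => x [dx xa].
    have h1 := open_nbhs_nbhs (conj (@mfd_dom_open _ _ mM (ic a)) dx).
    have h2 : \forall y \near x, [set v | `|v - cc a| < rr a] (cmap (atlas M (ic a)) y).
      exact: (@mfd_map_cont _ _ mM _ x dx _ (open_nbhs_nbhs (conj (@open_ball_rV R _ (cc a) (rr a)) xa))).
    exact: filterI h1 h2.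
  + move=> x /core[a [dx xa]]; exists a => //; split => //=.
    by rewrite (le_lt_trans xa)// ltr_pdivrMr// ltr_pMr// ltr1n.
  + move=> x [a _ [dx /= xa]]; rewrite (bigD1 a)//= /b bump_at_1 ?subrr ?mul0r ?subr0//.
    exact: ltW.
Qed.

(** By skew-symmetry and the defining equation of sgrad. In this form the bracket with [H] is a
    derivative along sgrad H. *)
Lemma poissonE {R : realType} (N : symp_data R) (F H : N -> R) (z : N) :
  let i := at_pt N z in
  symp_form N i z \in unitmx -> (symp_form N i z)^T = - symp_form N i z ->
  poisson F H z = (differential i F z *m (sgrad i H z)^T) 0 0.
Proof.
move=> i u sk; rewrite /poisson -/i.
have E : sgrad i F z *m symp_form N i z *m (sgrad i H z)^T = - (differential i F z *m (sgrad i H z)^T).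
  by have [h _] := @sgradP _ N i F z (sgrad i F z) u; exact: h.
have -> : sgrad i H z *m symp_form N i z *m (sgrad i F z)^T =
    (- (sgrad i F z *m symp_form N i z *m (sgrad i H z)^T))^T.
  move: (sgrad i H z) (sgrad i F z) (symp_form N i z) sk => a b S sk.
  by rewrite linearN /= !trmx_mul trmxK sk mulNmx mulmxN opprK mulmxA.
by rewrite E opprK mxE.
Qed.

Lemma derive_row_mx {R : realType} {V : normedModType R} {a b} (f : V -> 'rV[R]_a)
  (g : V -> 'rV[R]_b) x v : differentiable f x -> differentiable g x ->
  differentiable (fun x => row_mx (f x) (g x)) x /\
  'D_v (fun x => row_mx (f x) (g x)) x = row_mx ('D_v f x) ('D_v g x).
Proof.
move=> ff gg.
have fl i k : (fun t => row_mx (f t) (g t) i (lshift b k)) = (fun t => f t i k).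
  by apply/funext => s; rewrite row_mxEl.
have fr i k : (fun t => row_mx (f t) (g t) i (rshift a k)) = (fun t => g t i k).
  by apply/funext => s; rewrite row_mxEr.
have dd : differentiable (fun t => row_mx (f t) (g t)) x.
  apply/differentiable_coords => i j; case: (split_ordP j) => k ->.
    by rewrite fl; exact: (differentiable_coords f x).2.
  by rewrite fr; exact: (differentiable_coords g x).2.
split=> //; apply/matrixP => i j; rewrite -(derive_coord _ i j dd).
by case: (split_ordP j) => k ->; rewrite ?row_mxEl ?row_mxEr ?fl ?fr derive_coord.
Qed.

Lemma circle_repr_itv {R : realType} (c : circle R) :
  exists2 t : R, `[0, 1]%classic t & to_circle t = c.
Proof.
pose t0 := circle_repr c; exists (t0 - (Num.floor t0)%:~R).
  have /andP[a b] := floor_itv t0; rewrite /= in_itv/= subr_ge0 a /= lerBlDl ltW//.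
  by move: b; rewrite intrD.
rewrite -[RHS]circle_reprK; apply/to_circle_eq.
by rewrite opprB addrC subrK intr_int.
Qed.

(** * Functions on the product with the annulus *)

Section annulus_product.
Context {R : realType} {M : symp_data R}.
Hypothesis sM : is_symplectic_manifold M.
Let mM := symp_manifold sM.
Let d := mdim M.
Variable rho : \bar R.
Hypothesis rho0 : (0%:E < rho)%E.

Local Notation A := (annulus rho).
Local Notation N := (prod_symp M A).

Definition radius_of (v : 'rV[R]_(d + (1 + 1))) : R := lsubmx (rsubmx v) 0 0.
Definition angle_of (v : 'rV[R]_(d + (1 + 1))) : R := rsubmx (rsubmx v) 0 0.

(* Functions on [M * A_rho] are given by functions on the whole of [M * T^*S^1]. *)
Definition on_annulus (phi : M * (R * circle R) -> R) (z : N) : R := phi (z.1, val z.2).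

Definition lift_annulus (i : cidx M) (phi : M * (R * circle R) -> R) (v : 'rV[R]_(d + (1 + 1))) : R :=
  phi (cinv (atlas M i) (lsubmx v), (radius_of v, to_circle (angle_of v))).

Definition annulus_dom (i : cidx M) : set 'rV[R]_(d + (1 + 1)) :=
  [set v | cim (atlas M i) (lsubmx v)].

Lemma open_annulus_dom i : open (annulus_dom i).
Proof. by apply: open_lsubmx; exact: (@mfd_im_open _ _ mM i). Qed.

Lemma radius_cont : continuous radius_of.
Proof.
have -> : radius_of = (fun v : 'rV[R]_(d + (1 + 1)) => v 0 (rshift d (lshift 1 0))).
  by apply/funext => v; rewrite /radius_of !mxE.
exact: coord_continuous.
Qed.

Lemma open_radius : open [set v | (`|radius_of v|%:E < rho)%E].
Proof.
have oE : open [set r : R | (`|r|%:E < rho)%E].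
  case: rho rho0 => [c c0| _|//]; last first.
    by rewrite (_ : [set _ | _] = setT); [exact: openT|apply/seteqP; split => // r _; exact: ltry].
  have -> : [set r : R | (`|r|%:E < c%:E)%E] = (fun r : R => `|r|) @^-1` [set x | x < c].
    by apply/seteqP; split => r /=; rewrite lte_fin.
  by apply: open_comp; [move=> r _; exact: norm_continuous|exact: open_lt].
by apply: (@open_comp _ _ radius_of _ _ oE) => v _; exact: radius_cont.
Qed.

Lemma annulus_cinv (i : cidx N) v phi : (`|radius_of v|%:E < rho)%E ->
  on_annulus phi (cinv (atlas N i) v) = lift_annulus i.1 phi v.
Proof.
move=> rv; rewrite /on_annulus /lift_annulus /=; congr (phi (_, _)).
by rewrite insubdK// inE.
Qed.

Lemma annulus_cim (i : cidx N) v : cim (atlas N i) v ->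
  annulus_dom i.1 v /\ (`|radius_of v|%:E < rho)%E.
Proof.
move=> [[x w] [/= dx dw] <-]; split.
  by rewrite /annulus_dom /= row_mxKl; exact: cim_cmap.
rewrite /radius_of /= row_mxKr /= row_mxKl mxE.
by have := valP w; rewrite inE.
Qed.

Lemma near_annulus_cinv (i : cidx N) v phi : cim (atlas N i) v ->
  \forall w \near v, on_annulus phi (cinv (atlas N i) w) = lift_annulus i.1 phi w.
Proof.
move=> /annulus_cim[_ rv].
by apply: filterS (open_nbhs_nbhs (conj open_radius rv)) => w; exact: annulus_cinv.
Qed.

Lemma smooth_on_annulus phi :
  (forall i, smooth_on (annulus_dom i) (lift_annulus i phi)) ->
  smooth_fun (N := N) (on_annulus phi).
Proof.
move=> sphi i.
have oU : open (annulus_dom i.1 `&` [set v | (`|radius_of v|%:E < rho)%E]).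
  by apply: openI; [exact: open_annulus_dom|exact: open_radius].
apply: (@smooth_on_sub _ _ _ _ (annulus_dom i.1 `&` [set v | (`|radius_of v|%:E < rho)%E])).
  by move=> v /annulus_cim.
apply: (smooth_on_ext oU (f := lift_annulus i.1 phi)).
  by move=> v [_ rv]; rewrite /= annulus_cinv.
by apply: smooth_on_sub (sphi i.1) => v [].
Qed.

(** The support lies in the closed set [C], and [C] in a continuous image of the compact product of
    [K], [-r, r] and [0, 1]. Radii are clamped to [-r, r] to make the parametrization a total map
    into the annulus. *)
Lemma compact_on_annulus phi (K : set M) (r : R) : compact K -> 0 <= r -> (r%:E < rho)%E ->
  (forall x s c, ~ K x \/ r < `|s| -> phi (x, (s, c)) = 0) ->
  compact (closure [set z : N | on_annulus phi z != 0]).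
Proof.
move=> cK r0 rr phi0.
pose clamp (s : R) := Num.max (- r) (Num.min r s).
have clamp_le s : `|clamp s| <= r.
  rewrite ler_norml /clamp le_max lexx /= ge_max lerNl (le_trans _ r0) ?oppr_le0//=.
  by rewrite ge_min lexx.
have clamp_id s : `|s| <= r -> clamp s = s.
  by rewrite ler_norml /clamp => /andP[a b]; rewrite (min_idPr b) (max_idPr a).
pose U : set (cotangent_circle R) := [set z | (`|z.1 : R|%:E < rho)%E].
have inU (w : R * R) : (clamp w.1, to_circle w.2) \in U.
  by rewrite inE /U /= (le_lt_trans _ rr)// lee_fin.
pose iota (w : R * R) : set_type U := exist _ (clamp w.1, to_circle w.2) (inU w).
have ciota : continuous iota.
  apply: continuous_comp_initial => w.
  apply: (continuous_pair_at (f := fun w : R * R => clamp w.1) (g := fun w : R * R => to_circle w.2)).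
    apply: (@continuous_comp _ _ _ (fst : R * R -> R) clamp); first exact: cvg_fst.
    apply: (@continuous_max _ _ (cst (- r)) (fun s => Num.min r s)); first exact: cst_continuous.
    by apply: (@continuous_min _ _ (cst r) id); [exact: cst_continuous|exact: cvg_id].
  apply: (@continuous_comp _ _ _ (snd : R * R -> R) to_circle); first exact: cvg_snd.
  exact: to_circle_continuous.
pose j (w : M * (R * R)) : N := (w.1, iota w.2).
have cj : continuous j.
  move=> w; apply: (continuous_pair_at (f := fun w : M * (R * R) => w.1) (g := fun w : M * (R * R) => iota w.2)).
    exact: cvg_fst.
  apply: (@continuous_comp _ _ _ (snd : M * (R * R) -> R * R) iota); first exact: cvg_snd.
  exact: ciota.
pose D := j @` (K `*` ([set s | `|s| <= r] `*` `[0, 1]%classic)).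
have cD : compact D.
  apply: continuous_compact; first exact: continuous_subspaceT.
  apply: compact_setX => //; apply: compact_setX.
    have -> : [set s : R | `|s| <= r] = `[- r, r]%classic.
      by apply/seteqP; split => s; rewrite /= in_itv/= ler_norml.
    exact: segment_compact.
  exact: segment_compact.
pose C := [set z : N | K z.1 /\ `|(val z.2).1 : R| <= r].
have clK : closed K by apply: compact_closed => //; exact: mfd_hausdorff mM.
have clC : closed C.
  have -> : C = (fst : N -> M) @^-1` K `&`
      (fun z : N => `|(val z.2).1 : R|) @^-1` [set s | s <= r] by [].
  apply: closedI.
    by apply: (preimage_closed _ clK) => z _; exact: cvg_fst.
  apply: preimage_closed; last exact: closed_le.
  move=> z _.
  have c1 : {for z, continuous (fun z : N => (val z.2).1 : R)}.
    apply: (@continuous_comp _ _ _ (fun z : N => val z.2) (fst : R * circle R -> R)); last exact: cvg_fst.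
    apply: (@continuous_comp _ _ _ (snd : N -> set_type U) val); first exact: cvg_snd.
    exact: initial_continuous.
  exact: (continuous_comp c1 (@norm_continuous _ _ _)).
apply: (@subclosed_compact _ _ D); [exact: closed_closure|exact: cD|].
apply: (@subset_trans _ C).
  apply: (@subset_trans _ (closure C)); last by rewrite -((closure_id C).1 clC).
  apply: closure_subset => z /= pz.
  split.
    by apply: contrapT => nK; move/eqP: pz; apply; rewrite /on_annulus; case: (val z.2) => s c; apply: phi0; left.
  rewrite leNgt; apply/negP => rs; move/eqP: pz; apply; rewrite /on_annulus.
  by move: rs; case: (val z.2) => s c /= rs; apply: phi0; right.
move=> [x w] [/= Kx ws].
have [t It Et] := circle_repr_itv (val w).2.
exists (x, ((val w).1, t)); first by split.
congr (_, _); apply/val_inj; rewrite /= clamp_id// Et.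
by rewrite [RHS]surjective_pairing.
Qed.

End annulus_product.

(** Conservation of energy: a skew form vanishes on a pair of equal vectors. *)
Lemma differential_sgrad {R : realType} (N : symp_data R) (i : cidx N) (H : N -> R) (z : N) :
  symp_form N i z \in unitmx -> (symp_form N i z)^T = - symp_form N i z ->
  (differential i H z *m (sgrad i H z)^T) 0 0 = 0.
Proof.
move=> u sk.
have [h _] := @sgradP _ N i H z (sgrad i H z) u.
have {h} E := h erefl (sgrad i H z).
have E2 : (sgrad i H z *m symp_form N i z *m (sgrad i H z)^T)^T =
    - (sgrad i H z *m symp_form N i z *m (sgrad i H z)^T).
  move: (sgrad i H z) (symp_form N i z) sk => a S sk.
  by rewrite !trmx_mul trmxK sk mulNmx mulmxN mulmxA.
have := congr1 (fun m : 'M[R]_1 => m 0 0) E2; rewrite E mxE [X in X = _]mxE [X in _ = X]mxE.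
rewrite [X in _ = - X]mxE; move: ((_ *m _) 0 0) => c; lra.
Qed.

Lemma half_not_int {R : realType} : (2^-1 : R) \isn't a Num.int.
Proof.
apply/negP => /intrP[m Em].
have : (m * 2)%:~R = 1%:~R :> R by rewrite intrM -Em mulVf.
by move=> /intr_inj; lia.
Qed.

Lemma circle_at_pt {R : realType} (c : circle R) : cdom (atlas (circle_mfd R) (at_pt (circle_mfd R) c)) c.
Proof.
rewrite /= -[X in X <> _]circle_reprK => /to_circle_eq.
by rewrite addrAC subrr add0r rpredN; exact/negP/half_not_int.
Qed.

(** * The bracket of the cut-off integral with the energy *)

Section annulus_poisson.
Context {R : realType} {M : symp_data R}.
Hypothesis sM : is_symplectic_manifold M.
Let mM := symp_manifold sM.
Let d := mdim M.
Variable rho : \bar R.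
Lemma annulus_at_pt (z : prod_symp M (annulus rho)) : cdom (atlas (prod_symp M (annulus rho)) (at_pt (prod_symp M (annulus rho)) z)) z.
Proof. by split; [exact: mfd_at_pt mM z.1|split => //; exact: circle_at_pt]. Qed.

Hypothesis rho0 : (0%:E < rho)%E.

Local Notation A := (annulus rho).
Local Notation N := (prod_symp M A).

Lemma annulus_form_unit (i : cidx N) (z : N) : cdom (atlas M i.1) z.1 ->
  symp_form N i z \in unitmx.
Proof.
move=> dx; have u := symp_nondegenerate sM dx.
have E : symp_form N i z *m block_mx (invmx (symp_form M i.1 z.1)) 0 0
    (block_mx 0 (- 1%:M) 1%:M 0 : 'M[R]_(1 + 1)) = 1%:M.
  rewrite mulmx_block !mul0mx !mulmx0 addr0 !add0r mulmxV// mulmx_block.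
  rewrite !mul0mx !mulmx0 !mul1mx !mulNmx !mulmxN !mul1mx opprK !addr0 !add0r.
  by rewrite -!scalar_mx_block.
exact: (mulmx1_unit E).1.
Qed.

Lemma annulus_form_skew (i : cidx N) (z : N) : cdom (atlas M i.1) z.1 ->
  (symp_form N i z)^T = - symp_form N i z.
Proof.
move=> dx; have s := symp_skew sM dx.
rewrite /= !tr_block_mx !trmx0 s linearN /= trmx1 !opp_block_mx !oppr0 opprK.
by [].
Qed.

Definition flat_coord (v : 'rV[R]_(d + (1 + 1))) : 'rV[R]_(d + 1) :=
  row_mx (lsubmx v) (rsubmx (rsubmx v)).

Lemma flat_coord_diff v : differentiable flat_coord v /\
  forall w, 'D_w flat_coord v = flat_coord w.
Proof.
have dl : differentiable (lsubmx : 'rV[R]_(d + (1 + 1)) -> 'rV[R]_d) v by exact: differentiable_lsubmx.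
have dr : differentiable (fun v : 'rV[R]_(d + (1 + 1)) => rsubmx (rsubmx v)) v.
  apply: (@differentiable_comp _ _ _ _ (rsubmx : 'rV[R]_(d + (1 + 1)) -> 'rV[R]_(1 + 1)) rsubmx).
    exact: differentiable_rsubmx.
  exact: differentiable_rsubmx.
split; first by have [] := derive_row_mx 0 dl dr.
move=> w; have [_ ->] := derive_row_mx w dl dr; congr row_mx.
  by rewrite deriveE// diff_lin//; exact: continuous_lsubmx.
rewrite (derive_comp (g := (rsubmx : 'rV[R]_(d + (1 + 1)) -> 'rV[R]_(1 + 1))) w); last 2 first.
- exact: differentiable_rsubmx.
- exact: differentiable_rsubmx.
rewrite deriveE; last exact: differentiable_rsubmx.
rewrite deriveE; last exact: differentiable_rsubmx.
by rewrite diff_lin ?diff_lin//; exact: continuous_rsubmx.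
Qed.

Lemma radius_diff v : differentiable (@radius_of R M) v /\
  forall w, 'D_w (@radius_of R M) v = radius_of w.
Proof.
have -> : @radius_of R M = (fun v : 'rV[R]_(d + (1 + 1)) => v 0 (rshift d (lshift 1 0))).
  by apply/funext => y; rewrite /radius_of !mxE.
split; first exact: differentiable_coord.
move=> w; rewrite (derive_coord w 0 (rshift d (lshift 1 0)) (g := idfun)) ?derive_id//.
Qed.

Lemma smooth_radius U : smooth_on U (@radius_of R M).
Proof.
rewrite (_ : @radius_of R M = (fun v => v 0 (rshift d (lshift 1 0)))).
  exact: smooth_coordf.
by apply/funext => y; rewrite /radius_of !mxE.
Qed.

Variable G : M * circle R -> R.
Hypothesis sG : smooth_fun (N := prod_mfd M (circle_mfd R)) G.

Definition energy (w : M * (R * circle R)) : R := w.2.1 + G (w.1, w.2.2).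

Lemma lift_energy i v : lift_annulus i energy v = radius_of v + lift_fun i G (flat_coord v).
Proof. by rewrite /lift_annulus /energy /lift_fun /flat_coord /= row_mxKl /tcoord row_mxKr. Qed.

Lemma lift_energy_diff i v : annulus_dom i v ->
  differentiable (lift_fun i G) (flat_coord v) /\
  differentiable (lift_annulus i energy) v /\ forall w,
   'D_w (lift_annulus i energy) v = radius_of w + 'D_(flat_coord w) (lift_fun i G) (flat_coord v).
Proof.
move=> iv.
have dG : differentiable (lift_fun i G) (flat_coord v).
  apply: (smooth_on_diff (@smooth_lift _ _ _ sG i)).
  by rewrite /lift_dom /= /flat_coord row_mxKl.
have [df Df] := flat_coord_diff v; have [dr Dr] := radius_diff v.
have dc : differentiable (lift_fun i G \o flat_coord) v by exact: differentiable_comp.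
have -> : lift_annulus i energy = @radius_of R M + (lift_fun i G \o flat_coord).
  by apply/funext => y; rewrite lift_energy.
split => //; split; first exact: differentiableD.
move=> w; rewrite deriveD; [|exact: diff_derivable|exact: diff_derivable].
by rewrite Dr (derive_comp _ df dG) Df.
Qed.

Lemma smooth_flat_coord U : smoothV U flat_coord.
Proof.
apply: smoothV_row_mx; first exact: smoothV_lsubmx.
move=> k; rewrite (_ : (fun y => _) = (fun v : 'rV[R]_(d + (1 + 1)) => v 0 (rshift d (rshift 1 k)))).
  exact: smooth_coordf.
by apply/funext => v; rewrite !mxE.
Qed.

Lemma smooth_lift_energy i : smooth_on (annulus_dom i) (lift_annulus i energy).
Proof.
have oU := @open_annulus_dom _ _ sM i.
apply: (smooth_on_ext oU (f := fun v => radius_of v + (lift_fun i G \o flat_coord) v)).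
  by move=> v _; rewrite lift_energy.
apply: smooth_add => //.
  exact: smooth_radius.
apply: (@smooth_comp _ _ _ _ (lift_dom i) flat_coord) => //.
- by move=> v iv; rewrite /lift_dom /= /flat_coord row_mxKl.
- exact: smooth_flat_coord.
- exact: smooth_lift.
Qed.

(** As the energy is r + G, the angular component is 1: without its radial part the vector is d/dt +
    sgrad G_t on M * S^1. The radial component, minus the angular derivative of G, keeps the energy
    constant. *)
Lemma sgrad_energy (i : cidx N) (z : N) (H : N -> R) :
  cdom (atlas N i) z -> let v := cmap (atlas N i) z in
  (\forall y \near v, H (cinv (atlas N i) y) = lift_annulus i.1 energy y) ->
  sgrad i H z = row_mx (sgrad i.1 (Gt G (angle_of v)) z.1)
    (row_mx (const_mx (- 'D_(row_mx 0 (const_mx 1)) (lift_fun i.1 G) (flat_coord v))) (const_mx 1)).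
Proof.
move=> iz v HE.
have dx : cdom (atlas M i.1) z.1 by case: iz.
have xv : lsubmx v = cmap (atlas M i.1) z.1 by rewrite /v /= row_mxKl.
have iv : annulus_dom i.1 v by rewrite /annulus_dom /= xv; exact: cim_cmap.
have [dG [dE DE]] := lift_energy_diff iv.
set Ds := 'D_(row_mx 0 _) _ _.
apply/esym; apply/(@sgradP _ N i H z _ (annulus_form_unit dx)) => w.
have dH : differentiable (H \o cinv (atlas N i)) v.
  by apply: near_eq_differentiable dE; apply: filterS HE => y hy; exact: esym hy.
have wE : w = row_mx (lsubmx w) (row_mx (lsubmx (rsubmx w)) (rsubmx (rsubmx w))) by rewrite !hsubmxK.
have lhs : (differential i H z *m w^T) 0 0 = radius_of w +
   ((differential i.1 (Gt G (angle_of v)) z.1 *m (lsubmx w)^T) 0 0 + Ds * angle_of w).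
  rewrite differentialE//.
  rewrite (near_eq_derive (g := lift_annulus i.1 energy)) // DE; congr (_ + _).
  have -> : flat_coord w = row_mx (lsubmx w) 0 + (angle_of w) *: row_mx 0 (const_mx 1).
    rewrite /flat_coord scale_row_mx add_row_mx scaler0 addr0 add0r; congr row_mx.
    by apply/rowP => k; rewrite !mxE mulr1 /angle_of !mxE ord1.
  rewrite deriveE// linearD linearZ /= -!deriveE//; congr (_ + _); last by rewrite mulrC.
  have dGt : differentiable (Gt G (angle_of v) \o cinv (atlas M i.1)) (cmap (atlas M i.1) z.1).
    exact: (smooth_on_diff (@smooth_slice _ _ mM _ (to_circle (angle_of v)) sG i.1) (cim_cmap dx)).
  rewrite differentialE//.
  have -> : Gt G (angle_of v) \o cinv (atlas M i.1) = (fun y => lift_fun i.1 G (row_mx y (rsubmx (rsubmx v)))).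
    by apply/funext => y; rewrite /Gt /lift_fun /= row_mxKl /tcoord row_mxKr.
  by rewrite derive_row_l -xv.
have gr : sgrad i.1 (Gt G (angle_of v)) z.1 *m symp_form M i.1 z.1 *m (lsubmx w)^T =
    - (differential i.1 (Gt G (angle_of v)) z.1 *m (lsubmx w)^T).
  by have [h _] := @sgradP _ M i.1 (Gt G (angle_of v)) z.1 (sgrad i.1 (Gt G (angle_of v)) z.1) (symp_nondegenerate sM dx); exact: h.
apply/matrixP => k l; rewrite !ord1 [RHS]mxE lhs.
rewrite /= {1}wE mul_row_block !mulmx0 addr0 add0r mul_row_block !mulmx0 mulmxN !mulmx1 add0r addr0.
rewrite !tr_row_mx mul_row_col gr mul_row_col.
move: (differential i.1 _ _ *m _) => m1.
rewrite !mxE !big_ord1 !mxE /radius_of /angle_of !mxE; move: (m1 0 0) (Ds) => a b; ring.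
Qed.

Variables (q : nat) (h : M -> 'rV[R]_q) (Ft : 'rV[R]_(q + 1) -> R) (bb : R -> R) (C : R).
Hypothesis hdiff : forall i y, cim (atlas M i) y -> differentiable (h \o cinv (atlas M i)) y.
Hypothesis Fdiff : forall y, differentiable Ft y.
Hypothesis Fper : forall y (t : R),
  Ft (row_mx y (const_mx (circle_repr (to_circle t)))) = Ft (row_mx y (const_mx t)).
Hypothesis Fle : forall i x t, cdom (atlas M i) x ->
  `|'D_(row_mx ('D_(sgrad i (Gt G t) x) (h \o cinv (atlas M i)) (cmap (atlas M i) x)) (const_mx 1))
     Ft (row_mx (h x) (const_mx t))| <= C.
Hypothesis bdiff : forall s, differentiable bb s.
Hypothesis bb01 : forall s, 0 <= bb s <= 1.

(** [circle_repr] is a discontinuous choice of representative; [Fper] makes the value independent of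
    that choice. *)
Definition integral_cutoff (w : M * (R * circle R)) : R :=
  Ft (row_mx (h w.1) (const_mx (circle_repr w.2.2))) * bb (energy w).

Definition embed_coord i (v : 'rV[R]_(d + (1 + 1))) : 'rV[R]_(q + 1) :=
  row_mx (h (cinv (atlas M i) (lsubmx v))) (const_mx (angle_of v)).

Lemma lift_integral_cutoff i v :
  lift_annulus i integral_cutoff v = Ft (embed_coord i v) * bb (lift_annulus i energy v).
Proof. by rewrite /lift_annulus /integral_cutoff /= Fper. Qed.

Lemma embed_coord_diff i v : annulus_dom i v ->
  differentiable (embed_coord i) v /\ forall w, 'D_w (embed_coord i) v =
    row_mx ('D_(lsubmx w) (h \o cinv (atlas M i)) (lsubmx v)) (const_mx (angle_of w)).
Proof.
move=> iv.
have dl : differentiable (lsubmx : 'rV[R]_(d + (1 + 1)) -> 'rV[R]_d) v by exact: differentiable_lsubmx.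
have dc : differentiable ((h \o cinv (atlas M i)) \o (lsubmx : 'rV[R]_(d + (1 + 1)) -> 'rV[R]_d)) v.
  by apply: differentiable_comp => //; exact: hdiff.
have caE : (fun v : 'rV[R]_(d + (1 + 1)) => const_mx (angle_of v) : 'rV[R]_1) =
    (fun v => rsubmx (rsubmx v)).
  by apply/funext => y; apply/rowP => k; rewrite !mxE ord1 /angle_of !mxE.
have [dr Dr] : differentiable (fun v : 'rV[R]_(d + (1 + 1)) => rsubmx (rsubmx v)) v /\
    forall w, 'D_w (fun v : 'rV[R]_(d + (1 + 1)) => rsubmx (rsubmx v)) v = rsubmx (rsubmx w).
  have d1 : differentiable (rsubmx : 'rV[R]_(d + (1 + 1)) -> 'rV[R]_(1 + 1)) v by exact: differentiable_rsubmx.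
  have d2 : differentiable (rsubmx : 'rV[R]_(1 + 1) -> 'rV[R]_1) (rsubmx v) by exact: differentiable_rsubmx.
  split; first exact: differentiable_comp d1 d2.
  move=> w; rewrite (derive_comp (g := (rsubmx : 'rV[R]_(d + (1 + 1)) -> 'rV[R]_(1 + 1))) w d1 d2).
  by rewrite !deriveE// diff_lin ?diff_lin//; exact: continuous_rsubmx.
have E : embed_coord i = (fun v => row_mx (((h \o cinv (atlas M i)) \o lsubmx) v) (rsubmx (rsubmx v))).
  by apply/funext => y; rewrite /embed_coord -[rsubmx (rsubmx y)](congr1 (fun f => f y) caE).
rewrite E; split; first exact: (derive_row_mx 0 dc dr).1.
move=> w; rewrite (derive_row_mx w dc dr).2 Dr (derive_comp w dl); last exact: hdiff.
rewrite (deriveE _ dl) diff_lin; last exact: continuous_lsubmx.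
by rewrite -(congr1 (fun f => f w) caE).
Qed.

Lemma poisson_lift (z : N) (phi : M * (R * circle R) -> R) (H : N -> R) :
  let i := at_pt N z in let v := cmap (atlas N i) z in
  differentiable (lift_annulus i.1 phi) v ->
  poisson (N := N) (on_annulus phi) H z = 'D_(sgrad i H z) (lift_annulus i.1 phi) v.
Proof.
move=> i v dphi.
have iz : cdom (atlas N i) z by exact: annulus_at_pt.
have dx : cdom (atlas M i.1) z.1 by case: iz.
rewrite poissonE; [|exact: annulus_form_unit|exact: annulus_form_skew].
have nE := near_annulus_cinv rho0 phi (cim_cmap iz).
rewrite differentialE; last first.
  by apply: near_eq_differentiable dphi; apply: filterS nE => y hy; exact: esym hy.
exact: near_eq_derive.
Qed.

(* Near [z] the Hamiltonian is [energy], hence [sgrad H] kills [bb (energy)] and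
   only the derivative of [Ft] remains. *)
Lemma poisson_le (z : N) (H : N -> R) :
  let i := at_pt N z in let v := cmap (atlas N i) z in
  (\forall y \near v, H (cinv (atlas N i) y) = lift_annulus i.1 energy y) ->
  `|poisson (N := N) (on_annulus integral_cutoff) H z| <= C.
Proof.
move=> i v HE.
have iz : cdom (atlas N i) z by exact: annulus_at_pt.
have dx : cdom (atlas M i.1) z.1 by case: iz.
have [iv _] := annulus_cim (cim_cmap iz).
have [dG [dE DE]] := lift_energy_diff iv.
have [de De] := embed_coord_diff iv.
have d1 : differentiable (Ft \o embed_coord i.1) v by exact: differentiable_comp.
have d2 : differentiable (bb \o lift_annulus i.1 energy) v by exact: differentiable_comp.
have E : lift_annulus i.1 integral_cutoff =
    (Ft \o embed_coord i.1) * (bb \o lift_annulus i.1 energy).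
  by apply/funext => y; rewrite lift_integral_cutoff.
rewrite poisson_lift -/i -/v; last by rewrite E; exact: differentiableM.
set V := sgrad i H z.
have DH : 'D_V (lift_annulus i.1 energy) v = 0.
  have dH : differentiable (H \o cinv (atlas N i)) v.
    by apply: near_eq_differentiable dE; apply: filterS HE => y hy; exact: esym hy.
  rewrite -(differential_sgrad H (annulus_form_unit dx) (annulus_form_skew dx)) differentialE//.
  by apply: near_eq_derive; apply: filterS HE => y hy; exact: esym hy.
have D2 : 'D_V (bb \o lift_annulus i.1 energy) v = 0.
  by rewrite (derive_comp V dE (bdiff _)) DH deriveE// linear0.
have D1 : 'D_V (Ft \o embed_coord i.1) v = 
   'D_(row_mx ('D_(sgrad i.1 (Gt G (angle_of v)) z.1) (h \o cinv (atlas M i.1)) (cmap (atlas M i.1) z.1)) (const_mx 1))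
     Ft (row_mx (h z.1) (const_mx (angle_of v))).
  rewrite (derive_comp V de (Fdiff _)) De /V (sgrad_energy iz HE) 2!row_mxKl.
  have aE a (b : 'rV[R]_1) : angle_of (row_mx a (row_mx b (const_mx 1))) = 1.
    by rewrite /angle_of !row_mxKr mxE.
  rewrite aE.
  by rewrite /embed_coord /v /= row_mxKl (mfd_mapK mM dx).
rewrite E deriveM; [|exact: diff_derivable|exact: diff_derivable].
rewrite D2 scaler0 add0r D1 normrM; have /andP[b0 b1] := bb01 (lift_annulus i.1 energy v).
rewrite (ger0_norm b0) (le_trans _ (Fle (angle_of v) dx))//.
exact: ler_piMl.
Qed.

Lemma poisson_eq0 (z : N) (phi : M * (R * circle R) -> R) (H : N -> R) :
  let i := at_pt N z in let v := cmap (atlas N i) z in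
  (\forall y \near v, lift_annulus i.1 phi y = 0) ->
  poisson (N := N) (on_annulus phi) H z = 0.
Proof.
move=> i v E0.
have E : \forall y \near v, cst 0 y = lift_annulus i.1 phi y.
  by apply: filterS E0 => y hy; exact: esym hy.
rewrite poisson_lift; last exact: near_eq_differentiable E _.
by rewrite -(near_eq_derive _ E) derive_cst.
Qed.

End annulus_poisson.

(** * Boundedness of G and the contradiction *)

Lemma row_mx_continuous_at {R : realType} {T : topologicalType} {a b} (f : T -> 'rV[R]_a)
    (g : T -> 'rV[R]_b) x : {for x, continuous f} -> {for x, continuous g} ->
  {for x, continuous (fun y => row_mx (f y) (g y))}.
Proof.
move=> cf cg.
have did c (u : 'rV[R]_c) : differentiable id u by exact: ex_diff.
have dcst c1 c2 (u : 'rV[R]_c1) : differentiable (cst (0 : 'rV[R]_c2)) u by exact: ex_diff.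
have cl : continuous (fun u : 'rV[R]_a => row_mx u (0 : 'rV[R]_b)).
  move=> u; apply: differentiable_continuous.
  exact: (@derive_row_mx _ _ _ _ id (cst 0) u 0 (did _ u) (dcst _ _ u)).1.
have cr : continuous (fun u : 'rV[R]_b => row_mx (0 : 'rV[R]_a) u).
  move=> u; apply: differentiable_continuous.
  exact: (@derive_row_mx _ _ _ _ (cst 0) id u 0 (dcst _ _ u) (did _ u)).1.
have -> : (fun y => row_mx (f y) (g y)) = (fun y => row_mx (f y) 0 + row_mx 0 (g y)).
  by apply/funext => y; rewrite add_row_mx addr0 add0r.
exact: (cvgD (continuous_comp cf (cl _)) (continuous_comp cg (cr _))).
Qed.

Lemma continuous_on_cover {R : realType} {M : mfd_data R} (mM : is_manifold M) (G : M * circle R -> R) :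
  smooth_fun (N := prod_mfd M (circle_mfd R)) G ->
  continuous (fun w : M * R => G (w.1, to_circle w.2)).
Proof.
move=> sG w; pose i := at_pt M w.1.
have dx : cdom (atlas M i) w.1 := mfd_at_pt mM w.1.
pose f (w' : M * R) : 'rV[R]_(mdim M + 1) := row_mx (cmap (atlas M i) w'.1) (const_mx w'.2).
have dE : \forall w' \near w, cdom (atlas M i) w'.1.
  have c1 : {for w, continuous (fst : M * R -> M)} by exact: cvg_fst.
  exact: (c1 _ (open_nbhs_nbhs (conj (@mfd_dom_open _ _ mM i) dx))).
have E : \forall w' \near w, (lift_fun i G \o f) w' = G (w'.1, to_circle w'.2).
  by apply: filterS dE => w' dw; rewrite /= /lift_fun /f row_mxKl tcoord_row (mfd_mapK mM dw).
have cf : {for w, continuous f}.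
  apply: row_mx_continuous_at.
    by apply: (@continuous_comp _ _ _ fst); [exact: cvg_fst|exact: (@mfd_map_cont _ _ mM i _ dx)].
  apply: (@continuous_comp _ _ _ snd (const_mx : R -> 'rV[R]_1)); first exact: cvg_snd.
  apply: differentiable_continuous; apply/differentiable_coords => k l.
  by rewrite (_ : (fun _ => _) = id)//; apply/funext => y; rewrite mxE.
have cG : {for f w, continuous (lift_fun i G)}.
  apply: differentiable_continuous; apply: (smooth_on_diff (@smooth_lift _ _ _ sG i)).
  by rewrite /lift_dom /= /f row_mxKl; exact: cim_cmap.
have := continuous_comp cf cG; rewrite /continuous_at /= -(nbhs_singleton E) => cE.
by apply: cvg_trans cE; apply: near_eq_cvg; exact: E.
Qed.

Lemma smooth_fun_bounded {R : realType} {M : mfd_data R} (mM : is_manifold M) (G : M * circle R -> R) :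
  Cc_infty (N := prod_mfd M (circle_mfd R)) G ->
  has_ubound (range G) /\ has_lbound (range G).
Proof.
move=> [sG cG].
pose K1 : set M := fst @` closure [set w : prod_mfd M (circle_mfd R) | G w != 0].
pose f (w : M * R) := G (w.1, to_circle w.2).
pose I : set R := `[0, 1]%classic.
have cK : compact (K1 `*` I).
  apply: compact_setX; last exact: segment_compact.
  by apply: continuous_compact cG; apply: continuous_subspaceT => w; exact: cvg_fst.
have cf : compact (f @` (K1 `*` I)).
  by apply: continuous_compact cK; apply: continuous_subspaceT; exact: continuous_on_cover.
have [B [_ BP]] := compact_bounded cf.
have GB w : `|G w| <= `|B| + 1.
  have [->|Gw] := eqVneq (G w) 0; first by rewrite normr0 addr_ge0.
  apply: (BP (`|B| + 1)); first by rewrite (le_lt_trans (ler_norm _))// ltrDl.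
  have [t t01 Et] := circle_repr_itv w.2.
  exists (w.1, t); last by rewrite /f /= Et -surjective_pairing.
  by split => //; exists w => //; exact: subset_closure.
split; [exists (`|B| + 1)|exists (- (`|B| + 1))] => _ [w _ <-].
  exact: le_trans (ler_norm _) (GB w).
by have := GB w; rewrite ler_norml => /andP[].
Qed.

(** Room for three layers of width [e] in the radius: the transition of the energy cutoff, a gap in
    which the function [F] is already 0, and the transition of the radial cutoff of [H]. *)
Lemma ereal_margin {R : realType} (a : R) (rho : \bar R) : (a%:E < rho)%E ->
  exists e : R, 0 < e /\ ((a + 3 * e)%:E < rho)%E.
Proof.
case: rho => [r| |]//; last by exists 1; rewrite ltry.
rewrite lte_fin => ar; exists ((r - a) / 4); rewrite divr_gt0 ?subr_gt0//; split => //.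
by rewrite lte_fin; lra.
Qed.

Theorem theorem1p12 (R : realType) (M : symp_data R)
  (M_symp : is_symplectic_manifold M) (M_conn : connected [set: M])
  (X0 X1 Y0 Y1 : set M)
  (X0_compact : compact X0) (X1_compact : compact X1)
  (Y0_compact : compact Y0) (Y1_compact : compact Y1)
  (X01 : X0 `&` X1 = set0) (Y01 : Y0 `&` Y1 = set0)
  (rho : \bar R) (rho_gt1 : (1%:E < rho)%E)
  (p : R) (p_gt0 : 0 < p)
  (pb4_eq : pb4 (stab (rho := rho) X0) (stab (rho := rho) X1)
                (stab (rho := rho) Y0) (stab (rho := rho) Y1) = p%:E)
  (G : M * circle R -> R)
  (G_Cc : Cc_infty (N := prod_mfd M (circle_mfd R)) G)
  (G_Y0 : forall (t : circle R) (y : M), Y0 y -> G (y, t) <= 0)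
  (G_Y1 : forall (t : circle R) (y : M), Y1 y -> 1 <= G (y, t))
  (* max and min are attained, as G is continuous with compact support *)
  (G_osc : ((sup (range G) - inf (range G))%:E < rho)%E)
  (g : R -> M -> M)
  (g_flow : is_hamiltonian_flow (fun t x => G (x, to_circle t)) g) :
  exists (x : M) (t0 t1 : R),
    [/\ `|t0 - t1| <= 1 / p, X0 (g t0 x) & X1 (g t1 x)].
Proof.
apply: contrapT => nochord.
have mM := symp_manifold M_symp.
have [sG cG] := G_Cc.
have [Gub Glb] := smooth_fun_bounded mM G_Cc.
set m1 := sup (range G) in G_osc; set m0 := inf (range G) in G_osc.
have Gm1 w : G w <= m1 by apply: sup_upper_bound; [split => //; exists (G w), w|exists w].
have Gm0 w : m0 <= G w by apply: inf_lbound => //; exists w.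
(* The maximum with 0 gives nonnegativity without choosing a point of [M]; should the difference be
   negative, [rho_gt1] yields osc < rho. *)
pose osc := Num.max 0 (m1 - m0).
have osc_ge0 : 0 <= osc by rewrite le_max lexx.
have m10 : m1 - m0 <= osc by rewrite le_max lexx orbT.
have osc_rho : (osc%:E < rho)%E.
  rewrite /osc; have [h|h] := leP 0 (m1 - m0) => //.
  by apply: lt_trans rho_gt1; rewrite lte_fin.
have rho0 : (0%:E < rho)%E by apply: le_lt_trans osc_rho; rewrite lee_fin.
have [e [e0 oscE]] := ereal_margin osc_rho.
pose K1 : set M := fst @` closure [set w : prod_mfd M (circle_mfd R) | G w != 0].
have cK1 : compact K1.
  apply: continuous_compact cG; apply: continuous_subspaceT => w; exact: cvg_fst.
have K1cl : closed K1 by apply: compact_closed => //; exact: mfd_hausdorff mM.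
have G0 x c : ~ K1 x -> G (x, c) = 0.
  move=> nx; apply: contrapT => /eqP Gn; apply: nx; exists (x, c) => //.
  exact: subset_closure.
pose K := K1 `|` (X0 `|` X1).
have [n [ic [cc [rr [rr0 rr_cim Kcore]]]]] := coordinate_ball_cover mM (compactU cK1 (compactU X0_compact X1_compact)).
have noch x t0 t1 : `|t0 - t1| <= 1 / p -> X0 (g t0 x) -> X1 (g t1 x) -> False.
  by move=> tt h0 h1; apply: nochord; exists x, t0, t1.
have K1K : K1 `<=` K by move=> x; left.
have X0K : X0 `<=` K by move=> x; right; left.
have X1K : X1 `<=` K by move=> x; right; right.
have T0 : 0 < 1 / p by rewrite divr_gt0.
have [T' TT' mk] := almost_first_integral M_symp rr0 rr_cim sG K1cl G0 K1K Kcore g_flow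
  X0_compact X1_compact X0K X1K T0 noch.
have T'p : 1 / T' < p.
  by move: TT'; rewrite !div1r => h; rewrite -[ltRHS]invrK ltf_pV2// posrE ?invr_gt0// (lt_trans _ h)// invr_gt0.
(* From T' > 1 / p one has 1 / T' < p; half of the gap is spent as error, so that C < p. *)
have eps0 : 0 < (p - 1 / T') / 2 by rewrite divr_gt0// subr_gt0.
have [Ft [sF Fper F_0 FX Fle]] := mk _ eps0.
set C := 1 / T' + _ in Fle.
have Cp : C < p by rewrite /C; lra.
pose h := emb ic cc rr.
pose S0 := emb_supp ic cc rr.
have cS0 : compact S0 := emb_supp_compact M_symp rr_cim.
have clS0 : closed S0 by apply: compact_closed => //; exact: mfd_hausdorff mM.
(* [chi] is 1 near [S0], outside which F vanishes, so that it does not disturb H there; and it is 1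
   on [Y1], where H must be at least 1. *)
have [chi [schi chi0 [S [cS chiS]] [Oc [oO KO chi1]]]] :=
  manifold_cutoff M_symp (compactU cS0 (compactU Y0_compact Y1_compact)).
(* On the zero section the energy is G, with values in [m0, m1]; there [bb] is 1, and F keeps the
   values of [Ft]. *)
pose bb := plateau m0 m1 e.
pose phiF := integral_cutoff G h Ft bb.
(* F vanishes for |r| >= osc + e, while the radial cutoff of H is 1 up to [rad] and 0 from rad + e =
   osc + 3 e on, which is below [rho]. *)
pose rad := osc + 2 * e.
pose phiH (w : M * (R * circle R)) := energy G w * plateau (- rad) rad e w.2.1 * chi w.1.
have Fper' y (t : R) : Ft (row_mx y (const_mx (circle_repr (to_circle t)))) = Ft (row_mx y (const_mx t)).
  have /to_circle_eq/intrP[k kE] : to_circle t = to_circle (circle_repr (to_circle t)) by rewrite circle_reprK.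
  rewrite -[RHS](periodicZ Fper k); congr Ft.
  rewrite /tvec scale_row_mx add_row_mx scaler0 addr0; congr row_mx.
  apply/rowP => l; rewrite !mxE mulr1; move: kE; lra.
have hdiff i y : cim (atlas M i) y -> differentiable (h \o cinv (atlas M i)) y.
  by move=> iy; exact: (emb_diff M_symp rr0 rr_cim iy).
have Fdiff y : differentiable Ft y by exact: (smooth_on_diff sF).
have Fle' i x t : cdom (atlas M i) x ->
  `|'D_(row_mx ('D_(sgrad i (Gt G t) x) (h \o cinv (atlas M i)) (cmap (atlas M i) x)) (const_mx 1))
     Ft (row_mx (h x) (const_mx t))| <= C.
  move=> dx; rewrite -(ext_field_emb M_symp rr0 rr_cim sG K1cl G0 K1K Kcore t dx).
  exact: Fle.
have h0 x : ~ S0 x -> h x = 0 by move=> nx; exact: (emb_out M_symp rr0 nx).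
have phiF_out x w : ~ S0 x -> phiF (x, w) = 0.
  by move=> /h0 hx; rewrite /phiF /integral_cutoff /= hx F_0 ?mul0r// row_mxKl.
(* For r >= osc + e the energy is at least m1 + e, and for r <= - (osc + e) it is at most m0 - e. *)
have phiF_far x s c : osc + e <= `|s| -> phiF (x, (s, c)) = 0.
  move=> sE; rewrite /phiF /integral_cutoff /bb plateau_0 ?mulr0//.
  rewrite /energy /=; move: sE (Gm0 (x, c)) (Gm1 (x, c)).
  by rewrite ler_normr => /orP[sE|sE] g0 g1; apply/orP; [right|left]; lra.
have lt_rho a : a <= osc + 3 * e -> (a%:E < rho)%E.
  by move=> h1; apply: le_lt_trans oscE; rewrite lee_fin.
have CcF : Cc_infty (N := prod_symp M (annulus rho)) (on_annulus phiF).
  split.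
    apply: (smooth_on_annulus M_symp rho0) => i.
    have oI := @open_annulus_dom _ _ M_symp i.
    have -> : lift_annulus i phiF = (fun v => Ft (embed_coord h i v) * bb (lift_annulus i (energy G) v)).
      by apply/funext => v; exact: lift_integral_cutoff.
    apply: smooth_mul => //; last by apply: smooth_plateau => //; exact: smooth_lift_energy.
    apply: (@smooth_comp _ _ _ (annulus_dom i) setT (embed_coord h i) Ft oI _ _ sF) => //.
    apply: smoothV_row_mx => k.
      apply: (@smooth_comp _ _ _ (annulus_dom i) _ (lsubmx : 'rV[R]_(mdim M + (1 + 1)) -> _)
        (fun y => h (cinv (atlas M i) y) 0 k) oI _ _ (emb_chart_smooth M_symp rr0 rr_cim k)) => //.
      exact: smoothV_lsubmx.
    rewrite (_ : (fun y => _) = (fun v : 'rV[R]_(mdim M + (1 + 1)) => v 0 (rshift (mdim M) (rshift 1 0)))).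
      exact: smooth_coordf.
    by apply/funext => v; rewrite /angle_of !mxE.
  apply: (compact_on_annulus M_symp (r := osc + e) cS0).
  - lra.
  - apply: lt_rho; lra.
  - by move=> x s c [/phiF_out//|/ltW/phiF_far].
have CcH : Cc_infty (N := prod_symp M (annulus rho)) (on_annulus phiH).
  split.
    apply: (smooth_on_annulus M_symp rho0) => i.
    have oI := @open_annulus_dom _ _ M_symp i.
    have -> : lift_annulus i phiH = (fun v => lift_annulus i (energy G) v *
      plateau (- rad) rad e (radius_of v) * (chi \o cinv (atlas M i)) (lsubmx v)) by [].
    apply: smooth_mul => //.
      apply: smooth_mul => //; first exact: smooth_lift_energy.
      apply: smooth_plateau => //; exact: smooth_radius.
    apply: (@smooth_comp _ _ _ (annulus_dom i) _ lsubmx _ oI _ _ (schi i)) => //.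
    exact: smoothV_lsubmx.
  apply: (compact_on_annulus M_symp (r := rad + e) cS).
  - rewrite /rad; lra.
  - apply: lt_rho; rewrite /rad; lra.
  - move=> x s c [/chiS xc|sE]; first by rewrite /phiH /= xc mulr0.
    rewrite /phiH /= plateau_0 ?mulr0 ?mul0r//.
    by move: sE => /ltW; rewrite ler_normr => /orP[sE|sE]; apply/orP; [right|left]; lra.
have bb1 x c : bb (energy G (x, (0, c))) = 1.
  by rewrite /bb plateau_1// /energy /= add0r Gm0 Gm1.
have rad0 : 0 <= rad by rewrite /rad; lra.
have H0 x c : phiH (x, (0, c)) = G (x, c) * chi x.
  by rewrite /phiH /energy /= add0r plateau_1 ?mulr1// oppr_le0 rad0.
have pbF : (p%:E <= unorm (poisson (N := prod_symp M (annulus rho)) (on_annulus phiF) (on_annulus phiH)))%E.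
  rewrite -pb4_eq; apply: ereal_inf_lbound; exists (on_annulus phiF), (on_annulus phiH); split => //.
  - split=> -[x [[s c] ?]] [/= Xx s0].
      by rewrite /on_annulus /= s0 /phiF /integral_cutoff /= (FX _ _).1// mul0r.
    by rewrite /on_annulus /= s0 /phiF /integral_cutoff (FX _ _).2// mul1r bb1.
  - split=> -[x [[s c] ?]] [/= Xx s0]; rewrite /on_annulus /= s0 H0.
      by rewrite mulr_le0_ge0// G_Y0.
    by rewrite chi1 ?mulr1 ?G_Y1//; apply: KO; right; right.
suff : (unorm (poisson (N := prod_symp M (annulus rho)) (on_annulus phiF) (on_annulus phiH)) <= C%:E)%E.
  by move=> /(le_trans pbF); rewrite lee_fin leNgt Cp.
apply: ub_ereal_sup => _ [z _ <-]; rewrite lee_fin.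
have C0 : 0 <= C by exact: le_trans (Fle 0).
have iz := @annulus_at_pt _ _ M_symp rho z.
set i := at_pt _ z in iz; set v := cmap (atlas (prod_symp M (annulus rho)) i) z.
have dx : cdom (atlas M i.1) z.1 by case: iz.
have xv : cinv (atlas M i.1) (@lsubmx _ _ (mdim M) (1 + 1) v) = z.1.
  by rewrite /v /= row_mxKl (mfd_mapK mM dx).
have xcont : {for v, continuous (fun y : 'rV[R]_(mdim M + (1 + 1)) => cinv (atlas M i.1) (lsubmx y))}.
  apply: (@continuous_comp _ _ _ (@lsubmx _ _ (mdim M) (1 + 1)) (cinv (atlas M i.1))).
    by apply: differentiable_continuous; exact: differentiable_lsubmx.
  by apply: (mfd_inv_cont mM); rewrite /v /= row_mxKl; exact: cim_cmap.
have rcont : {for v, continuous (@radius_of R M)} by exact: radius_cont.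
(* Off [Oc], or for |r| >= rad, F vanishes near [z] and so does the bracket; elsewhere H is the
   energy near [z] and [poisson_le] applies. *)
have [Oz|nOz] := pselect (Oc z.1); last first.
  rewrite (poisson_eq0 M_symp rho0) ?normr0// -/i -/v.
  have oS : open (~` S0) by exact: closed_openC.
  have nS : (~` S0) (cinv (atlas M i.1) (@lsubmx _ _ (mdim M) (1 + 1) v)).
    by rewrite xv => Sz; apply: nOz; apply: KO; left.
  have nO : \forall y \near v, (~` S0) (cinv (atlas M i.1) (@lsubmx _ _ (mdim M) (1 + 1) y)).
    exact: (xcont _ (open_nbhs_nbhs (conj oS nS))).
  apply: filterS nO => y yS.
  exact: phiF_out.
have [rz|rz] := ltP `|radius_of v| rad; last first.
  rewrite (poisson_eq0 M_symp rho0) ?normr0// -/i -/v.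
  have re : osc + e < `|radius_of v| by apply: lt_le_trans rz; rewrite /rad; lra.
  have ncont : {for v, continuous (fun y => `|radius_of y : R|)}.
    exact: (continuous_comp rcont (@norm_continuous _ _ _)).
  have nO : \forall y \near v, osc + e < `|radius_of y : R| by exact: (ncont _ (lt_nbhsr re)).
  apply: filterS nO => y yr.
  by apply: phiF_far; exact: ltW.
apply: (poisson_le M_symp rho0 sG hdiff Fdiff Fper' Fle').
- by move=> s; exact: differentiable_plateau.
- by move=> s; exact: plateau01.
rewrite -/i -/v.
have iv := near_annulus_cinv rho0 phiH (cim_cmap iz).
have Ov : Oc (cinv (atlas M i.1) (@lsubmx _ _ (mdim M) (1 + 1) v)) by rewrite xv.
have ncont : {for v, continuous (fun y => `|radius_of y : R|)}.
  exact: (continuous_comp rcont (@norm_continuous _ _ _)).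
have nO : \forall y \near v, Oc (cinv (atlas M i.1) (@lsubmx _ _ (mdim M) (1 + 1) y)).
  exact: (xcont _ (open_nbhs_nbhs (conj oO Ov))).
have nR : \forall y \near v, `|radius_of y : R| < rad by exact: (ncont _ (lt_nbhsl rz)).
near=> y.
rewrite (near iv y)// /lift_annulus /phiH /=.
rewrite plateau_1 ?mulr1//; last first.
  rewrite -ler_norml ltW//; near: y; exact: nR.
by rewrite chi1 ?mulr1//; near: y; exact: nO.
Unshelve. all: by end_near. Qed.
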